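(* For every integer $k\ge2$, the function germ $F_k:(\mathbb{C}^3,0)\to(\mathbb{C},0)$, $F_k(x,y,z)=\bar x\,y\,(x+z^k)$, has $0$ as an isolated critical value, has nonisolated singularities (i.e. $\operatorname{Sing}F_k$ is not contained in $\{0\}$ as a germ at $0$), and has Milnor tube fibration, but it is not Thom regular.
   Context: $F_k$ is viewed as a real analytic map germ $(\mathbb{R}^6,0)\to(\mathbb{R}^2,0)$; $\operatorname{Sing}F_k$ is the germ at $0$ of the set of points where its real differential has rank $<2$. Isolated critical value means $\operatorname{Sing}F_k\subset F_k^{-1}(0)$ as germs at $0$. Milnor tube fibration: a non-constant map germ $G:(\mathbb{R}^m,0)\to(\mathbb{R}^p,0)$, $m\ge p\ge1$, has Milnor tube fibration if $\operatorname{Sing}G\subset G^{-1}(0)$ and if, for any $\varepsilon>0$ small enough, there exists some positive $\eta\ll\varepsilon$ such that the restriction $G_|:\bar B^m_\varepsilon\cap G^{-1}(B^p_\eta\setminus\{0\})\to B^p_\eta\setminus\{0\}$ is a locally trivial fibration, the topological type of which is independent of the choices of $\varepsilon$ and $\eta$. Here $\bar B^m_\varepsilon$ is the closed ball of radius $\varepsilon$ at $0\in\mathbb{R}^m$ and $B^p_\eta$ the open ball of radius $\eta$ at $0\in\mathbb{R}^p$. Thom regularity. Let $G$ be a real analytic map defined on an open set $B\subset\mathbb{R}^m$. A Thom $(a_G)$-stratification of $G^{-1}(0)$ in $B$ is a locally finite partition of $B$ into connected semi-analytic real analytic submanifolds (strata) such that $G^{-1}(0)$ is a union of strata, the restriction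 of $G$ to each stratum has constant rank, and for every stratum $R\not\subset G^{-1}(0)$ and every stratum $S\subset G^{-1}(0)$ the Thom $(a_G)$ condition holds: if $x_k\in R$ converges to $x\in S$ and $\ker \mathrm{d}(G_{|R})_{x_k}$ converges to a linear subspace $T$, then $T_xS\subset T$. A map germ $G$ at $0$ is Thom regular if such a stratification exists in some neighbourhood of $0$. *)

(* Defs.v *)
From HB Require Import structures.
From mathcomp Require Import all_boot all_order all_algebra.
From mathcomp Require Import all_classical all_reals all_analysis.
From mathcomp Require Import complex.

Set Implicit Arguments.
Unset Strict Implicit.
Unset Printing Implicit Defensive.

Import Order.TTheory GRing.Theory Num.Theory.
Import numFieldNormedType.Exports.

Local Open Scope classical_set_scope.
Local Open Scope ring_scope.

(* Points of R^m are row vectors 'rV[R]_m.  A map germ at 0 is given by a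
   representative defined everywhere; a property of germs at 0 is a property
   holding on a neighbourhood of 0.  The library norm `|x| on 'rV[R]_m is the
   sup norm (it induces the usual topology), so the Euclidean norm, which
   defines the balls of the Milnor tube, is introduced separately. *)

Definition enorm (R : realType) (m : nat) (x : 'rV[R]_m) : R :=
  Num.sqrt (\sum_(i < m) x 0 i ^+ 2).

(* f is near a the sum of an absolutely convergent power series.  Partial sums
   are taken over the boxes {alpha | alpha_i < n for all i}; the absolute
   convergence makes the choice of the summation order irrelevant. *)
Definition analytic_at (R : realType) (m : nat) (f : 'rV[R]_m -> R)
    (a : 'rV[R]_m) : Prop :=
  exists (c : ('I_m -> nat) -> R) (r : R), 0 < r /\
    forall x : 'rV[R]_m, `|x - a| < r ->
      let term (alpha : 'I_m -> nat) :=
        c alpha * \prod_(i < m) (x 0 i - a 0 i) ^+ alpha i in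
      cvgn (fun n : nat => \sum_(alpha : {ffun 'I_m -> 'I_n})
                             `|term (fun i => alpha i : nat)|) /\
      (fun n : nat => \sum_(alpha : {ffun 'I_m -> 'I_n})
                        term (fun i => alpha i : nat)) @ \oo --> f x.

Definition analytic_on (R : realType) (m p : nat) (U : set 'rV[R]_m)
    (f : 'rV[R]_m -> 'rV[R]_p) : Prop :=
  forall a, U a -> forall i : 'I_p, analytic_at (fun x => f x 0 i) a.

(* Near every point of B (not only of X), X is a finite union of sets defined
   by finitely many analytic conditions f = 0 or f > 0. *)
Definition semianalytic (R : realType) (m : nat) (B X : set 'rV[R]_m) : Prop :=
  X `<=` B /\
  forall a, B a -> exists U : set 'rV[R]_m,
    [/\ open U, U a &
     exists (p q : nat) (f : 'I_p -> 'I_q -> 'rV[R]_m -> R)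
            (is_eq : 'I_p -> 'I_q -> bool),
       (forall i j x, U x -> analytic_at (f i j) x) /\
       (forall x, U x ->
          (X x <-> exists i, forall j,
                     if is_eq i j then f i j x = 0 else 0 < f i j x))].

(* Slice charts: phi is an analytic diffeomorphism from U onto V, with inverse
   psi, and sends M on the first d coordinates. *)
Definition analytic_submanifold (R : realType) (m : nat)
    (M : set 'rV[R]_m) : Prop :=
  exists2 d : nat, (d <= m)%N &
  forall a, M a -> exists (U V : set 'rV[R]_m) (phi psi : 'rV[R]_m -> 'rV[R]_m),
    [/\ open U /\ U a,
        open V,
        analytic_on U phi /\ analytic_on V psi,
        (forall x, U x -> V (phi x) /\ psi (phi x) = x) /\
        (forall y, V y -> U (psi y) /\ phi (psi y) = y) &
        forall x, U x -> (M x <-> forall i : 'I_m, (d <= i)%N -> phi x 0 i = 0)].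

(* T_x M: velocities at x of differentiable curves drawn on M. *)
Definition tangent_space (R : realType) (m : nat) (M : set 'rV[R]_m)
    (x : 'rV[R]_m) : set 'rV[R]_m :=
  [set v | exists gamma : R -> 'rV[R]_m,
     [/\ gamma 0 = x, (\forall t \near (0 : R), M (gamma t)) &
         is_derive (0 : R) (1 : R) gamma v]].

Definition row_space (R : realType) (n m : nat) (A : 'M[R]_(n, m)) :
    set 'rV[R]_m := [set v | (v <= A)%MS].

(* The rank at x of the restriction of G to the submanifold M is r; note that
   'd G x v = v *m jacobian G x. *)
Definition restriction_rank (R : realType) (m p : nat)
    (G : 'rV[R]_m -> 'rV[R]_p) (M : set 'rV[R]_m) (x : 'rV[R]_m) (r : nat) :
    Prop :=
  exists A : 'M[R]_m, tangent_space M x = row_space A /\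
                      \rank (A *m jacobian G x) = r.

Definition ker_restriction (R : realType) (m p : nat)
    (G : 'rV[R]_m -> 'rV[R]_p) (M : set 'rV[R]_m) (x : 'rV[R]_m) :
    set 'rV[R]_m :=
  tangent_space M x `&` [set v | 'd G x v = 0].

Definition orthogonal_projector (R : realType) (m : nat) (P : 'M[R]_m)
    (V : set 'rV[R]_m) : Prop :=
  [/\ P^T = P, P *m P = P & V = row_space P].

(* Convergence in the Grassmannian, for the usual metric given by the distance
   between orthogonal projectors. *)
Definition subspace_cvg (R : realType) (m : nat) (V : nat -> set 'rV[R]_m)
    (T : set 'rV[R]_m) : Prop :=
  exists (PV : nat -> 'M[R]_m) (PT : 'M[R]_m),
    [/\ forall n, orthogonal_projector (PV n) (V n),
        orthogonal_projector PT T & PV @ \oo --> PT].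

Definition Sing (R : realType) (m p : nat) (G : 'rV[R]_m -> 'rV[R]_p) :
    set 'rV[R]_m := [set x | (\rank (jacobian G x) < p)%N].

Definition isolated_critical_value (R : realType) (m p : nat)
    (G : 'rV[R]_m -> 'rV[R]_p) : Prop :=
  \forall x \near (0 : 'rV[R]_m), Sing G x -> G x = 0.

Definition nonisolated_singularities (R : realType) (m p : nat)
    (G : 'rV[R]_m -> 'rV[R]_p) : Prop :=
  ~ (\forall x \near (0 : 'rV[R]_m), Sing G x -> x = 0).

Definition thom_condition (R : realType) (m p : nat)
    (G : 'rV[R]_m -> 'rV[R]_p) (M S : set 'rV[R]_m) : Prop :=
  forall (x_ : nat -> 'rV[R]_m) (x : 'rV[R]_m) (T : set 'rV[R]_m),
    (forall n, M (x_ n)) -> S x -> x_ @ \oo --> x ->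
    subspace_cvg (fun n => ker_restriction G M (x_ n)) T ->
    tangent_space S x `<=` T.

Definition thom_stratification (R : realType) (m p : nat)
    (G : 'rV[R]_m -> 'rV[R]_p) (B : set 'rV[R]_m) (P : set (set 'rV[R]_m)) :
    Prop :=
  [/\ partition P id B /\
      (forall a, B a -> exists U : set 'rV[R]_m,
         [/\ open U, U a & finite_set [set S | P S /\ S `&` U !=set0]]),
      forall S, P S ->
        [/\ connected S, semianalytic B S & analytic_submanifold S],
      (exists2 Q : set (set 'rV[R]_m), Q `<=` P &
         B `&` G @^-1` [set 0] = \bigcup_(S in Q) S),
      (forall S, P S -> exists r : nat,
         forall x, S x -> restriction_rank G S x r) &
      forall M S, P M -> P S ->
        ~ (M `<=` G @^-1` [set 0]) -> S `<=` G @^-1` [set 0] ->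
        thom_condition G M S].

Definition thom_regular (R : realType) (m p : nat)
    (G : 'rV[R]_m -> 'rV[R]_p) : Prop :=
  exists B : set 'rV[R]_m,
    [/\ open B, B 0 & exists P, thom_stratification G B P].

(* f restricts to a homeomorphism from A onto B, with inverse given by g; both
   sets carry their subspace topology. *)
Definition homeo_between (T U : topologicalType) (A : set T) (B : set U)
    (f : T -> U) (g : U -> T) : Prop :=
  [/\ {within A, continuous f}, {within B, continuous g},
      forall x, A x -> B (f x) /\ g (f x) = x &
      forall y, B y -> A (g y) /\ f (g y) = y].

(* f : X -> Y is locally trivial: every b in Y has an open neighbourhood V in Y
   with f^-1(V) homeomorphic over V to V * f^-1(b) (any fibre of a local
   trivialization over V is homeomorphic to f^-1(b)). *)
Definition locally_trivial (T U : topologicalType) (X : set T) (Y : set U)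
    (f : T -> U) : Prop :=
  (forall x, X x -> Y (f x)) /\
  forall b, Y b -> exists V : set U,
    [/\ open V, V b &
     exists (h : T -> T) (g : U * T -> T),
       homeo_between (X `&` f @^-1` (V `&` Y))
                     ((V `&` Y) `*` (X `&` f @^-1` [set b]))
                     (fun x => (f x, h x)) g].

Definition top_equivalent (T U : topologicalType)
    (X : set T) (Y : set U) (f : T -> U)
    (X' : set T) (Y' : set U) (f' : T -> U) : Prop :=
  exists (Phi Phi' : T -> T) (phi phi' : U -> U),
    [/\ homeo_between X X' Phi Phi', homeo_between Y Y' phi phi' &
        forall x, X x -> f' (Phi x) = phi (f x)].

Definition punctured_ball (R : realType) (p : nat) (eta : R) : set 'rV[R]_p :=
  [set y | enorm y < eta /\ y != 0].

Definition milnor_tube (R : realType) (m p : nat) (G : 'rV[R]_m -> 'rV[R]_p)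
    (eps eta : R) : set 'rV[R]_m :=
  [set x | enorm x <= eps /\ punctured_ball eta (G x)].

(* "eps small enough" is eps <= eps0 and "eta << eps" is eta <= eta0 eps, with
   eta0 eps a positive bound depending on eps. *)
Definition milnor_tube_fibration (R : realType) (m p : nat)
    (G : 'rV[R]_m -> 'rV[R]_p) : Prop :=
  [/\ ~ (exists c, \forall x \near (0 : 'rV[R]_m), G x = c),
      isolated_critical_value G &
      exists (eps0 : R) (eta0 : R -> R),
        let admissible (eps eta : R) :=
          (0 < eps <= eps0) && (0 < eta <= eta0 eps) in
        [/\ 0 < eps0,
            forall eps, 0 < eps <= eps0 -> 0 < eta0 eps < eps,
            forall eps eta, admissible eps eta ->
              locally_trivial (milnor_tube G eps eta) (punctured_ball eta) G &
            forall eps eta eps' eta',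
              admissible eps eta -> admissible eps' eta' ->
              top_equivalent (milnor_tube G eps eta) (punctured_ball eta) G
                             (milnor_tube G eps' eta') (punctured_ball eta') G]].

(* F_k(x, y, z) = conj(x) * y * (x + z^k) on C^3 = R^6, with coordinates
   (Re x, Im x, Re y, Im y, Re z, Im z) and target C = R^2, (Re, Im). *)
Definition Fk (R : realType) (k : nat) (v : 'rV[R]_6) : 'rV[R]_2 :=
  let co (j : nat) := v 0 (inord j) in
  let x : R[i] := Complex (co 0) (co 1) in
  let y : R[i] := Complex (co 2) (co 3) in
  let z : R[i] := Complex (co 4) (co 5) in
  let w : R[i] := conjc x * y * (x + z ^+ k) in
  \row_(j < 2) if j == 0 then complex.Re w else complex.Im w.

(* Main.v *)
From HB Require Import structures.
Require Import Defs.
From mathcomp Require Import all_boot all_order all_algebra.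
From mathcomp Require Import all_classical all_reals all_analysis.
From mathcomp Require Import complex ring lra.

(* Write u = x + z^k and h = conj x * u, so that F = y h, and dF is onto as soon
   as h <> 0 because F is complex linear in y.

   Thom regularity fails along the y-axis: at (s, y, 0) with s <> 0, a vector of
   ker dF has its y-component in R.y, and this persists in the limit s -> 0,
   whereas among finitely many locally closed strata one must contain an arc of
   the y-axis that is transverse to R.y.

   Milnor tube. Where |F| = t we have |y| = t / |h|, so a point of the tube of
   radius eps amounts to a value w of F with |w| = t and a point (x, z) with
   |x|^2 + |z|^2 + t^2 / |h|^2 <= eps^2.  These sets of (x, z), for various
   (eps, t), are identified with one another by real scalings.
   - Along (e^(k l) x, e^l z) the left-hand side is a sum of exponentials of l,
     hence convex, and the sublevel set is a segment around an explicit centre,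
     provided (x, z) stays away from h = 0 (the core).  Segments are mapped onto
     segments affinely on each side of the centre.
   - Near x = 0, i.e. when 5 |x| <= |z|^k, the left-hand side decreases along
     (e^(2 k n) x, e^(-n) z) until the core is reached, so the sublevel set is a
     collar of the boundary of the core, rescaled linearly in n.
   - Near u = 0 the same is done after the involution (x, z) |-> (- u, z).
   The resulting maps depend continuously on all data and are mutually inverse. *)

Set Implicit Arguments.
Unset Strict Implicit.
Unset Printing Implicit Defensive.
Import Order.TTheory GRing.Theory Num.Theory.
Import numFieldNormedType.Exports.
Local Open Scope classical_set_scope.
Local Open Scope ring_scope.

(** * Coordinates and differential of the map *)

(** Thom regularity is the usual source of a tube fibration; as it fails here, the trivializing maps
    have to be written down explicitly. Since F = w is solved by y = w / h, every map of pairs (x,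
    z) that keeps h nonzero lifts to the fibres, and only the norm bound remains to be controlled.
    The scaling (e^(k l) x, e^l z) multiplies h by e^(2 k l). It cannot do the whole work: near h =
    0 the term t^2 / |h|^2 may exceed the bound along an entire orbit, so the orbit meets the tube
    for one pair (eps, t) and misses it for another. This is what the second scaling repairs. There
    |x| grows at rate 2k and |z|^k decays at rate k, so that |h|, comparable to |x| |z|^k, still
    grows and |y| falls, while the loss in |z|^2 outweighs the gain in |x|^2 because x is tiny
    beside z. All estimates are made on four real invariants of (x, z), which both scalings multiply
    by exponentials. *)

HB.lock Definition co (R : realType) (j : nat) (v : 'rV[R]_6) : R := v 0 (inord j).
Arguments co {R} j%_N v.

HB.lock Definition zre (R : realType) (k : nat) (v : 'rV[R]_6) : R :=
  complex.Re ((Complex (co 4 v) (co 5 v)) ^+ k).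
HB.lock Definition zim (R : realType) (k : nat) (v : 'rV[R]_6) : R :=
  complex.Im ((Complex (co 4 v) (co 5 v)) ^+ k).
Arguments zre {R} k%_N v.
Arguments zim {R} k%_N v.

Section Coordinates.
Variable R : realType.
Implicit Types (v w : 'rV[R]_6) (k : nat).

Lemma zre0 v : zre 0 v = 1. Proof. by rewrite zre.unlock. Qed.
Lemma zim0 v : zim 0 v = 0. Proof. by rewrite zim.unlock. Qed.

Lemma zreS k v : zre k.+1 v = co 4 v * zre k v - co 5 v * zim k v.
Proof. by rewrite zre.unlock zim.unlock exprS; case: (_ ^+ k) => a b. Qed.

Lemma zimS k v : zim k.+1 v = co 4 v * zim k v + co 5 v * zre k v.
Proof. by rewrite zre.unlock zim.unlock exprS; case: (_ ^+ k) => a b. Qed.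

Definition Fre k v : R :=
  (co 0 v * co 2 v + co 1 v * co 3 v) * (co 0 v + zre k v)
  - (co 0 v * co 3 v - co 1 v * co 2 v) * (co 1 v + zim k v).
Definition Fim k v : R :=
  (co 0 v * co 2 v + co 1 v * co 3 v) * (co 1 v + zim k v)
  + (co 0 v * co 3 v - co 1 v * co 2 v) * (co 0 v + zre k v).

Lemma FkE k v : Fk k v = \row_(j < 2) if j == 0 then Fre k v else Fim k v.
Proof.
apply/rowP => j; rewrite !mxE /Fre /Fim zre.unlock zim.unlock co.unlock.
by case: (_ ^+ k) => a b /=; case: ifP => _; ring.
Qed.

Lemma FkE0 k v : Fk k v 0 0 = Fre k v. Proof. by rewrite FkE mxE. Qed.
Lemma FkE1 k v : Fk k v 0 1 = Fim k v. Proof. by rewrite FkE mxE. Qed.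

Lemma differentiable_co j v : differentiable (co j) v.
Proof. by rewrite co.unlock; exact: differentiable_coord. Qed.

Lemma differentiable_zreim k v :
  differentiable (zre k) v /\ differentiable (zim k) v.
Proof.
elim: k => [|k [dr di]].
  by split; [rewrite (_ : zre 0 = cst 1)|rewrite (_ : zim 0 = cst 0)];
    rewrite //; apply/funext => w; rewrite ?zre0 ?zim0.
rewrite (_ : zre k.+1 = co 4 * zre k - co 5 * zim k); last first.
  by apply/funext => w; rewrite zreS.
rewrite (_ : zim k.+1 = co 4 * zim k + co 5 * zre k); last first.
  by apply/funext => w; rewrite zimS.
have d4 := differentiable_co 4 v; have d5 := differentiable_co 5 v.
by split; [apply: differentiableB|apply: differentiableD]; apply: differentiableM.
Qed.

Lemma differentiable_Freim k v :
  differentiable (Fre k) v /\ differentiable (Fim k) v.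
Proof.
have [dr di] := differentiable_zreim k v; have dc j := differentiable_co j v.
have dA : differentiable (co 0 * co 2 + co 1 * co 3) v.
  by apply: differentiableD; apply: differentiableM.
have dB : differentiable (co 0 * co 3 - co 1 * co 2) v.
  by apply: differentiableB; apply: differentiableM.
have dP : differentiable (co 0 + zre k) v by apply: differentiableD.
have dQ : differentiable (co 1 + zim k) v by apply: differentiableD.
split.
  exact: (differentiableB (differentiableM dA dP) (differentiableM dB dQ)).
exact: (differentiableD (differentiableM dA dQ) (differentiableM dB dP)).
Qed.

Lemma FkZ k : @Fk R k =
  (fun v => Fre k v *: delta_mx 0 0) + (fun v => Fim k v *: delta_mx 0 1).
Proof.
apply/funext => v; apply/rowP => j; rewrite FkE !mxE.
by case: j => [[|[|//]] ?]; rewrite /= ?mulr1 ?mulr0 ?addr0 ?add0r.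
Qed.

Lemma differentiable_Fk k v : differentiable (@Fk R k) v.
Proof.
rewrite FkZ; apply: differentiableD; apply: differentiableZl.
  exact: (differentiable_Freim k v).1.
exact: (differentiable_Freim k v).2.
Qed.

Lemma diff_Fk k v w : 'd (@Fk R k) v w =
  \row_(j < 2) if j == 0 then 'D_w (Fre k) v else 'D_w (Fim k) v.
Proof.
have dF := @differentiable_Fk k v.
rewrite -deriveE // derive_mx; last exact: diff_derivable.
have e0 : (fun t => @Fk R k t 0 0) = Fre k by apply/funext => t; rewrite FkE0.
have e1 : (fun t => @Fk R k t 0 1) = Fim k by apply/funext => t; rewrite FkE1.
apply/rowP => j; rewrite [LHS]mxE [RHS]mxE.
have [->|j0] := eqVneq j 0; first by rewrite e0.
have -> : j = 1 by apply/val_inj; case: j j0 => [[|[|]]].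
by rewrite e1.
Qed.

Lemma co_is_linear j : linear (co j : 'rV[R]_6 -> R).
Proof. by move=> a v w; rewrite co.unlock !mxE. Qed.

HB.instance Definition _ j :=
  GRing.isLinear.Build R 'rV[R]_6 R _ (co j) (@co_is_linear j).

Global Instance is_derive_co j v w : is_derive v w (co j) (co j w).
Proof.
have dc := differentiable_co j v.
apply: DeriveDef; first exact: diff_derivable.
rewrite deriveE // diff_lin // => x.
exact: differentiable_continuous (differentiable_co j x).
Qed.

Global Instance is_derive_zre k v w : is_derive v w (zre k) ('D_w (zre k) v).
Proof. by have [dr _] := differentiable_zreim k v; exact/derivableP/diff_derivable. Qed.
Global Instance is_derive_zim k v w : is_derive v w (zim k) ('D_w (zim k) v).
Proof. by have [_ dr] := differentiable_zreim k v; exact/derivableP/diff_derivable. Qed.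

End Coordinates.

(** * The singular locus and the kernel of the differential *)

Section Singularities.
Variable R : realType.
Implicit Types (v w : 'rV[R]_6) (k : nat).

Lemma derive_zreS k v w : 'D_w (zre k.+1) v =
  co 4 w * zre k v + co 4 v * 'D_w (zre k) v
  - (co 5 w * zim k v + co 5 v * 'D_w (zim k) v).
Proof.
rewrite (_ : zre k.+1 = co 4 * zre k - co 5 * zim k); last first.
  by apply/funext => u; rewrite zreS.
have := is_deriveB (is_deriveM (is_derive_co 4 v w) (is_derive_zre k v w))
  (is_deriveM (is_derive_co 5 v w) (is_derive_zim k v w)).
move=> [_ ->]; rewrite /GRing.scale /=.
move: (co 4 w) (co 4 v) (co 5 w) (co 5 v) ('D_w _ v) ('D_w _ v) (zre k v) (zim k v).
by move=> *; ring.
Qed.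

Lemma derive_zimS k v w : 'D_w (zim k.+1) v =
  co 4 w * zim k v + co 4 v * 'D_w (zim k) v
  + (co 5 w * zre k v + co 5 v * 'D_w (zre k) v).
Proof.
rewrite (_ : zim k.+1 = co 4 * zim k + co 5 * zre k); last first.
  by apply/funext => u; rewrite zimS.
have := is_deriveD (is_deriveM (is_derive_co 4 v w) (is_derive_zim k v w))
  (is_deriveM (is_derive_co 5 v w) (is_derive_zre k v w)).
move=> [_ ->]; rewrite /GRing.scale /=.
move: (co 4 w) (co 4 v) (co 5 w) (co 5 v) ('D_w _ v) ('D_w _ v) (zre k v) (zim k v).
by move=> *; ring.
Qed.

Lemma derive_zreim_const k v w : co 4 w = 0 -> co 5 w = 0 ->
  'D_w (zre k) v = 0 /\ 'D_w (zim k) v = 0.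
Proof.
move=> w4 w5; elim: k => [|k [ir ii]].
  have -> : @zre R 0 = cst 1 by apply/funext => u; exact: zre0.
  have -> : @zim R 0 = cst 0 by apply/funext => u; exact: zim0.
  by rewrite !derive_cst.
by rewrite derive_zreS derive_zimS ir ii w4 w5 !mul0r !mulr0 !addr0 subr0.
Qed.

Lemma zreim_at0 k v : co 4 v = 0 -> co 5 v = 0 ->
  zre k.+1 v = 0 /\ zim k.+1 v = 0.
Proof. by move=> v4 v5; rewrite zreS zimS v4 v5 !mul0r subrr addr0. Qed.

Lemma derive_zreim_at0 k v w : co 4 v = 0 -> co 5 v = 0 ->
  'D_w (zre k.+2) v = 0 /\ 'D_w (zim k.+2) v = 0.
Proof.
move=> v4 v5; have [zr zi] := zreim_at0 k v4 v5.
by rewrite derive_zreS (derive_zimS k.+1) v4 v5 zr zi !mul0r !mulr0 !addr0 subr0.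
Qed.

Lemma derive_Fre k v w : 'D_w (Fre k) v =
  (co 0 w * co 2 v + co 0 v * co 2 w + (co 1 w * co 3 v + co 1 v * co 3 w))
    * (co 0 v + zre k v)
  + (co 0 v * co 2 v + co 1 v * co 3 v) * (co 0 w + 'D_w (zre k) v)
  - ((co 0 w * co 3 v + co 0 v * co 3 w - (co 1 w * co 2 v + co 1 v * co 2 w))
    * (co 1 v + zim k v)
  + (co 0 v * co 3 v - co 1 v * co 2 v) * (co 1 w + 'D_w (zim k) v)).
Proof.
have dA : is_derive v w (co 0 * co 2 + co 1 * co 3) _ :=
  is_deriveD (is_deriveM (is_derive_co 0 v w) (is_derive_co 2 v w))
             (is_deriveM (is_derive_co 1 v w) (is_derive_co 3 v w)).
have dB := is_deriveB (is_deriveM (is_derive_co 0 v w) (is_derive_co 3 v w))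
                      (is_deriveM (is_derive_co 1 v w) (is_derive_co 2 v w)).
have dP := is_deriveD (is_derive_co 0 v w) (is_derive_zre k v w).
have dQ := is_deriveD (is_derive_co 1 v w) (is_derive_zim k v w).
have := is_deriveB (is_deriveM dA dP) (is_deriveM dB dQ) => -[_].
rewrite -/(Fre k) => ->.
rewrite /GRing.scale /= !(addrfctE, mulrfctE, opprfctE) /=.
move: ('D_w _ v) ('D_w _ v) (zre k v) (zim k v) (co 0 w) (co 0 v) (co 1 w) (co 1 v)
  (co 2 w) (co 2 v) (co 3 w) (co 3 v).
by move=> *; ring.
Qed.

Lemma derive_Fim k v w : 'D_w (Fim k) v =
  (co 0 w * co 2 v + co 0 v * co 2 w + (co 1 w * co 3 v + co 1 v * co 3 w))
    * (co 1 v + zim k v)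
  + (co 0 v * co 2 v + co 1 v * co 3 v) * (co 1 w + 'D_w (zim k) v)
  + ((co 0 w * co 3 v + co 0 v * co 3 w - (co 1 w * co 2 v + co 1 v * co 2 w))
    * (co 0 v + zre k v)
  + (co 0 v * co 3 v - co 1 v * co 2 v) * (co 0 w + 'D_w (zre k) v)).
Proof.
have dA := is_deriveD (is_deriveM (is_derive_co 0 v w) (is_derive_co 2 v w))
                      (is_deriveM (is_derive_co 1 v w) (is_derive_co 3 v w)).
have dB := is_deriveB (is_deriveM (is_derive_co 0 v w) (is_derive_co 3 v w))
                      (is_deriveM (is_derive_co 1 v w) (is_derive_co 2 v w)).
have dP := is_deriveD (is_derive_co 0 v w) (is_derive_zre k v w).
have dQ := is_deriveD (is_derive_co 1 v w) (is_derive_zim k v w).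
have := is_deriveD (is_deriveM dA dQ) (is_deriveM dB dP) => -[_].
rewrite -/(Fim k) => ->.
rewrite /GRing.scale /= !(addrfctE, mulrfctE, opprfctE) /=.
move: ('D_w _ v) ('D_w _ v) (zre k v) (zim k v) (co 0 w) (co 0 v) (co 1 w) (co 1 v)
  (co 2 w) (co 2 v) (co 3 w) (co 3 v).
by move=> *; ring.
Qed.

Lemma det_mx2 (T : comNzRingType) (N : 'M[T]_2) :
  \det N = N 0 0 * N 1 1 - N 0 1 * N 1 0.
Proof.
rewrite (expand_det_row _ 0) !big_ord_recl big_ord0 addr0 /cofactor !det_mx11 !mxE /=.
rewrite expr0 expr1 mul1r mulN1r mulrN.
by congr (_ * N _ _ - N _ _ * N _ _); apply/val_inj.
Qed.

Lemma diff_jacobian m n (G : 'rV[R]_m -> 'rV[R]_n) (x w : 'rV[R]_m) :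
  differentiable G x -> 'd G x w = w *m jacobian G x.
Proof. by move=> dG; rewrite -deriveE // deriveEjacobian. Qed.

Definition mk6 (a0 a1 a2 a3 a4 a5 : R) : 'rV[R]_6 :=
  \row_(j < 6) nth 0 [:: a0; a1; a2; a3; a4; a5] j.

Lemma co_mk6 (a0 a1 a2 a3 a4 a5 : R) :
  (co 0 (mk6 a0 a1 a2 a3 a4 a5) = a0) *
  (co 1 (mk6 a0 a1 a2 a3 a4 a5) = a1) *
  (co 2 (mk6 a0 a1 a2 a3 a4 a5) = a2) *
  (co 3 (mk6 a0 a1 a2 a3 a4 a5) = a3) *
  (co 4 (mk6 a0 a1 a2 a3 a4 a5) = a4) *
  (co 5 (mk6 a0 a1 a2 a3 a4 a5) = a5).
Proof. by rewrite co.unlock !mxE !inordK. Qed.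

Lemma mk6_eta v : mk6 (co 0 v) (co 1 v) (co 2 v) (co 3 v) (co 4 v) (co 5 v) = v.
Proof.
apply/rowP => j; rewrite mxE co.unlock.
by case: j => [[|[|[|[|[|[|//]]]]]] hj] /=; congr (v 0 _); apply/val_inj;
  rewrite /= inordK.
Qed.

Lemma Fk_regular k v : Fk k v != 0 -> ~ Sing (@Fk R k) v.
Proof.
move=> Fv0; rewrite /Sing /=; apply/negP; rewrite -leqNgt.
set P := co 0 v + zre k v; set Q := co 1 v + zim k v.
pose e (i : 'I_2) : 'rV[R]_6 :=
  if i == 0 then mk6 0 0 1 0 0 0 else mk6 0 0 0 1 0 0.
pose W : 'M[R]_(2, 6) := \matrix_(i < 2) e i.
(* The block of the differential in the two y-directions is multiplication by h, of determinant
   |h|^2 = |x|^2 |u|^2. *)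
pose N : 'M[R]_2 := W *m jacobian (@Fk R k) v.
have NE i j : N i j = 'd (@Fk R k) v (e i) 0 j.
  rewrite diff_jacobian; last exact: differentiable_Fk.
  have -> : e i = row i W by rewrite rowK.
  by rewrite -row_mul [RHS]mxE.
have z45 i : 'D_(e i) (zre k) v = 0 /\ 'D_(e i) (zim k) v = 0.
  by apply: derive_zreim_const; rewrite /e; case: ifP; rewrite !co_mk6.
have detN : \det N = (co 0 v ^+ 2 + co 1 v ^+ 2) * (P ^+ 2 + Q ^+ 2).
  have Fre_e i : 'D_(e i) (Fre k) v =
      if i == 0 then co 0 v * P + co 1 v * Q else co 1 v * P - co 0 v * Q.
    rewrite derive_Fre (z45 i).1 (z45 i).2 /e -/P -/Q.
    case: ifP => _; rewrite !co_mk6;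
    by rewrite !(mul0r, mulr0, mulr1, addr0, add0r, subr0, sub0r, mulNr, opprK).
  have Fim_e i : 'D_(e i) (Fim k) v =
      if i == 0 then co 0 v * Q - co 1 v * P else co 1 v * Q + co 0 v * P.
    rewrite derive_Fim (z45 i).1 (z45 i).2 /e -/P -/Q.
    case: ifP => _; rewrite !co_mk6;
    by rewrite !(mul0r, mulr0, mulr1, addr0, add0r, subr0, sub0r, mulNr, opprK).
  have N0 i : N i 0 = 'D_(e i) (Fre k) v by rewrite NE diff_Fk mxE.
  have N1 i : N i 1 = 'D_(e i) (Fim k) v by rewrite NE diff_Fk mxE.
  rewrite det_mx2 !N0 !N1 !Fre_e !Fim_e /=.
  by clear; move: P Q (co 0 v) (co 1 v) => *; ring.
have detN0 : \det N != 0.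
  apply: contra Fv0; rewrite detN mulf_eq0 => h.
  have {h} : (co 0 v = 0 /\ co 1 v = 0) \/ (P = 0 /\ Q = 0).
    by case/orP: h; rewrite paddr_eq0 ?sqr_ge0 // !sqrf_eq0 => /andP[/eqP ? /eqP ?];
      [left|right].
  rewrite FkE; move=> h; apply/eqP/rowP => j; rewrite !mxE /Fre /Fim -/P -/Q.
  by case: h => -[-> ->]; rewrite !(mul0r, mulr0, subrr, addr0, oppr0); case: ifP.
have rN : \rank N = 2%N by apply: mxrank_unit; rewrite unitmxE unitfE.
by have := mxrankM_maxr W (jacobian (@Fk R k) v); rewrite -/N rN.
Qed.

Lemma isolated_critical_value_Fk k : isolated_critical_value (@Fk R k).
Proof.
near=> v => Sv; apply/eqP; apply: contraT => Fv0; case: (Fk_regular Fv0 Sv).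
Unshelve. all: by end_near. Qed.

(** Both x and y vanish on the z-axis, so every term of the product rule keeps a zero factor. *)
Lemma Sing_Fk_z k (s : R) : Sing (@Fk R k) (mk6 0 0 0 0 s 0).
Proof.
rewrite /Sing /= (_ : jacobian _ _ = 0) ?mxrank0 //.
apply/row_matrixP => i; rewrite rowE row0 -diff_jacobian; last exact: differentiable_Fk.
apply/rowP => j; rewrite diff_Fk !mxE derive_Fre derive_Fim !co_mk6.
by rewrite !(mul0r, mulr0, subrr, addr0, oppr0); case: ifP.
Qed.

(** As z^k vanishes to order k >= 2, only |x|^2 y counts to first order at z = 0. Its differential
    is 2 Re(conj x dx) y + |x|^2 dy, so on the kernel dy is a real multiple of y. *)
Lemma ker_dFk_axis k (s y1 y2 : R) w : (2 <= k)%N -> s != 0 ->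
  'd (@Fk R k) (mk6 s 0 y1 y2 0 0) w = 0 -> y1 * co 3 w - y2 * co 2 w = 0.
Proof.
case: k => [|[|k]] // _ s0; rewrite diff_Fk => /rowP h.
have := h 1; have := h 0; rewrite !mxE /= derive_Fre derive_Fim.
set p := mk6 _ _ _ _ _ _; have p4 : co 4 p = 0 by rewrite co_mk6.
have p5 : co 5 p = 0 by rewrite co_mk6.
have [-> ->] := zreim_at0 k.+1 p4 p5.
have [-> ->] := derive_zreim_at0 k w p4 p5.
rewrite /p !co_mk6 => h0 h1.
have : s ^+ 2 * (y1 * co 3 w - y2 * co 2 w) = 0.
  (* The cross product with y removes the term parallel to y. *)
  have := congr2 (fun a b => y1 * a - y2 * b) h1 h0.
  rewrite !mulr0 subrr => <-.
  by move: (co 0 w) (co 1 w) (co 2 w) (co 3 w) => *; ring.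
by move/eqP; rewrite mulf_eq0 sqrf_eq0 (negbTE s0) /= => /eqP.
Qed.

End Singularities.

(** * Analytic functions and locally closed sets *)

Section AnalyticContinuous.
Variable R : realType.

(** Every monomial except the constant one carries a factor x_i - a_i, so bringing x closer to a by
    a factor l <= 1 shrinks each term by l. Comparison with one absolutely convergent series gives
    |f x - f a| <= l M. *)
Lemma analytic_continuous m (f : 'rV[R]_m -> R) (a : 'rV[R]_m) :
  analytic_at f a -> f x @[x --> a] --> f a.
Proof.
move=> [c [r [r0 /= cf]]].
have r20 : 0 < r / 2 by rewrite divr_gt0.
(* The corner of the cube of half-side r / 2: the terms at [b] dominate the terms at all points of
   that cube. *)
pose b : 'rV[R]_m := a + const_mx (r / 2).
pose term (x : 'rV[R]_m) (alpha : 'I_m -> nat) :=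
  c alpha * \prod_(i < m) (x 0 i - a 0 i) ^+ alpha i.
pose s x n := \sum_(alpha : {ffun 'I_m -> 'I_n}) term x (fun i => alpha i : nat).
have br : `|b - a| < r.
  rewrite /b addrAC subrr add0r [ltLHS]/Num.Def.normr /= mx_normrE.
  apply: (@le_lt_trans _ _ (r / 2)); last by rewrite ltr_pdivrMr // mulr_natr mulr2n ltrDl.
  by apply: bigmax_le => [|i _]; rewrite ?mxE ?ger0_norm // ltW.
have [cvb _] := cf b br.
have [M Mb] : exists M, forall n,
    \sum_(alpha : {ffun 'I_m -> 'I_n}) `|term b (fun i => alpha i : nat)| <= M.
  have [M [_ /(_ (M + 1)) hM]] := cvg_seq_bounded cvb.
  exists (M + 1) => n; have := hM _ n I; rewrite ltrDl ltr01 => /(_ isT).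
  by apply: le_trans; exact: ler_norm.
have M0 : 0 <= M by apply: le_trans (Mb 0%N); apply: sumr_ge0.
have key (x : 'rV[R]_m) (l : R) : 0 <= l <= 1 -> `|x - a| <= l * (r / 2) ->
    `|x - a| < r -> `|f x - f a| <= l * M.
  move=> /andP[l0 l1] xl xr.
  have sx : s x n @[n --> \oo] --> f x by have [_] := cf x xr.
  have sa : s a n @[n --> \oo] --> f a.
    by have := cf a; rewrite subrr normr0 => /(_ r0) [_].
  have sxa : `|s x n - s a n| @[n --> \oo] --> `|f x - f a|.
    exact: cvg_norm (cvgB sx sa).
  apply: (cvgr_to_le sxa); apply: nearW => n /=.
  rewrite -sumrB; apply: (le_trans (ler_norm_sum _ _ _)).
  apply: (@le_trans _ _ (l * \sum_(alpha : {ffun 'I_m -> 'I_n})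
      `|term b (fun i => alpha i : nat)|)); last by rewrite ler_wpM2l.
  rewrite mulr_sumr; apply: ler_sum => alpha _.
  rewrite /term -mulrBr !normrM mulrCA ler_wpM2l //.
  have [h|] := boolP [forall i, alpha i == 0%N :> nat].
    rewrite !big1 ?subrr ?normr0 ?mulr_ge0 // => i _;
    by rewrite (eqP (forallP h i)) expr0.
  rewrite negb_forall => /existsP[i ai].
  have -> : \prod_(i < m) (a 0 i - a 0 i) ^+ alpha i = 0.
    by rewrite (bigD1 i) //= subrr expr0n (negbTE ai) mul0r.
  rewrite subr0 !normr_prod.
  have xb j : `|x 0 j - a 0 j| <= l * (b 0 j - a 0 j).
    rewrite /b !mxE addrAC subrr add0r; apply: le_trans xl.
    rewrite [leRHS]/Num.Def.normr /= mx_normrE.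
    by apply: le_trans (le_bigmax _ _ (0, j)); rewrite !mxE.
  have b0 j : 0 <= b 0 j - a 0 j by rewrite /b !mxE addrAC subrr add0r ltW.
  rewrite [in leLHS](bigD1 i) //= [in leRHS](bigD1 i) //= mulrA.
  apply: ler_pM; rewrite ?prodr_ge0 //.
    rewrite !normrX (ger0_norm (b0 i)).
    apply: (@le_trans _ _ ((l * (b 0 i - a 0 i)) ^+ alpha i)).
      by apply: lerXn2r; rewrite ?nnegrE ?normr_ge0 ?mulr_ge0.
    rewrite exprMn ler_wpM2r ?exprn_ge0 //.
    case: (alpha i : nat) ai => // n0 _; rewrite exprS ler_piMr //.
    exact: exprn_ile1.
  apply: ler_prod => j _; rewrite normr_ge0 /= !normrX lerXn2r ?nnegrE //.
  apply: (le_trans (xb j)); rewrite (ger0_norm (b0 j)).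
  by rewrite ler_piMl.
apply/(@cvgrPdist_le _ _ _ (nbhs a) (nbhs_filter a)) => e e0.
pose l := Num.min 1 (e / (M + 1)).
have M1 : 0 < M + 1 by rewrite ltr_wpDl.
have l0 : 0 < l by rewrite lt_min ltr01 divr_gt0.
have d0 : 0 < l * (r / 2) by rewrite mulr_gt0.
apply: filterS (nbhsx_ballx a _ d0) => x.
rewrite -ball_normE /= => /ltW; rewrite distrC => xl.
rewrite distrC.
apply: (le_trans (key x l _ xl _)).
- by rewrite (ltW l0) /= ge_min lexx.
- apply: (le_lt_trans xl); apply: (@le_lt_trans _ _ (1 * (r / 2))).
    by rewrite ler_wpM2r ?(ltW r20) // ge_min lexx.
  by rewrite mul1r ltr_pdivrMr // mulr_natr mulr2n ltrDl.
- apply: (@le_trans _ _ (e / (M + 1) * (M + 1))).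
    apply: ler_pM => //; first exact: ltW.
      by rewrite ge_min lexx orbT.
    by rewrite lerDl.
  by rewrite divfK ?gt_eqF.
Qed.

Lemma analytic_on_coord m (U : set 'rV[R]_m) (phi : 'rV[R]_m -> 'rV[R]_m) i :
  analytic_on U phi -> {in U, continuous (fun x => phi x 0 i)}.
Proof. by move=> aphi a /set_mem Ua; exact/analytic_continuous/aphi. Qed.

End AnalyticContinuous.

(** * Finite covers by locally closed sets *)

Section LocallyClosed.

Definition locally_closed_set (T : topologicalType) (A : set T) :=
  forall a, A a -> exists U : set T, [/\ open U, U a & open (U `&` ~` A)].

(** Baire's argument for finitely many sets: either A fills a neighbourhood of one of its points in
    W, or removing A leaves a nonempty open set covered by the remaining sets. *)
Lemma locally_closed_cover (T : topologicalType) (s : seq (set T)) (W : set T) :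
  (forall A, A \in s -> locally_closed_set A) ->
  open W -> W !=set0 -> (forall x, W x -> exists2 A, A \in s & A x) ->
  exists A : set T, A \in s /\
    exists W' : set T, [/\ open W', W' !=set0, W' `<=` W & W' `<=` A].
Proof.
elim: s W => [|A s IH] W lcA oW W0 cW.
  by case: W0 => x /cW [].
have lcs B : B \in s -> locally_closed_set B.
  by move=> Bs; apply: lcA; rewrite in_cons Bs orbT.
have step (W2 : set T) : open W2 -> W2 !=set0 -> W2 `<=` W -> W2 `<=` ~` A ->
    exists B : set T, B \in A :: s /\
      exists W' : set T, [/\ open W', W' !=set0, W' `<=` W & W' `<=` B].
  move=> oW2 W20 W2W W2A.
  have [|B [Bs [W' [oW' W'0 W'W2 W'B]]]] := IH W2 lcs oW2 W20.
    move=> x W2x; have [B] := cW x (W2W _ W2x).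
    rewrite in_cons => /orP[/eqP -> Ax|Bs Bx]; last by exists B.
    by case: (W2A x W2x).
  exists B; split; first by rewrite in_cons Bs orbT.
  exists W'; split => //.
  exact: subset_trans W2W.
have [[a [Wa Aa]]|nWA] := pselect (W `&` A !=set0); last first.
  by refine (step W oW W0 _ _) => [//|x Wx Ax]; apply: nWA; exists x.
have [U [oU Ua oUA]] := lcA A (mem_head _ _) a Aa.
have [WUA|nWUA] := pselect (W `&` U `<=` A).
  exists A; split; first exact: mem_head.
  by exists (W `&` U); split; [exact: openI | exists a | move=> x [] | ].
have [||x [Wx _]|x [_ []]|B hB] := step (W `&` (U `&` ~` A)) => //.
- exact: openI.
- apply: contrapT => h; apply: nWUA => x [Wx Ux]; apply: contrapT => nAx.
  by apply: h; exists x.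
- by exists B.
Qed.

(** In a slice chart the complement is where one of the last coordinates is nonzero, an open
    condition because analytic functions are continuous. *)
Lemma submanifold_locally_closed (R : realType) m (M : set 'rV[R]_m) :
  analytic_submanifold M -> locally_closed_set M.
Proof.
move=> [d _ chart] a Ma.
have [U [V [phi [psi [[oU Ua] _ [aphi _] _ MU]]]]] := chart a Ma.
exists U; split => //.
rewrite openE => x [Ux nMx].
have [i [di pi0]] : exists i : 'I_m, (d <= i)%N /\ phi x 0 i != 0.
  apply: contrapT => h; apply: nMx; apply/(MU _ Ux) => i di.
  by apply/eqP; apply: contraT => ?; case: h; exists i.
have cphi := analytic_on_coord (i := i) aphi (mem_set Ux).
near=> y.
have Uy : U y by near: y; exact: open_nbhs_nbhs.
split=> // /(MU _ Uy) /(_ i di); apply/eqP.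
by near: y; exact: (cvgr_neq0 _ cphi pi0).
Unshelve. all: by end_near. Qed.

End LocallyClosed.

(** * Orthogonal projectors *)

Section Projectors.
Variable R : realType.

(** For a basis B of the row space the projector is B^T (B B^T)^-1 B; the Gram matrix is invertible
    because u B B^T = 0 forces |u B|^2 = 0. *)
Lemma orthogonal_projector_exists m n (A : 'M[R]_(n, m)) :
  exists P : 'M[R]_m, orthogonal_projector P (row_space A).
Proof.
pose B := row_base A; pose G := B *m B^T.
have freeB : row_free B := row_base_free A.
have Gu : G \in unitmx.
  rewrite -row_free_unit -kermx_eq0; apply/eqP/row_matrixP => i; rewrite row0.
  set u := row i _.
  have uG : u *m G = 0 by rewrite /u -row_mul mulmx_ker row0.
  have : (u *m B) *m (u *m B)^T = 0 by rewrite trmx_mul mulmxA -(mulmxA u) uG mul0mx.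
  move/matrixP/(_ 0 0); rewrite [LHS]mxE [RHS]mxE => /eqP.
  rewrite psumr_eq0 => [/allP h|j _]; last by rewrite [(_^T) _ _]mxE -expr2 sqr_ge0.
  have uB : u *m B = 0.
    apply/rowP => j; have := h j (mem_index_enum j).
    by rewrite [(_^T) _ _]mxE -expr2 sqrf_eq0 [RHS]mxE => /eqP.
  by apply: (row_free_inj freeB); rewrite uB mul0mx.
pose P := B^T *m (invmx G *m B).
have BP : B *m P = B by rewrite /P mulmxA mulmxA -/G mulmxV // mul1mx.
have GT : G^T = G by rewrite /G trmx_mul trmxK.
exists P; split.
- by rewrite /P (trmx_mul B^T) (trmx_mul _ B) trmxK trmx_inv GT -mulmxA.
- by rewrite {1}/P -(mulmxA B^T) -(mulmxA _ B P) BP.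
- apply/seteqP; split => v /= vA.
    have : (v <= B)%MS by rewrite eq_row_base.
    by move=> /submxP[w ->]; rewrite -BP mulmxA; exact: submxMl.
  apply: (submx_trans vA); rewrite -(eq_row_base A) -/B /P mulmxA.
  exact: submxMl.
Qed.

(** A symmetric idempotent satisfies P_ii = sum_k P_ik^2, whence P_ii <= 1 and then P_ij^2 <= 1.
    This is what makes sequences of kernels relatively compact. *)
Lemma orthogonal_projector_bound m (P : 'M[R]_m) V i j :
  orthogonal_projector P V -> -1 <= P i j <= 1.
Proof.
move=> [PT fibre_norm _]; rewrite -ler_norml.
have Pii : P i i = \sum_k P i k ^+ 2.
  by rewrite -{1}fibre_norm -{2}PT mxE; apply: eq_bigr => k _; rewrite mxE expr2.
have le1 k : P i k ^+ 2 <= P i i.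
  by rewrite Pii (bigD1 k) //= lerDl sumr_ge0 // => l _; rewrite sqr_ge0.
have Pii0 : 0 <= P i i by apply: le_trans (le1 i); rewrite sqr_ge0.
have Pii1 : P i i <= 1.
  have [//|P1] := leP (P i i) 1.
  by have := le1 i; move: P1; move: (P i i) => p; nra.
rewrite -(@ler_pXn2r _ 2) ?nnegrE // expr1n real_normK ?num_real //.
exact: le_trans (le1 j) Pii1.
Qed.

Lemma cvg_mx (T : Type) (F : set_system T) (FF : Filter F) m n
    (M : T -> 'M[R]_(m, n)) (L : 'M[R]_(m, n)) :
  (forall i j, M x i j @[x --> F] --> L i j) -> M @ F --> L.
Proof.
move=> h; apply/cvgrPdist_le => e e0.
have : \forall x \near F, forall ij : 'I_m * 'I_n, `|L ij.1 ij.2 - M x ij.1 ij.2| <= e.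
  by apply: filter_forall => -[i j]; exact: (cvgrPdist_le _ _).1 (h i j) _ e0.
apply: filterS => x hx.
rewrite [leLHS]/Num.Def.normr /= mx_normrE (bigmax_le _ (ltW e0)) //= => ij _.
by rewrite !mxE.
Qed.

(** Bolzano-Weierstrass on the cube of entries. The condition k <= phi k, weaker than monotonicity,
    already carries limits along [phi]. *)
Lemma mx_bounded_subsequence m n (M : nat -> 'M[R]_(m, n)) :
  (forall k i j, -1 <= M k i j <= 1) ->
  exists (phi : nat -> nat) (L : 'M[R]_(m, n)),
    (forall k, (k <= phi k)%N) /\ M (phi k) @[k --> \oo] --> L.
Proof.
move=> Mb; pose w k := mxvec (M k).
pose A : set 'rV[R]_(m * n) := [set v | forall i, `[(-1 : R), 1]%classic (v ord0 i)].
have cA : compact A.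
  by apply: (rV_compact (A := fun=> `[(-1 : R), 1]%classic)) => i; exact: segment_compact.
have [v [_ cv]] : A `&` cluster (w @ \oo) !=set0.
  apply: cA; exists 0%N => // k _ i /=.
  by case/mxvec_indexP: i => i j; rewrite /w mxvecE in_itv /= Mb.
have sub k : exists l, (k <= l)%N /\ `|v - w l| < k.+1%:R^-1.
  have k0 : 0 < k.+1%:R^-1 :> R by rewrite invr_gt0.
  have vb : nbhs v (ball v k.+1%:R^-1) by exact: nbhsx_ballx.
  have wk : (w @ \oo) (w @` [set l | (k <= l)%N]) by exists k => // l kl; exists l.
  have [y [[l kl <-]]] := cv _ _ wk vb.
  by rewrite -ball_normE => yb; exists l.
have [phi hphi] := choice sub.
exists phi, (vec_mx v); split => [k|]; first exact: (hphi k).1.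
apply: cvg_mx => i j; rewrite mxE; apply/cvgrPdist_le => e e0.
near=> k.
apply: (@le_trans _ _ k.+1%:R^-1).
  apply: le_trans (ltW (hphi k).2).
  rewrite [leRHS]/Num.Def.normr /= mx_normrE.
  apply: le_trans (le_bigmax _ _ (0, mxvec_index i j)).
  by rewrite [X in _ <= `|X|]mxE [X in _ <= `|_ + X|]mxE mxvecE.
by apply: ltW; near: k; exact: (near_infty_natSinv_lt (PosNum e0)).
Unshelve. all: by end_near. Qed.

End Projectors.

(** * Failure of Thom regularity *)

Section ThomPreliminaries.
Variable R : realType.

Lemma nbhs0_mk6 (U : set 'rV[R]_6) : nbhs (0 : 'rV[R]_6) U ->
  exists r : R, 0 < r /\ forall a0 a1 a2 a3 a4 a5 : R,
    `|a0| <= r -> `|a1| <= r -> `|a2| <= r -> `|a3| <= r -> `|a4| <= r -> `|a5| <= r ->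
    U (mk6 a0 a1 a2 a3 a4 a5).
Proof.
move=> /nbhs_ballP[e /= e0 eU]; exists (e / 2); split; first by rewrite divr_gt0.
move=> a0 a1 a2 a3 a4 a5 h0 h1 h2 h3 h4 h5; apply: eU.
rewrite -ball_normE /= sub0r normrN.
apply: (@le_lt_trans _ _ (e / 2)); last by rewrite ltr_pdivrMr // mulr_natr mulr2n ltrDl.
rewrite [leLHS]/Num.Def.normr /= mx_normrE.
apply: bigmax_le => [|[i j] _]; first by rewrite divr_ge0 // ltW.
by rewrite mxE; case: j => [[|[|[|[|[|[|//]]]]]] hj].
Qed.

Lemma pigeonhole_seq (T : eqType) (s : seq T) (Q : T -> nat -> Prop) :
  (forall n, exists2 M, M \in s & Q M n) ->
  exists2 M, M \in s & forall N, exists n, (N <= n)%N /\ Q M n.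
Proof.
move=> h; apply: contrapT => nQ.
have : exists N, forall M, M \in s -> forall n, (N <= n)%N -> ~ Q M n.
  have {h} : forall M, M \in s -> exists N, forall n, (N <= n)%N -> ~ Q M n.
    move=> M Ms; apply: contrapT => nN; apply: nQ; exists M => // N.
    apply: contrapT => nn; apply: nN; exists N => n Nn QMn; apply: nn.
    by exists n.
  elim: s {nQ} => [|M s IH] hs; first by exists 0%N.
  have [N1 hN1] := hs M (mem_head _ _).
  have [|N2 hN2] := IH; first by move=> M' M's; apply: hs; rewrite in_cons M's orbT.
  exists (maxn N1 N2) => M'; rewrite in_cons => /orP[/eqP ->|M's] n;
    rewrite geq_max => /andP[n1 n2]; [exact: hN1|exact: hN2].
by move=> [N hN]; have [M Ms QM] := h N; exact: (hN M Ms N (leqnn _) QM).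
Qed.

Lemma nonisolated_singularities_Fk k : nonisolated_singularities (@Fk R k).
Proof.
move=> /nbhs0_mk6[r [r0 h]].
have r00 : `|0 : R| <= r by rewrite normr0 ltW.
have rr : `|r| <= r by rewrite ger0_norm // ltW.
have /(congr1 (co 4)) := h 0 0 0 0 r 0 r00 r00 r00 r00 rr r00 (Sing_Fk_z k r).
by rewrite co_mk6 co.unlock mxE => r0'; rewrite r0' ltxx in r0.
Qed.

Lemma Fk_z0 k (a y1 y2 : R) : (0 < k)%N ->
  Fk k (mk6 a 0 y1 y2 0 0) = \row_(j < 2) (a ^+ 2 * if j == 0 then y1 else y2).
Proof.
case: k => // k _; apply/rowP => j; rewrite FkE !mxE /Fre /Fim.
set p := mk6 _ _ _ _ _ _; have p4 : co 4 p = 0 by rewrite co_mk6.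
have p5 : co 5 p = 0 by rewrite co_mk6.
have [-> ->] := zreim_at0 k p4 p5; rewrite /p !co_mk6.
by case: ifP => _; ring.
Qed.

Lemma Fk_nonconstant k : (0 < k)%N ->
  ~ (exists c, \forall x \near (0 : 'rV[R]_6), Fk k x = c).
Proof.
move=> k0 [c /nbhs0_mk6[r [r0 h]]].
have r00 : `|0 : R| <= r by rewrite normr0 ltW.
have rr : `|r| <= r by rewrite ger0_norm // ltW.
have := h 0 0 0 0 0 0 r00 r00 r00 r00 r00 r00.
rewrite -(h r 0 r 0 0 0 rr r00 rr r00 r00 r00) !Fk_z0 // => /rowP/(_ 0).
rewrite !mxE /= mulr0 => /esym/eqP.
by rewrite mulf_eq0 sqrf_eq0 orbb gt_eqF.
Qed.

(** Symmetry and idempotence are closed conditions, so a limit of projectors is the projector onto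
    its own row space. *)
Lemma orthogonal_projector_lim m (P : nat -> 'M[R]_m) (V : nat -> set 'rV[R]_m)
    (L : 'M[R]_m) :
  (forall n, orthogonal_projector (P n) (V n)) -> P n @[n --> \oo] --> L ->
  orthogonal_projector L (row_space L).
Proof.
move=> hP PL.
have cP i j : P n i j @[n --> \oo] --> L i j.
  exact: (cvg_comp P (fun M : 'M[R]_m => M i j) PL (@coord_continuous _ _ _ i j L)).
split => //.
- apply/matrixP => i j; rewrite mxE.
  have cPT : P n j i @[n --> \oo] --> L i j.
    apply: cvg_trans (cP i j); apply: near_eq_cvg; apply: nearW => n /=.
    by have [PT _ _] := hP n; rewrite -{1}PT mxE.
  exact: (cvg_unique _ (cP j i) cPT).
- apply/matrixP => i j; rewrite mxE.
  have cPP : P n i j @[n --> \oo] --> \sum_k L i k * L k j.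
    have cS : \sum_k P n i k * P n k j @[n --> \oo] --> \sum_k L i k * L k j.
      by apply: cvg_big => [|k _]; [exact: add_continuous|exact: cvgM].
    apply: cvg_trans cS; apply: near_eq_cvg; apply: nearW => n /=.
    by have [_ fibre_norm _] := hP n; rewrite -{3}fibre_norm mxE.
  exact: (cvg_unique _ cPP (cP i j)).
Qed.

Lemma ker_restriction_row_space m p (G : 'rV[R]_m -> 'rV[R]_p) M x r :
  differentiable G x -> restriction_rank G M x r ->
  exists A : 'M[R]_m, ker_restriction G M x = row_space A.
Proof.
move=> dG [A [TA _]]; exists (A :&: kermx (jacobian G x))%MS.
rewrite /ker_restriction TA; apply/seteqP; split => v.
  move=> [vA dv]; rewrite /row_space /mkset sub_capmx vA /=; apply/sub_kermxP.
  by rewrite -diff_jacobian.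
rewrite {1}/row_space /mkset sub_capmx => /andP[vA /sub_kermxP vJ].
by split => //=; rewrite diff_jacobian.
Qed.

Lemma continuous_mk6_3 (a b : R) : continuous (fun t : R => mk6 0 0 a (b + t) 0 0).
Proof.
move=> t; apply: cvg_mx => i j; rewrite mxE.
under eq_fun do rewrite mxE.
case: j => [[|[|[|[|[|[|//]]]]]] hj] /=; try exact: cvg_cst.
by apply: cvgD; [exact: cvg_cst|exact: cvg_id].
Qed.

End ThomPreliminaries.

Section ThomRegularity.
Variable R : realType.

Lemma open_preimage_cvg (T U : topologicalType) (f : T -> U) (A : set U) :
  continuous f -> open A -> open (f @^-1` A).
Proof. by move=> cf; apply: open_comp => x _; exact: cf. Qed.

Lemma locally_closed_preimage (T U : topologicalType) (f : T -> U) (A : set U) :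
  continuous f -> locally_closed_set A -> locally_closed_set (f @^-1` A).
Proof.
move=> cf lA a /= Afa; have [V [oV Va oVA]] := lA _ Afa.
exists (f @^-1` V); split => //; first exact: open_preimage_cvg.
exact: (open_preimage_cvg cf oVA).
Qed.

Lemma is_derive_line (V : normedModType R) (a w : V) :
  is_derive (0 : R) (1 : R) (fun t : R => a + t *: w) w.
Proof.
have dw : is_derive (0 : R) (1 : R) (fun t : R => t *: w) w.
  have := is_diff_scalel (0 : R) w => -[df dE].
  apply: DeriveDef; first exact: diff_derivable.
  by rewrite deriveE // dE scale1r.
by have := is_deriveD (is_derive_cst a (0 : R) (1 : R)) dw; rewrite add0r.
Qed.

(* At (s, y, 0) with s <> 0, every vector of the kernel of dF moves y along the
   real line R.y only, whereas some stratum contains an arc of the y-axis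
   transverse to that line. *)
Lemma Fk_not_thom_regular k : (2 <= k)%N -> ~ thom_regular (@Fk R k).
Proof.
move=> k2 [B [oB B0 [P [[partPB locfin] strata [Q QP VQ] rk thom]]]].
have k0 : (0 < k)%N by apply: leq_trans k2.
have [coverP trivP _] := partPB.
have same S S' x : P S -> P S' -> S x -> S' x -> S = S'.
  by move=> PS PS' Sx S'x; apply: (trivP S S' PS PS'); exists x.
have [U [oU U0 /finite_seqP[s sE]]] := locfin 0 B0.
have sP S : S \in s -> P S.
  by move=> Ss; have : [set` s] S by []; rewrite -sE => -[].
have [rho [rho0 hrho]] : exists r : R, 0 < r /\ forall a0 a1 a2 a3 a4 a5 : R,
    `|a0| <= r -> `|a1| <= r -> `|a2| <= r -> `|a3| <= r -> `|a4| <= r -> `|a5| <= r ->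
    (U `&` B) (mk6 a0 a1 a2 a3 a4 a5).
  by apply: nbhs0_mk6; apply: filterI; exact: open_nbhs_nbhs.
have r00 : `|0 : R| <= rho by rewrite normr0 ltW.
have rr : `|rho| <= rho by rewrite ger0_norm // ltW.
have inS x : (U `&` B) x -> exists2 S, S \in s & S x.
  move=> [Ux Bx]; have : cover P id x by rewrite coverP.
  move=> [S PS Sx]; exists S => //.
  have : [set` s] S by rewrite -sE; split => //; exists x.
  by [].
(* The arc y = rho + i t of the y-axis; its velocity i is never a real multiple of y because rho >
   0. *)
pose c (t : R) := mk6 0 0 rho t 0 0.
have cc : continuous c.
  by move=> t; have := @continuous_mk6_3 R rho 0 t; under eq_fun do rewrite add0r.
(* One of the finitely many strata near 0 contains a whole open piece of the arc. *)
have [|||t|A [As [W' [oW' [tau W'tau] W'W W'A]]]] :=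
    @locally_closed_cover R (map (fun X => c @^-1` X) s) `](- rho), rho[%classic.
- move=> A /mapP[S Ss ->]; apply: locally_closed_preimage => //.
  by apply: submanifold_locally_closed; have [] := strata S (sP S Ss).
- exact: interval_open.
- by exists 0; rewrite /= in_itv /= oppr_lt0 rho0.
- rewrite /= in_itv /= -ltr_norml => trho.
  have [S Ss St] := inS _ (hrho 0 0 rho t 0 0 r00 r00 rr (ltW trho) r00 r00).
  by exists (c @^-1` S) => //; exact: map_f.
move: As W'A => /mapP[S Ss ->] W'S {A}.
have PS := sP S Ss.
have taurho : `|tau| <= rho.
  by have := W'W _ W'tau; rewrite /= in_itv /= -ltr_norml => /ltW.
have Sc : S (c tau) := W'S _ W'tau.
have Fc : Fk k (c tau) = 0.
  by rewrite Fk_z0 //; apply/rowP => j; rewrite !mxE expr0n /= mul0r.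
have SV : S `<=` (@Fk R k) @^-1` [set 0].
  have : (B `&` (@Fk R k) @^-1` [set 0]) (c tau).
    by split => //; have [] := hrho 0 0 rho tau 0 0 r00 r00 rr taurho r00 r00.
  rewrite VQ => -[S' QS' S'c].
  have SS' := same _ _ _ PS (QP _ QS') Sc S'c.
  move=> x Sx; have : (B `&` (@Fk R k) @^-1` [set 0]) x.
    by rewrite VQ; exists S' => //; rewrite -SS'.
  by case.
pose a n : R := rho / n.+1%:R.
have a0 n : 0 < a n by rewrite divr_gt0.
have arho n : `|a n| <= rho.
  by rewrite (ger0_norm (ltW (a0 n))) ler_pdivrMr // ler_peMr ?ler1n //; exact: ltW.
pose x_ n := mk6 (a n) 0 rho tau 0 0.
(* The points [x_ n] tend to [c tau] from outside the zero fibre, and infinitely many of them share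
   a stratum M. *)
have [M Ms hM] : exists2 M, M \in s & forall N, exists n, (N <= n)%N /\ M (x_ n).
  apply: pigeonhole_seq => n; exact/inS/hrho.
have [phi hphi] := choice hM.
(* Compactness of the projectors provides a limit subspace, to which the Thom condition applies. *)
have /choice[PV hPV] : forall n, exists Pn : 'M[R]_6,
    orthogonal_projector Pn (ker_restriction (@Fk R k) M (x_ (phi n))).
  move=> n; have [r hr] := rk M (sP M Ms).
  have [A ->] := ker_restriction_row_space (@differentiable_Fk R k _) (hr _ (hphi n).2).
  exact: orthogonal_projector_exists.
have [psi [L [psin cL]]] :=
  mx_bounded_subsequence (fun n i j => orthogonal_projector_bound i j (hPV n)).
have pL := orthogonal_projector_lim (fun n => hPV (psi n)) cL.
pose u n := x_ (phi (psi n)).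
have cu : u n @[n --> \oo] --> c tau.
  apply: cvg_mx => i j; rewrite mxE; under eq_fun do rewrite mxE.
  case: j => [[|[|[|[|[|[|//]]]]]] hj] /=; try exact: cvg_cst.
  have c0 : rho * n.+1%:R^-1 @[n --> \oo] --> 0.
    rewrite -[X in _ --> X](mulr0 rho); apply: cvgM; first exact: cvg_cst.
    exact: cvg_harmonic.
  apply: (squeeze_cvgr _ (cvg_cst 0) c0); apply: nearW => n.
  rewrite (ltW (a0 _)) /= ler_pM2l // lef_pV2 ?posrE // ler_nat ltnS.
  exact: leq_trans (psin n) (hphi (psi n)).1.
have nMV : ~ (M `<=` (@Fk R k) @^-1` [set 0]).
  move=> /(_ _ (hphi 0%N).2); rewrite /= Fk_z0 // => /rowP/(_ 0).
  rewrite !mxE /= => /eqP; rewrite mulf_eq0 sqrf_eq0 gt_eqF ?a0 //.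
  by rewrite gt_eqF.
have := thom M S (sP M Ms) PS nMV SV u (c tau) (row_space L)
  (fun n => (hphi (psi n)).2) Sc cu.
have cvgL : subspace_cvg (fun n => ker_restriction (@Fk R k) M (u n)) (row_space L).
  exists (fun n => PV (psi n)), L; split; [exact: (fun n => hPV (psi n))|exact: pL|exact: cL].
move=> /(_ cvgL (mk6 0 0 0 1 0 0)).
have tan : tangent_space S (c tau) (mk6 0 0 0 1 0 0).
  exists (fun t => c tau + t *: mk6 0 0 0 1 0 0); split.
  - by rewrite scale0r addr0.
  - have : \forall t \near (0 : R), W' (tau + t).
      have ct : tau + t @[t --> (0 : R)] --> tau.
        rewrite -[X in _ --> X](addr0 tau).
        by apply: cvgD; [exact: cvg_cst|exact: cvg_id].
      by apply: ct; exact: open_nbhs_nbhs.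
    apply: filterS => t /W'S /=; congr (S _).
    apply/rowP => j; rewrite !mxE.
    by case: j => [[|[|[|[|[|[|//]]]]]] hj] /=; rewrite ?mulr0 ?addr0 ?mulr1.
  - exact: is_derive_line.
move=> /(_ tan); rewrite /row_space /mkset => /submxP[v vL].
(* The relation of [ker_dFk_axis] holds on the rows of each projector and passes to the limit. On
   the tangent vector i of the arc it would read rho = 0. *)
have LL : forall i, rho * L i (inord 3) - tau * L i (inord 2) = 0.
  move=> i.
  have cPV j : PV (psi n) i j @[n --> \oo] --> L i j.
    exact: (cvg_comp _ (fun M : 'M[R]_6 => M i j) cL (@coord_continuous _ _ _ i j L)).
  have cc0 : rho * PV (psi n) i (inord 3) - tau * PV (psi n) i (inord 2) @[n --> \oo]
      --> rho * L i (inord 3) - tau * L i (inord 2).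
    by apply: cvgB; apply: cvgM => //; exact: cvg_cst.
  have c00 : rho * PV (psi n) i (inord 3) - tau * PV (psi n) i (inord 2) @[n --> \oo]
      --> (0 : R).
    apply: cvg_near_cst; apply: nearW => n /=.
    have [_ _ kE] := hPV (psi n).
    have : ker_restriction (@Fk R k) M (x_ (phi (psi n))) (row i (PV (psi n))).
      by rewrite kE; exact: row_sub.
    move=> [_ /= dF0].
    have := ker_dFk_axis k2 (lt0r_neq0 (a0 _)) dF0.
    by rewrite co.unlock !mxE.
  exact: (cvg_unique _ cc0 c00).
have : rho * (mk6 0 0 0 1 0 0 : 'rV[R]_6) 0 (inord 3)
     - tau * (mk6 0 0 0 1 0 0 : 'rV[R]_6) 0 (inord 2) = 0.
  rewrite vL !mxE !mulr_sumr -sumrB big1 // => i _.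
  by rewrite mulrCA [tau * _]mulrCA -mulrBr LL mulr0.
rewrite !mxE !inordK //= mulr1 mulr0 subr0 => rho00.
by rewrite rho00 ltxx in rho0.
Qed.

End ThomRegularity.

(** * Radii of star-shaped sublevel sets *)

Section Rad.
Variable R : realType.
Implicit Types (phi : R -> R) (E s : R).

Lemma cvg_maxr (T : Type) (F : set_system T) (FF : Filter F) (f g : T -> R) (a b : R) :
  f @ F --> a -> g @ F --> b -> Num.max (f t) (g t) @[t --> F] --> Num.max a b.
Proof.
move=> fa gb; rewrite maxr_absE; under eq_fun do rewrite maxr_absE.
apply: cvgM; last exact: cvg_cst.
by apply: cvgD; [exact: cvgD|apply: cvg_norm; exact: cvgB].
Qed.

(** These conditions make the sublevel set in s >= 0 a segment [0, r] on which phi reaches E only at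
    r; r = 0 is allowed. The strict inequality in [star_in] is what makes r depend continuously on
    phi. *)
Record star phi E : Prop := Star {
  star_cont : forall s, 0 <= s -> phi x @[x --> s] --> phi s;
  star0 : phi 0 <= E;
  star_in : forall s s', 0 <= s' -> s' < s -> phi s <= E -> phi s' < E;
  star_out : exists2 s, 0 <= s & E < phi s }.

Definition sradius phi E : R := sup [set s | 0 <= s /\ phi s <= E].

Lemma sradius_has_sup phi E : star phi E -> has_sup [set s | 0 <= s /\ phi s <= E].
Proof.
move=> st; split; first by exists 0; split => //; exact: star0 st.
have [m m0 Em] := star_out st; exists m => s [s0 sE].
rewrite leNgt; apply/negP => ms.
by have := star_in st m0 ms sE; rewrite ltNge (ltW Em).
Qed.

Lemma sradius_ge0 phi E : star phi E -> 0 <= sradius phi E.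
Proof.
move=> st; apply: (ub_le_sup (sradius_has_sup st).2); split => //; exact: star0 st.
Qed.

Lemma sradius_lt phi E s : star phi E -> 0 <= s -> s < sradius phi E -> phi s < E.
Proof.
move=> st s0 sr; have d0 : 0 < sradius phi E - s by rewrite subr_gt0.
have [u [u0 uE]] := sup_adherent d0 (sradius_has_sup st).
by rewrite -/(sradius _ _) subKr => su; apply: star_in st _ _ s0 su uE.
Qed.

Lemma sradius_gt phi E s : star phi E -> sradius phi E < s -> E < phi s.
Proof.
move=> st rs; rewrite ltNge; apply/negP => sE.
have s0 : 0 <= s by apply: le_trans (sradius_ge0 st) (ltW rs).
have : s <= sradius phi E by apply: (ub_le_sup (sradius_has_sup st).2).
by rewrite leNgt rs.
Qed.

Lemma sradius_val phi E : star phi E -> phi (sradius phi E) = E.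
Proof.
move=> st; set r := sradius phi E; have r0 : 0 <= r := sradius_ge0 st.
have cr := star_cont st r0.
apply/eqP; rewrite eq_le; apply/andP; split; rewrite leNgt; apply/negP => h.
  have [rpos|] := ltP 0 r; last first.
    by move=> r0'; have := star0 st; rewrite (_ : 0 = r) ?leNgt ?h //; apply/le_anti/andP.
  have [d /= d0 hd] := (nbhs_ballP _ _).1 (cvgr_gt _ cr _ h).
  pose s := r - Num.min d r / 2.
  have m0 : 0 < Num.min d r by rewrite lt_min d0.
  have md : Num.min d r <= d by rewrite ge_min lexx.
  have mr : Num.min d r <= r by rewrite ge_min lexx orbT.
  have s0 : 0 <= s by rewrite /s; lra.
  have sr : s < r by rewrite /s; lra.
  have /= := hd s; rewrite /ball /= /s opprB addrC subrK ger0_norm; last by lra.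
  by move=> /(_ ltac:(lra)); rewrite ltNge (ltW (sradius_lt st s0 sr)).
have [d /= d0 hd] := (nbhs_ballP _ _).1 (cvgr_lt _ cr _ h).
have /= := hd (r + d / 2); rewrite /ball /= opprD addrA subrr sub0r normrN ger0_norm; last by lra.
move=> /(_ ltac:(lra)); rewrite ltNge ltW //; apply: (sradius_gt st).
by rewrite -/r; lra.
Qed.

Lemma sradius_leE phi E s : star phi E -> 0 <= s -> (phi s <= E) = (s <= sradius phi E).
Proof.
move=> st s0; have [sr|rs|->] := ltgtP s (sradius phi E).
- by rewrite ltW // (sradius_lt st).
- by rewrite leNgt (sradius_gt st rs).
- by rewrite sradius_val // lexx.
Qed.

Lemma sradius_gt0 phi E : star phi E -> phi 0 < E -> 0 < sradius phi E.
Proof.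
move=> st h; rewrite lt0r sradius_ge0 // andbT; apply/eqP => r0.
by move: h; rewrite -r0 sradius_val // ltxx.
Qed.

Lemma sradius_eq0 phi E : star phi E -> (sradius phi E == 0) = (phi 0 == E).
Proof.
move=> st; apply/eqP/eqP => h; first by rewrite -h sradius_val.
apply/le_anti/andP; split; last exact: sradius_ge0.
by rewrite leNgt; apply/negP => r0; have := sradius_lt st (lexx _) r0; rewrite h ltxx.
Qed.

(** Pointwise convergence suffices: the inequalities phi0 (r - e) < E < phi0 (r + e) are strict, so
    they persist for nearby functions and enclose their radii. *)
Lemma sradius_cvg (T : Type) (F : set_system T) (FF : Filter F) (phi : T -> R -> R) phi0 E :
  (\forall t \near F, star (phi t) E) -> star phi0 E ->
  (forall s, 0 <= s -> phi t s @[t --> F] --> phi0 s) ->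
  sradius (phi t) E @[t --> F] --> sradius phi0 E.
Proof.
move=> st st0 cphi; apply/cvgrPdist_le => e e0.
set r := sradius phi0 E; have r0 : 0 <= r := sradius_ge0 st0.
have up : \forall t \near F, sradius (phi t) E <= r + e.
  have h : E < phi0 (r + e) by apply: (sradius_gt st0); rewrite ltrDl.
  have re0 : 0 <= r + e by rewrite addr_ge0 // ltW.
  have hh : \forall t \near F, E < phi t (r + e) := cvgr_gt _ (cphi _ re0) _ h.
  near=> t; rewrite leNgt; apply/negP => tlt.
  have stt : star (phi t) E by near: t.
  have Et : E < phi t (r + e) by near: t; exact: hh.
  by have := sradius_lt stt re0 tlt; rewrite ltNge (ltW Et).
have low : \forall t \near F, r - e <= sradius (phi t) E.
  have [re0|re0] := ltP (r - e) 0.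
    near=> t; have stt : star (phi t) E by near: t.
    by rewrite (le_trans (ltW re0)) // sradius_ge0.
  have h : phi0 (r - e) < E by apply: (sradius_lt st0) => //; rewrite ltrBlDr ltrDl.
  have hh : \forall t \near F, phi t (r - e) < E := cvgr_lt _ (cphi _ re0) _ h.
  near=> t; rewrite leNgt; apply/negP => tlt.
  have stt : star (phi t) E by near: t.
  have Et : phi t (r - e) < E by near: t; exact: hh.
  by have := sradius_gt stt tlt; rewrite ltNge (ltW Et).
near=> t.
have u : sradius (phi t) E <= r + e by near: t.
have l : r - e <= sradius (phi t) E by near: t.
by rewrite ler_distl lerBlDr; apply/andP; split; lra.
Unshelve. all: by end_near. Qed.

End Rad.

(** * Piecewise affine maps between segments *)

Section Stretch.
Variable R : realType.
Implicit Types (P : R -> R) (c E y : R).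

Definition radr P c E := sradius (fun s => P (c + s)) E.
Definition radl P c E := sradius (fun s => P (c - s)) E.

Definition starlike P c E :=
  [/\ star (fun s => P (c + s)) E, star (fun s => P (c - s)) E & P c < E].

(** Sends c to c' and scales each side by the ratio of the radii on that side. One formula with
    [Num.max] replaces a case split, so that continuity in all data is immediate. *)
Definition stretch P c E P' c' E' y :=
  c' + Num.max (y - c) 0 * (radr P' c' E' / radr P c E)
     - Num.max (c - y) 0 * (radl P' c' E' / radl P c E).

Lemma radr_gt0 P c E : starlike P c E -> 0 < radr P c E.
Proof. by move=> [st _ h]; apply: sradius_gt0 => //; rewrite addr0. Qed.

Lemma radl_gt0 P c E : starlike P c E -> 0 < radl P c E.
Proof. by move=> [_ st h]; apply: sradius_gt0 => //; rewrite subr0. Qed.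

Lemma starlike_leE P c E y : starlike P c E ->
  (P y <= E) = (c - radl P c E <= y <= c + radr P c E).
Proof.
move=> sl; have [stp stm _] := sl.
have p0 := radr_gt0 sl; have m0 := radl_gt0 sl.
have [cy|yc] := leP c y.
  have -> : P y = P (c + (y - c)) by congr P; ring.
  rewrite (sradius_leE stp) ?subr_ge0 // -/(radr P c E).
  by apply/idP/andP => [h|[h1 h2]]; [split; lra|lra].
have -> : P y = P (c - (c - y)) by congr P; ring.
rewrite (sradius_leE stm); last by rewrite subr_ge0 ltW.
rewrite -/(radl P c E).
by apply/idP/andP => [h|[h1 h2]]; [split; lra|lra].
Qed.

Lemma starlike_eqE P c E y : starlike P c E ->
  P y <= E -> (P y == E) = (y == c - radl P c E) || (y == c + radr P c E).
Proof.
move=> sl yE; have [stp stm _] := sl.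
have p0 := radr_gt0 sl; have m0 := radl_gt0 sl.
move: (yE); rewrite (starlike_leE _ sl) => /andP[yl yr].
apply/eqP/orP => [h|[/eqP ->|/eqP ->]].
- apply: contrapT => /not_orP[/negP nl /negP nr].
  have yl' : c - radl P c E < y by rewrite lt_neqAle eq_sym nl.
  have yr' : y < c + radr P c E by rewrite lt_neqAle nr.
  have [cy|yc] := leP c y.
    have : P (c + (y - c)) < E by apply: (sradius_lt stp); rewrite ?subr_ge0 // ltrBlDl.
    by rewrite addrC subrK h ltxx.
  have : P (c - (c - y)) < E.
    by apply: (sradius_lt stm); rewrite ?subr_ge0 ?(ltW yc) // ltrBlDr -ltrBlDl.
  by rewrite subKr h ltxx.
- by have := sradius_val stm.
- by have := sradius_val stp.
Qed.

Section StretchPair.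
Variables (P P' : R -> R) (c c' E E' : R).
Hypotheses (sl : starlike P c E) (sl' : starlike P' c' E').

Let st := stretch P c E P' c' E'.

Lemma stretch_posE y : c <= y -> st y = c' + (y - c) * (radr P' c' E' / radr P c E).
Proof.
move=> cy; rewrite /st /stretch (max_l (x := y - c)) ?subr_ge0 //.
by rewrite (max_r (x := c - y)) ?subr_le0 // mul0r subr0.
Qed.

Lemma stretch_negE y : y <= c -> st y = c' - (c - y) * (radl P' c' E' / radl P c E).
Proof.
move=> cy; rewrite /st /stretch (max_l (x := c - y)) ?subr_ge0 //.
by rewrite (max_r (x := y - c)) ?subr_le0 // mul0r addr0.
Qed.

Lemma stretch_le y : P y <= E -> P' (st y) <= E'.
Proof.
rewrite (starlike_leE _ sl) (starlike_leE _ sl') => /andP[yl yr].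
have p0 := radr_gt0 sl; have m0 := radl_gt0 sl.
have p0' := radr_gt0 sl'; have m0' := radl_gt0 sl'.
have [cy|/ltW yc] := leP c y.
  rewrite stretch_posE //.
  have h : 0 <= (y - c) * (radr P' c' E' / radr P c E).
    by rewrite mulr_ge0 ?subr_ge0 // divr_ge0 // ltW.
  have h2 : (y - c) * (radr P' c' E' / radr P c E) <= radr P' c' E'.
    by rewrite mulrA ler_pdivrMr // mulrC ler_pM2l // lerBlDl.
  by apply/andP; split; lra.
rewrite stretch_negE //.
have h : 0 <= (c - y) * (radl P' c' E' / radl P c E).
  by rewrite mulr_ge0 ?subr_ge0 // divr_ge0 // ltW.
have h2 : (c - y) * (radl P' c' E' / radl P c E) <= radl P' c' E'.
  by rewrite mulrA ler_pdivrMr // mulrC ler_pM2l // lerBlDr -lerBlDl.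
by apply/andP; split; lra.
Qed.

Lemma stretch_eq y : P y = E -> P' (st y) = E'.
Proof.
move=> h; have yE : P y <= E by rewrite h.
have p0 := radr_gt0 sl; have m0 := radl_gt0 sl.
have := starlike_eqE sl yE; rewrite h eqxx => /esym/orP hy.
apply/eqP; rewrite (starlike_eqE sl') ?stretch_le //; apply/orP.
case: hy => /eqP ->; [left|right].
  rewrite stretch_negE; last by rewrite gerBl ltW.
  by rewrite subKr mulrCA divff ?mulr1 // gt_eqF.
rewrite stretch_posE; last by rewrite lerDl ltW.
by rewrite addrAC subrr add0r mulrCA divff ?mulr1 // gt_eqF.
Qed.

Lemma stretchK y : stretch P' c' E' P c E (st y) = y.
Proof.
have p0 := radr_gt0 sl; have m0 := radl_gt0 sl.
have p0' := radr_gt0 sl'; have m0' := radl_gt0 sl'.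
have [cy|/ltW yc] := leP c y.
  have h : 0 <= (y - c) * (radr P' c' E' / radr P c E).
    by rewrite mulr_ge0 ?subr_ge0 // divr_ge0 // ltW.
  rewrite stretch_posE // /stretch [_ - c']addrAC subrr add0r opprD addrA subrr sub0r.
  rewrite max_l // max_r ?oppr_le0 // mul0r subr0.
  by field; rewrite !gt_eqF.
have h : 0 <= (c - y) * (radl P' c' E' / radl P c E).
  by rewrite mulr_ge0 ?subr_ge0 // divr_ge0 // ltW.
rewrite stretch_negE // /stretch [_ - c']addrAC subrr add0r subKr.
rewrite max_r ?oppr_le0 // max_l // mul0r addr0.
by field; rewrite !gt_eqF.
Qed.

End StretchPair.

Lemma stretch_cvg (T : Type) (F : set_system T) (FF : Filter F)
    (P P' : T -> R -> R) (P0 P0' : R -> R) (c c' y : T -> R) (c0 c0' y0 E E' : R) :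
  (\forall t \near F, starlike (P t) (c t) E) -> starlike P0 c0 E ->
  (\forall t \near F, starlike (P' t) (c' t) E') -> starlike P0' c0' E' ->
  (forall s, P t (c t + s) @[t --> F] --> P0 (c0 + s)) ->
  (forall s, P' t (c' t + s) @[t --> F] --> P0' (c0' + s)) ->
  c t @[t --> F] --> c0 -> c' t @[t --> F] --> c0' -> y t @[t --> F] --> y0 ->
  stretch (P t) (c t) E (P' t) (c' t) E' (y t) @[t --> F]
    --> stretch P0 c0 E P0' c0' E' y0.
Proof.
move=> sl sl0 sl' sl0' cP cP' cc cc' cy.
have rr : radr (P t) (c t) E @[t --> F] --> radr P0 c0 E.
  apply: sradius_cvg; last by move=> s _; exact: cP.
    by apply: filterS sl => t [].
  by case: sl0.
have rl : radl (P t) (c t) E @[t --> F] --> radl P0 c0 E.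
  apply: sradius_cvg; last by move=> s _; exact: cP.
    by apply: filterS sl => t [].
  by case: sl0.
have rr' : radr (P' t) (c' t) E' @[t --> F] --> radr P0' c0' E'.
  apply: sradius_cvg; last by move=> s _; exact: cP'.
    by apply: filterS sl' => t [].
  by case: sl0'.
have rl' : radl (P' t) (c' t) E' @[t --> F] --> radl P0' c0' E'.
  apply: sradius_cvg; last by move=> s _; exact: cP'.
    by apply: filterS sl' => t [].
  by case: sl0'.
rewrite /stretch; apply: cvgB; first apply: cvgD => //.
- apply: cvgM; last by apply: cvgM rr' _; apply: cvgV rr; rewrite gt_eqF // radr_gt0.
  apply: cvg_maxr; last exact: cvg_cst.
  exact: cvgB.
- apply: cvgM; last by apply: cvgM rl' _; apply: cvgV rl; rewrite gt_eqF // radl_gt0.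
  apply: cvg_maxr; last exact: cvg_cst.
  exact: cvgB.
Qed.

End Stretch.

(** * The norm along an orbit of the weighted scaling *)

Section Orbit.
Variables (R : realType) (k : nat).
Hypothesis k2 : (2 <= k)%N.
Let K : R := k%:R.
Implicit Types (f e kap l c E rho : R).

Let K2 : 2 <= K. Proof. by rewrite /K ler_nat. Qed.

(** The squared norm along (e^(k l) x, e^l z), where f, e, kap are |x|^2, |z|^2 and t^2 / |h|^2 at l
    = 0; the exponent 4k appears because |h|^2 has weight 4k. *)
Definition orbit_norm f e kap l : R :=
  expR (2 * k%:R * l) * f + expR (2 * l) * e + expR (- (4 * k%:R * l)) * kap.

Lemma orbit_norm_shift f e kap m l :
  orbit_norm (expR (2 * K * m) * f) (expR (2 * m) * e) (expR (- (4 * K * m)) * kap) l =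
  orbit_norm f e kap (m + l).
Proof.
by rewrite /orbit_norm !mulrDr opprD !expRD !mulrA; congr (_ * _ + _ * _ + _ * _);
  rewrite mulrC.
Qed.

Lemma expR_tangent (al B C : R) : expR (al * B) * (1 + al * (C - B)) <= expR (al * C).
Proof.
have -> : al * C = al * B + al * (C - B) by ring.
by rewrite expRD ler_pM2l ?expR_gt0 // expR_ge1Dx.
Qed.

Lemma expR_tangent_lt (al B C : R) : al != 0 -> B != C ->
  expR (al * B) * (1 + al * (C - B)) < expR (al * C).
Proof.
move=> al0 BC; have -> : al * C = al * B + al * (C - B) by ring.
by rewrite expRD ltr_pM2l ?expR_gt0 // expR_gt1Dx // mulf_neq0 // subr_eq0 eq_sym.
Qed.

Lemma orbit_norm_tangent f e kap B C : 0 < f -> 0 <= e -> 0 <= kap -> B != C ->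
  orbit_norm f e kap B + (C - B) * (2 * K * (expR (2 * K * B) * f) + 2 * (expR (2 * B) * e)
     - 4 * K * (expR (- (4 * K * B)) * kap)) < orbit_norm f e kap C.
Proof.
move=> f0 e0 kap0 BC; rewrite /orbit_norm -/K.
have K0 : 0 < K by apply: lt_le_trans K2.
have h1 : expR (2 * K * B) * (1 + 2 * K * (C - B)) * f < expR (2 * K * C) * f.
  by rewrite ltr_pM2r // expR_tangent_lt // gt_eqF // mulr_gt0.
have h2 : expR (2 * B) * (1 + 2 * (C - B)) * e <= expR (2 * C) * e.
  by rewrite ler_wpM2r // expR_tangent.
have h3 : expR (- (4 * K * B)) * (1 - 4 * K * (C - B)) * kap <= expR (- (4 * K * C)) * kap.
  rewrite ler_wpM2r //; have := expR_tangent (- (4 * K)) B C.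
  by rewrite !mulNr.
move: h1 h2 h3; set u := expR (2 * K * B); set v := expR (2 * B).
set w := expR (- (4 * K * B)); move=> h1 h2 h3.
apply: le_lt_trans (ltr_leD (ltr_leD h1 h2) h3).
by rewrite le_eqVlt; apply/orP; left; apply/eqP; ring.
Qed.

(** The tangent at B lies strictly below the graph at A and at C; according to the sign of its
    slope, one of these two values exceeds the value at B. *)
Lemma orbit_norm_quasiconvex f e kap A B C E : 0 < f -> 0 <= e -> 0 <= kap ->
  A < B -> B < C -> orbit_norm f e kap A <= E -> orbit_norm f e kap C <= E -> orbit_norm f e kap B < E.
Proof.
move=> f0 e0 kap0 AB BC AE CE.
have := orbit_norm_tangent f0 e0 kap0 (negbT (lt_eqF BC)).
have := orbit_norm_tangent f0 e0 kap0 (negbT (gt_eqF AB)).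
set D := 2 * K * (expR (2 * K * B) * f) + 2 * (expR (2 * B) * e)
     - 4 * K * (expR (- (4 * K * B)) * kap).
move=> hA hC.
have [D0|/ltW D0] := leP 0 D.
  have : 0 <= (C - B) * D by rewrite mulr_ge0 // subr_ge0 ltW.
  by move=> h; lra.
have : 0 <= (A - B) * D by rewrite mulr_le0 // subr_le0 ltW.
by move=> h; lra.
Qed.

Lemma cvg_Pl (T : Type) (F : set_system T) (FF : Filter F) (f e kap l : T -> R)
    (f0 e0 kap0 l0 : R) :
  f @ F --> f0 -> e @ F --> e0 -> kap @ F --> kap0 -> l @ F --> l0 ->
  orbit_norm (f t) (e t) (kap t) (l t) @[t --> F] --> orbit_norm f0 e0 kap0 l0.
Proof.
move=> cf ce ck cl; rewrite /orbit_norm.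
have cexp (u : T -> R) u0 : u @ F --> u0 -> expR (u t) @[t --> F] --> expR u0.
  by move=> cu; apply: (cvg_comp _ _ cu); exact: continuous_expR.
apply: cvgD; [apply: cvgD|]; apply: cvgM => //; apply: cexp.
- by apply: cvgM => //; exact: cvg_cst.
- by apply: cvgM => //; exact: cvg_cst.
- by apply: cvgN; apply: cvgM => //; exact: cvg_cst.
Qed.

Lemma orbit_norm_ge0 f e kap l : 0 <= f -> 0 <= e -> 0 <= kap -> 0 <= orbit_norm f e kap l.
Proof. by move=> f0 e0 k0; rewrite /orbit_norm !addr_ge0 // mulr_ge0 // expR_ge0. Qed.

Lemma starlike_Pl f e kap c E : 0 < f -> 0 <= e -> 0 < kap ->
  orbit_norm f e kap c < E -> starlike (orbit_norm f e kap) c E.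
Proof.
move=> f0 e0 kap0 cE; have kap0' := ltW kap0.
have E0 : 0 < E by apply: le_lt_trans cE; rewrite orbit_norm_ge0 // ltW.
have K0 : 0 < K by apply: lt_le_trans K2.
split => //; split.
- move=> s _; apply: cvg_Pl; try exact: cvg_cst.
  by apply: cvgD; [exact: cvg_cst|exact: cvg_id].
- by rewrite addr0 ltW.
- move=> s s' s'0 ss hs; have [->|sp] := eqVneq s' 0; first by rewrite addr0.
  apply: (orbit_norm_quasiconvex f0 e0 kap0' _ _ (ltW cE) hs).
    by rewrite ltrDl lt0r sp.
  by rewrite ltrD2l.
(* To the right the first exponential alone passes E: by its tangent at c it is at least fc + 2 K E
   at distance E / fc. *)
- pose fc := expR (2 * K * c) * f.
  have fc0 : 0 < fc by rewrite mulr_gt0 ?expR_gt0.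
  exists (E / fc); first by rewrite divr_ge0 // ltW.
  have := expR_tangent (2 * K) c (c + E / fc).
  rewrite addrAC subrr add0r => h.
  have h1 : fc * (1 + 2 * K * (E / fc)) <= expR (2 * K * (c + E / fc)) * f.
    by rewrite /fc mulrAC ler_wpM2r // ltW.
  have h2 : fc * (1 + 2 * K * (E / fc)) = fc + 2 * K * E by field; rewrite gt_eqF.
  have h3 : E <= 2 * K * E by rewrite ler_peMl ?(ltW E0) //; have := K2; lra.
  have h4 : 0 <= expR (2 * (c + E / fc)) * e by rewrite mulr_ge0 ?expR_ge0.
  have h5 : 0 <= expR (- (4 * K * (c + E / fc))) * kap by rewrite mulr_ge0 ?expR_ge0.
  by rewrite /orbit_norm -/K; lra.
- move=> s _; apply: cvg_Pl; try exact: cvg_cst.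
  by apply: cvgB; [exact: cvg_cst|exact: cvg_id].
- by rewrite subr0 ltW.
- move=> s s' s'0 ss hs; have [->|sp] := eqVneq s' 0; first by rewrite subr0.
  apply: (orbit_norm_quasiconvex f0 e0 kap0' _ _ hs (ltW cE)).
    by rewrite ltrD2l ltrN2.
  by rewrite gtrDl oppr_lt0 lt0r sp.
(* To the left the last exponential does the same, which uses kap > 0. *)
- pose kc := expR (- (4 * K * c)) * kap.
  have kc0 : 0 < kc by rewrite mulr_gt0 ?expR_gt0.
  exists (E / kc); first by rewrite divr_ge0 // ltW.
  have := expR_tangent (- (4 * K)) c (c - E / kc).
  rewrite addrAC subrr add0r !mulNr mulrN opprK => h.
  have h1 : kc * (1 + 4 * K * (E / kc)) <= expR (- (4 * K * (c - E / kc))) * kap.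
    by rewrite /kc mulrAC ler_wpM2r.
  have h2 : kc * (1 + 4 * K * (E / kc)) = kc + 4 * K * E by field; rewrite gt_eqF.
  have h3 : E <= 4 * K * E by rewrite ler_peMl ?(ltW E0) //; have := K2; lra.
  have h4 : 0 <= expR (2 * (c - E / kc)) * e by rewrite mulr_ge0 ?expR_ge0.
  have h5 : 0 <= expR (2 * K * (c - E / kc)) * f by rewrite mulr_ge0 ?expR_ge0 // ltW.
  by rewrite /orbit_norm -/K; lra.
Qed.

Definition orbit_center rho f d : R := ln rho - ln (f + d) / (2 * k%:R).

(* The centre is the point of the orbit where f + d = rho^(2k); there the first
   two terms of orbit_norm are at most rho^2 and the smallness of t controls the third. *)
Lemma orbit_norm_center C f d e g a tau rho : 0 < f -> 0 <= e -> d = e ^+ k ->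
  0 < a * g -> (f + d) ^+ 2 <= C * (a * g) ->
  0 < rho -> rho <= 1 -> 0 < tau -> C * tau <= (rho ^+ k) ^+ 4 * rho ^+ 2 ->
  orbit_norm f e (tau / (a * g)) (orbit_center rho f d) < 4 * rho ^+ 2.
Proof.
move=> f0 e0 dE ag0 fdag rho0 rho1 tau0 htau.
have d0 : 0 <= d by rewrite dE exprn_ge0.
have K0 : 0 < K by apply: lt_le_trans K2.
have fd0 : 0 < f + d by rewrite ltr_wpDr.
set c := orbit_center rho f d; pose r := rho ^+ k.
have r0 : 0 < r by rewrite exprn_gt0.
have r1 : r <= rho.
  by rewrite /r; case: k k2 => // n _; rewrite exprS ler_piMr ?exprn_ile1 // ltW.
have ek2 : expR (2 * K * c) = r ^+ 2 / (f + d).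
  rewrite /c /orbit_center -/K mulrBr expRB; congr (_ / _).
    by rewrite -mulrA expRM_natl expRM_natl lnK ?posrE // /r.
  by rewrite mulrC divfK ?lnK ?posrE // gt_eqF // mulr_gt0.
have ek4 : expR (- (4 * K * c)) = (f + d) ^+ 2 / r ^+ 4.
  have -> : 4 * K * c = 2 * K * c + 2 * K * c by ring.
  rewrite expRN expRD ek2; field.
  by rewrite !gt_eqF.
have t1 : expR (2 * K * c) * f <= rho ^+ 2.
  rewrite ek2 mulrAC ler_pdivrMr //; apply: ler_pM => //; rewrite ?sqr_ge0 ?(ltW f0) //.
    by apply: lerXn2r => //; rewrite nnegrE ltW.
  by rewrite lerDl.
(* Compared through k-th powers: as e^k = d, the left-hand side becomes r^2 d / (f + d), at most r^2
   = (rho^2)^k. *)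
have t2 : expR (2 * c) * e <= rho ^+ 2.
  have w0 : 0 <= expR (2 * c) * e by rewrite mulr_ge0 ?expR_ge0.
  have kpos : (0 < k)%N by apply: leq_trans k2.
  rewrite -(@ler_pXn2r _ k) ?nnegrE ?sqr_ge0 //.
  rewrite exprMn -expRM_natl mulrCA mulrA -/K -dE ek2 mulrAC exprAC -/r.
  rewrite ler_pdivrMr // ler_wpM2l ?lerDr ?(ltW f0) //.
  by rewrite exprn_ge0 ?sqr_ge0.
(* The bound of (f + d)^2 by C a g cancels a g and leaves C tau / r^4 <= rho^2. *)
have t3 : expR (- (4 * K * c)) * (tau / (a * g)) < 2 * rho ^+ 2.
  rewrite ek4; have r40 : 0 < r ^+ 4 by rewrite exprn_gt0.
  move: htau; rewrite -/r.
  move: (a * g) ag0 fdag => G G0 fdG; move: (r ^+ 4) r40 => r4 r40 htau.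
  have -> : (f + d) ^+ 2 / r4 * (tau / G) = ((f + d) ^+ 2 * tau) / (r4 * G).
    by field; rewrite !gt_eqF.
  rewrite ltr_pdivrMr; last by rewrite mulr_gt0.
  apply: (@le_lt_trans _ _ (C * G * tau)); first by rewrite ler_wpM2r // ltW.
  have h : C * tau * G <= r4 * rho ^+ 2 * G by rewrite ler_wpM2r // ltW.
  have h' : 0 < r4 * rho ^+ 2 * G by rewrite !mulr_gt0 // exprn_gt0.
  have -> : 2 * rho ^+ 2 * (r4 * G) = 2 * (r4 * rho ^+ 2 * G) by ring.
  by move: h; rewrite mulrAC; lra.
by rewrite /orbit_norm -/K; lra.
Qed.

End Orbit.

(** * Invariants of a point and the two scalings *)

Section InvariantsTheory.
Variables (R : realType) (k : nat).
Hypothesis k2 : (2 <= k)%N.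
Let K : R := k%:R.

Let K2 : 2 <= K. Proof. by rewrite /K ler_nat. Qed.
Let K0 : 0 < K. Proof. exact: lt_le_trans K2. Qed.

(* The values |x|^2, Re (x * conj (z^k)), |z|^(2k), |z|^2 at a point (x, z). *)
Record invariants := Invariants { ia : R; ic : R; id_ : R; ie : R }.

(* Effect on the invariants of
   (x, z) |-> (exp (K l + 2 K n) x, exp (l - n) z). *)
Definition act (l n : R) (p : invariants) : invariants :=
  Invariants (expR (2 * k%:R * l + 4 * k%:R * n) * ia p)
      (expR (2 * k%:R * l + k%:R * n) * ic p)
      (expR (2 * k%:R * l - 2 * k%:R * n) * id_ p)
      (expR (2 * l - 2 * n) * ie p).

Lemma act_act l n l' n' p : act l n (act l' n' p) = act (l + l') (n + n') p.
Proof. by rewrite /act /=; congr Invariants; rewrite mulrA -expRD; congr (expR _ * _); ring. Qed.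

Lemma act00 p : act 0 0 p = p.
Proof.
by case: p => a c d e; rewrite /act !mulr0 !addr0 !subr0 expR0 !mul1r.
Qed.

Definition ig p : R := ia p + 2 * ic p + id_ p.
(* For b = true the tuple p belongs to (- u, z) instead of (x, z), so that if_ b p
   is |x|^2 in both cases. fibre_norm b tau p is |x|^2 + |y|^2 + |z|^2 at the points where
   |F|^2 = tau. *)
Definition if_ (b : bool) p : R := if b then ig p else ia p.
Definition fibre_norm b tau p : R := if_ b p + ie p + tau / (ia p * ig p).

(** The relations satisfied by the invariants of an actual point with h nonzero; [coherent_c] is the
    Cauchy-Schwarz inequality. *)
Record coherent p : Prop := Coherent {
  coherent_d : id_ p = ie p ^+ k; coherent_e : 0 <= ie p; coherent_a : 0 < ia p;
  coherent_g : 0 < ig p; coherent_c : ic p ^+ 2 <= ia p * id_ p }.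

Definition collar_region p := 25 * ia p <= id_ p.
Definition core p := id_ p <= 25 * ia p /\ id_ p <= 25 * ig p.

Lemma coherent_d0 p : coherent p -> 0 <= id_ p.
Proof. by case=> -> *; rewrite exprn_ge0. Qed.

Lemma coherent_if b p : coherent p -> 0 < if_ b p. Proof. by case: b => -[]. Qed.

Lemma sqr_le_norm (x y : R) : 0 <= y -> x ^+ 2 <= y ^+ 2 -> - y <= x <= y.
Proof.
move=> y0 xy; rewrite -ler_norml -(@ler_pXn2r _ 2) ?nnegrE //.
by rewrite real_normK ?num_real.
Qed.

Lemma ig_act0 l p : ig (act l 0 p) = expR (2 * K * l) * ig p.
Proof. by rewrite /ig /act /= !mulr0 addr0 subr0 -/K; ring. Qed.

Lemma if_act0 b l p : if_ b (act l 0 p) = expR (2 * K * l) * if_ b p.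
Proof. by case: b; rewrite /if_ ?ig_act0 // /act /= mulr0 addr0. Qed.

Lemma ia_act0 l p : ia (act l 0 p) = expR (2 * K * l) * ia p.
Proof. by rewrite /act /= mulr0 addr0. Qed.
Lemma id_act0 l p : id_ (act l 0 p) = expR (2 * K * l) * id_ p.
Proof. by rewrite /act /= mulr0 subr0. Qed.
Lemma ie_act0 l p : ie (act l 0 p) = expR (2 * l) * ie p.
Proof. by rewrite /act /= mulr0 subr0. Qed.

Lemma kap_act0 tau l p : tau / (ia (act l 0 p) * ig (act l 0 p)) =
  expR (- (4 * K * l)) * (tau / (ia p * ig p)).
Proof.
rewrite ia_act0 ig_act0.
have -> : 4 * K * l = 2 * K * l + 2 * K * l by ring.
rewrite expRN expRD !invfM; ring.
Qed.

Lemma fibre_norm_act0 b tau l p : fibre_norm b tau (act l 0 p) =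
  orbit_norm k (if_ b p) (ie p) (tau / (ia p * ig p)) l.
Proof. by rewrite /fibre_norm if_act0 ie_act0 kap_act0. Qed.

(** For n nonzero, x and z^k are scaled differently, so u may vanish after the move; its
    nonvanishing is therefore a separate hypothesis. *)
Lemma coherent_act l n p : coherent p -> 0 < ig (act l n p) -> coherent (act l n p).
Proof.
move=> dp gp; split => //=.
- rewrite (coherent_d dp) exprMn; congr (_ * _).
  by rewrite -expRM_natl; congr expR; rewrite -/K; ring.
- by rewrite mulr_ge0 ?expR_ge0 // (coherent_e dp).
- by rewrite mulr_gt0 ?expR_gt0 // (coherent_a dp).
- have E : expR (2 * k%:R * l + k%:R * n) ^+ 2 =
      expR (2 * k%:R * l + 4 * k%:R * n) * expR (2 * k%:R * l - 2 * k%:R * n).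
    by rewrite -expRD -expRM_natl; congr expR; ring.
  by rewrite exprMn E [leRHS]mulrACA ler_wpM2l ?mulr_ge0 ?expR_ge0 // (coherent_c dp).
Qed.

Lemma coherent_act0 l p : coherent p -> coherent (act l 0 p).
Proof.
move=> dp; apply: coherent_act => //; rewrite ig_act0 mulr_gt0 ?expR_gt0 //; exact: coherent_g.
Qed.

Lemma core_act0 l p : core p -> core (act l 0 p).
Proof.
by move=> [h1 h2]; split; rewrite ?ia_act0 ?ig_act0 id_act0 mulrCA ler_pM2l ?expR_gt0.
Qed.

(** The origin of the constant 25: with Cauchy-Schwarz it gives 5 |c| <= d, hence |u|^2 = a + 2 c +
    d >= 3 d / 5. Close to x = 0, u stays comparable to z^k. *)
Lemma ig_reg0 p : 0 < ia p -> 0 <= id_ p -> ic p ^+ 2 <= ia p * id_ p -> collar_region p ->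
  3 * id_ p <= 5 * ig p.
Proof.
move=> a0 d0 cad; rewrite /collar_region /ig => r0.
have : - id_ p <= 5 * ic p <= id_ p.
  apply: sqr_le_norm => //; nra.
by move=> /andP[]; lra.
Qed.

Lemma collar_region_d p : 0 < ia p -> collar_region p -> 0 < id_ p.
Proof. by rewrite /collar_region => a0; lra. Qed.

(** On the core |x|^2 and |u|^2 are comparable and both control |z|^(2k): a sum f + d is at most 26
    times one of a, g and 77 times the other. The product 26 * 77 = 2002 is below 50^2. *)
Lemma core_bound b p : coherent p -> core p ->
  (if_ b p + id_ p) ^+ 2 <= 50 ^+ 2 * (ia p * ig p).
Proof.
move=> dp [h1 h2]; have d0 := coherent_d0 dp.
have a0 := coherent_a dp; have g0 := coherent_g dp.
have [gad agd] : ig p <= 2 * (ia p + id_ p) /\ ia p <= 2 * (ig p + id_ p).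
  have : 0 <= (ia p + id_ p) ^+ 2 - 4 * ic p ^+ 2.
    have := coherent_c dp; have := sqr_ge0 (ia p - id_ p); nra.
  rewrite -[4]/(2 * 2)%:R; rewrite subr_ge0 => h.
  have h' : (2 * ic p) ^+ 2 <= (ia p + id_ p) ^+ 2 by apply: le_trans h; lra.
  have /andP[c1 c2] := sqr_le_norm (addr_ge0 (ltW a0) d0) h'.
  have h3 : (2 * ic p) ^+ 2 <= (ia p / 2 + 2 * id_ p) ^+ 2.
    have := coherent_c dp; have := sqr_ge0 (ia p / 2 - 2 * id_ p); nra.
  have q0 : 0 <= ia p / 2 + 2 * id_ p by lra.
  have /andP[c3 c4] := sqr_le_norm q0 h3.
  by rewrite /ig; split; lra.
move: gad agd h1 h2 a0 g0 d0; rewrite /if_.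
move: (ia p) (ig p) (id_ p) => a g d gad agd h1 h2 a0 g0 d0.
have [s1 s2] : a + d <= 26 * a /\ a + d <= 77 * g by split; lra.
have [s3 s4] : g + d <= 26 * g /\ g + d <= 77 * a by split; lra.
case: b; rewrite expr2.
  apply: (@le_trans _ _ ((26 * g) * (77 * a))); first by apply: ler_pM => //; lra.
  by have := mulr_gt0 a0 g0; lra.
apply: (@le_trans _ _ ((26 * a) * (77 * g))); first by apply: ler_pM => //; lra.
by have := mulr_gt0 a0 g0; lra.
Qed.

End InvariantsTheory.

(** * Monotonicity of the norm in the collar *)

Section Collar.
Variables (R : realType) (k : nat).
Hypothesis k2 : (2 <= k)%N.
Let K : R := k%:R.
Implicit Types (p q : invariants R) (b : bool).

Let K2 : 2 <= K. Proof. by rewrite /K ler_nat. Qed.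
Let K0 : 0 < K. Proof. exact: lt_le_trans K2. Qed.

(** Measured at the end point q, |z|^2 has lost at least 2 m e and |x|^2 has gained at most 4 K m a.
    The loss wins because 25 a <= e^k <= e^2 and e K <= 1 give 2 K a < e. *)
Lemma collar_first m p : coherent k p -> 0 < m -> collar_region (act k 0 m p) ->
  ie p * K ^+ 2 <= 1 ->
  ia (act k 0 m p) + ie (act k 0 m p) < ia p + ie p.
Proof.
move=> dp m0 r0 eK; set q := act k 0 m p.
have aq0 : 0 < ia q by rewrite mulr_gt0 ?expR_gt0 // (coherent_a dp).
have dq0 : 0 < id_ q := collar_region_d aq0 r0.
have dE : id_ q = ie q ^+ k.
  rewrite /q /= (coherent_d dp) exprMn; congr (_ * _).
  by rewrite -expRM_natl; congr expR; ring.
have eq0 : 0 < ie q.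
  have eq00 : 0 <= ie q by rewrite mulr_ge0 ?expR_ge0 // (coherent_e dp).
  rewrite lt0r eq00 andbT; apply/eqP => e0; move: dq0; rewrite dE e0 expr0n.
  by rewrite (gtn_eqF (ltnW k2)) ltxx.
have aE : ia p = expR (- (4 * K * m)) * ia q.
  by rewrite /q /= mulrA -expRD mulr0 add0r -/K addNr expR0 mul1r.
have eE : ie p = expR (2 * m) * ie q.
  by rewrite /q /= mulrA -expRD mulr0 add0r subrr expR0 mul1r.
have h1 : (1 - 4 * K * m) * ia q <= ia p.
  by rewrite aE ler_pM2r //; exact: expR_ge1Dx.
have h2 : (1 + 2 * m) * ie q <= ie p by rewrite eE ler_pM2r //; exact: expR_ge1Dx.
have eqp : ie q <= ie p by apply: le_trans h2; rewrite ler_peMl ?(ltW eq0) //; lra.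
have eqK : ie q * K ^+ 2 <= 1 by apply: le_trans eK; rewrite ler_wpM2r ?sqr_ge0.
have K21 : 1 <= K ^+ 2 by rewrite expr_ge1 //; have := K2; lra.
have eq1 : ie q <= 1.
  by apply: le_trans eqK; rewrite ler_peMr // ltW.
have dq : id_ q <= ie q ^+ 2.
  rewrite dE; case: k k2 => [|[|n]] // _; rewrite exprS exprS mulrA -expr2 ler_piMr ?sqr_ge0 //.
  by rewrite exprn_ile1 // ltW.
have h3 : 2 * K * ia q < ie q.
  have h4 : 25 * (ia q * K) <= ie q * (ie q * K).
    by have := r0; rewrite /collar_region -/q; have := K0; nra.
  have h5 : ie q * K <= 1.
    by apply: le_trans eqK; rewrite ler_pM2l // expr2 ler_peMr //; have := K2; lra.
  have h6 : ie q * (ie q * K) <= ie q by rewrite ler_piMr // ltW.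
  by have := eq0; lra.
have h7 : 0 < m * (ie q - 2 * K * ia q) by rewrite mulr_gt0 // subr_gt0.
by move: h1 h2 h7; lra.
Qed.

(** Besides [collar_first], two comparisons are needed: |h|^2 does not decrease ([third]), and 2 c +
    d does not increase ([second]). The latter serves b = true, where the first term of the norm is
    a + 2 c + d instead of a. *)
Lemma collar_mono b tau m p : coherent k p -> 0 < m -> collar_region (act k 0 m p) ->
  ie p * K ^+ 2 <= 1 -> 0 <= tau ->
  fibre_norm b tau (act k 0 m p) < fibre_norm b tau p.
Proof.
move=> dp m0 r0 eK tau0.
have hfirst := collar_first dp m0 r0 eK.
have a0 := coherent_a dp; have g0 := coherent_g dp; have d0 := coherent_d0 dp.
pose T := expR (K * m).
have T1 : 1 <= T by rewrite /T -expR0 ler_expR mulr_ge0 ?ltW.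
have T0 : 0 < T := expR_gt0 _.
have aE : ia (act k 0 m p) = T ^+ 4 * ia p.
  by rewrite /= /T -expRM_natl; congr (expR _ * _); rewrite -/K; ring.
have cE : ic (act k 0 m p) = T * ic p.
  by rewrite /= /T; congr (expR _ * _); rewrite -/K; ring.
have dE : T ^+ 2 * id_ (act k 0 m p) = id_ p.
  rewrite /= /T -expRM_natl mulrA -expRD -/K.
  by rewrite (_ : 2 * (K * m) + _ = 0) ?expR0 ?mul1r //; ring.
move: hfirst r0 dE; rewrite /collar_region /fibre_norm /if_ /ig aE cE; clear aE cE.
move: (ie p) (ie (act k 0 m p)) (id_ (act k 0 m p)) (coherent_c dp) a0 g0 d0 T1 T0.
rewrite /ig; move: (ia p) (ic p) (id_ p) T => a c d T e e' d' cad a0 g0 d0 T1 T0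
  hfirst r0 dE.
have a'0 : 0 < T ^+ 4 * a by rewrite mulr_gt0 ?exprn_gt0.
have d'0 : 0 < d' by lra.
have hc : - d' <= 5 * (T * c) <= d'.
  apply: sqr_le_norm; first exact: ltW.
  have : T ^+ 2 * c ^+ 2 <= a * T ^+ 4 * d'.
    rewrite (_ : a * T ^+ 4 * d' = T ^+ 2 * (a * (T ^+ 2 * d'))); last by ring.
    by rewrite dE ler_wpM2l ?sqr_ge0.
  have := ler_wpM2r (ltW d'0) r0.
  by lra.
have {hc} [hc1 hc2] : - d' <= 5 * (T * c) /\ 5 * (T * c) <= d' by move/andP: hc.
have third : a * (a + 2 * c + d) <= T ^+ 4 * a * (T ^+ 4 * a + 2 * (T * c) + d').
  rewrite (_ : T ^+ 4 * a * _ = a * (T ^+ 8 * a + 2 * (T ^+ 5 * c) + T ^+ 4 * d'));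
    last by ring.
  rewrite ler_pM2l // -dE.
  have h1 : 0 <= (T ^+ 8 - 1) * a.
    by rewrite mulr_ge0 ?(ltW a0) // subr_ge0 exprn_ege1.
  have h2 : 0 <= T ^+ 5 - 1 by rewrite subr_ge0 exprn_ege1.
  (* With 5 T |c| <= d', this inequality lets T^2 (T^2 - 1) d' absorb the term 2 (T^5 - 1) c when c
     < 0. *)
  have h3 : 2 * (T ^+ 5 - 1) <= 5 * (T ^+ 3 * (T ^+ 2 - 1)).
    rewrite -subr_ge0.
    have -> : 5 * (T ^+ 3 * (T ^+ 2 - 1)) - 2 * (T ^+ 5 - 1) =
      (T - 1) * (3 * T ^+ 4 + 3 * T ^+ 3 - 2 * T ^+ 2 - 2 * T - 2) by ring.
    rewrite mulr_ge0 ?subr_ge0 //.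
    have := exprn_ege1 4 T1; have := exprn_ege1 2 T1; have := exprn_ege1 3 T1.
    have : T ^+ 2 <= T ^+ 3 by rewrite ler_weXn2l.
    have : T ^+ 2 <= T ^+ 4 by rewrite ler_weXn2l.
    have : T <= T ^+ 3 by rewrite -{1}(expr1 T) ler_weXn2l.
    by lra.
  have T21 : 0 <= T ^+ 2 - 1 by rewrite subr_ge0 exprn_ege1.
  have T20 : 0 < T ^+ 2 by rewrite exprn_gt0.
  have h4 : - (T ^+ 2 * (T ^+ 2 - 1) * d') <= 2 * (T ^+ 5 - 1) * c.
    have [c0|c0] := leP 0 c.
      apply: (@le_trans _ _ 0); first by rewrite oppr_le0 !mulr_ge0 // ltW.
      by rewrite !mulr_ge0.
    have : 5 * (T ^+ 3 * (T ^+ 2 - 1)) * c <= 2 * (T ^+ 5 - 1) * c.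
      by rewrite ler_wnM2r // ltW.
    apply: le_trans.
    have -> : 5 * (T ^+ 3 * (T ^+ 2 - 1)) * c = T ^+ 2 * (T ^+ 2 - 1) * (5 * (T * c)).
      by ring.
    by rewrite -mulrN ler_wpM2l // mulr_ge0 // ltW.
  by move: h1 h4; lra.
have frac : tau / (T ^+ 4 * a * (T ^+ 4 * a + 2 * (T * c) + d')) <=
    tau / (a * (a + 2 * c + d)).
  by rewrite ler_wpM2l // lef_pV2 ?posrE //;
    [apply: lt_le_trans third; exact: mulr_gt0|exact: mulr_gt0].
have second : 2 * (T * c) + d' <= 2 * c + d.
  rewrite -dE.
  have : 0 <= (T - 1) * ((T + 1) * d' - 2 * c).
    rewrite mulr_ge0 ?subr_ge0 //.
    have Tc : 5 * c <= d'.
      have [c0|/ltW c0] := leP 0 c; last by lra.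
      by apply: le_trans hc2; rewrite ler_pM2l // ler_peMl.
    have : d' <= T * d' by rewrite ler_peMl // ltW.
    by move: d'0 Tc; lra.
  by lra.
by case: b; move: hfirst frac second; lra.
Qed.

End Collar.

(** * Rescaling of the core *)

Section Rescaling.
Variables (R : realType) (k : nat).
Hypothesis k2 : (2 <= k)%N.
Let K : R := k%:R.
Implicit Types (p q : invariants R) (b : bool) (tau rho : R).

Let K2 : 2 <= K. Proof. by rewrite /K ler_nat. Qed.
Let K0 : 0 < K. Proof. exact: lt_le_trans K2. Qed.

Definition cvg_inv (T : Type) (F : set_system T) (p : T -> invariants R) p0 : Prop :=
  [/\ ia (p t) @[t --> F] --> ia p0, ic (p t) @[t --> F] --> ic p0,
      id_ (p t) @[t --> F] --> id_ p0 & ie (p t) @[t --> F] --> ie p0].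

Lemma cvg_expR_comp (T : Type) (F : set_system T) (FF : Filter F) (u : T -> R) (u0 : R) :
  u @ F --> u0 -> expR (u t) @[t --> F] --> expR u0.
Proof. by move=> cu; apply: (cvg_comp _ _ cu); exact: continuous_expR. Qed.

Lemma cvg_act (T : Type) (F : set_system T) (FF : Filter F) (l n : T -> R) (l0 n0 : R) (p : T -> invariants R) p0 :
  l @ F --> l0 -> n @ F --> n0 -> cvg_inv F p p0 ->
  cvg_inv F (fun t => act k (l t) (n t) (p t)) (act k l0 n0 p0).
Proof.
move=> cl cn [ca cc cd ce]; split => /=; apply: cvgM => //; apply: cvg_expR_comp.
- by apply: cvgD; apply: cvgM => //; exact: cvg_cst.
- by apply: cvgD; apply: cvgM => //; exact: cvg_cst.
- by apply: cvgB; apply: cvgM => //; exact: cvg_cst.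
- by apply: cvgB; apply: cvgM => //; exact: cvg_cst.
Qed.

Lemma cvg_ig (T : Type) (F : set_system T) (FF : Filter F) (p : T -> invariants R) p0 :
  cvg_inv F p p0 -> ig (p t) @[t --> F] --> ig p0.
Proof.
move=> [ca cc cd ce]; rewrite /ig; apply: cvgD => //; apply: cvgD => //.
by apply: cvgM => //; exact: cvg_cst.
Qed.

Lemma cvg_if (T : Type) (F : set_system T) (FF : Filter F) b (p : T -> invariants R) p0 :
  cvg_inv F p p0 -> if_ b (p t) @[t --> F] --> if_ b p0.
Proof. by case: b => cp; [exact: cvg_ig|case: cp]. Qed.

Lemma cvg_kap (T : Type) (F : set_system T) (FF : Filter F) (tau : T -> R) (tau0 : R) (p : T -> invariants R) p0 :
  tau @ F --> tau0 -> cvg_inv F p p0 -> 0 < ia p0 -> 0 < ig p0 ->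
  tau t / (ia (p t) * ig (p t)) @[t --> F] --> tau0 / (ia p0 * ig p0).
Proof.
move=> ct cp a0 g0; apply: cvgM => //; apply: cvgV; first by rewrite mulf_neq0 ?gt_eqF.
by apply: cvgM; [case: cp|exact: cvg_ig].
Qed.

Lemma cvg_PP (T : Type) (F : set_system T) (FF : Filter F) b (tau : T -> R) (tau0 : R) (p : T -> invariants R) p0 :
  tau @ F --> tau0 -> cvg_inv F p p0 -> 0 < ia p0 -> 0 < ig p0 ->
  fibre_norm b (tau t) (p t) @[t --> F] --> fibre_norm b tau0 p0.
Proof.
move=> ct cp a0 g0; rewrite /fibre_norm; apply: cvgD; last exact: cvg_kap.
by apply: cvgD; [exact: cvg_if|case: cp].
Qed.

Definition boundary q := 25 * ia q = id_ q.

Lemma boundary_reg0 q : boundary q -> collar_region q.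
Proof. by rewrite /boundary /collar_region => ->. Qed.

(** The boundary of the collar belongs to the core, so the core rescaling applies there and can be
    continued into the collar. *)
Lemma boundary_core q : coherent k q -> boundary q -> core q.
Proof.
move=> dq bq; have := ig_reg0 (coherent_a dq) (coherent_d0 dq) (coherent_c dq) (boundary_reg0 bq).
have := coherent_d0 dq; have := coherent_a dq; move: bq; rewrite /boundary /core.
by move=> *; split; lra.
Qed.

Lemma boundary_act0 l q : boundary q -> boundary (act k l 0 q).
Proof. by rewrite /boundary ia_act0 id_act0 => <-; ring. Qed.

(** Going away from the core shrinks x and enlarges z, so the point stays in the collar, where
    [ig_reg0] keeps u nonzero. *)
Lemma collar_region_act n q : 0 <= n -> coherent k q -> collar_region q ->
  collar_region (act k 0 (- n) q) /\ coherent k (act k 0 (- n) q).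
Proof.
move=> n0 dq r0; set p := act _ _ _ _.
have nK : 0 <= K * n by rewrite mulr_ge0 // ltW.
have rp : collar_region p.
  rewrite /collar_region /p /= -/K; apply: (@le_trans _ _ (25 * ia q)).
    by rewrite ler_pM2l // ler_piMl ?(ltW (coherent_a dq)) // expR_le1; lra.
  apply: (le_trans r0); rewrite ler_peMl ?(coherent_d0 dq) // -[X in X <= _]expR0 ler_expR.
  by lra.
split => //; apply: coherent_act => //; rewrite -/p.
have ap : 0 < ia p by rewrite mulr_gt0 ?expR_gt0 // (coherent_a dq).
have dp := collar_region_d ap rp.
have cp : ic p ^+ 2 <= ia p * id_ p.
  have E : expR (2 * K * 0 + K * (- n)) ^+ 2 =
      expR (2 * K * 0 + 4 * K * (- n)) * expR (2 * K * 0 - 2 * K * (- n)).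
    by rewrite -expRD -expRM_natl; congr expR; ring.
  rewrite /p /= exprMn -/K E [leRHS]mulrACA ler_wpM2l ?mulr_ge0 ?expR_ge0 //.
  exact: coherent_c dq.
have := ig_reg0 ap (ltW dp) cp rp; lra.
Qed.

(** The norm at depth n behind the boundary point q; the sign is negative because positive
    parameters lead towards the core. *)
Definition collar b tau q : R -> R := fun n => fibre_norm b tau (act k 0 (- n) q).

Lemma fibre_norm_ie b tau p : coherent k p -> 0 <= tau -> ie p <= fibre_norm b tau p.
Proof.
move=> dp tau0; rewrite /fibre_norm.
have := ltW (coherent_if b dp).
have : 0 <= tau / (ia p * ig p) by rewrite divr_ge0 // mulr_ge0 // ltW; case: dp.
by lra.
Qed.

(** The smallness demanded by [collar_mono] comes from |z|^2 <= [fibre_norm] <= E, so only points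
    inside the tube are compared. The path leaves the tube because |z|^2 grows like e^(2n). *)
Lemma star_collar b tau q E : coherent k q -> boundary q -> 0 <= tau ->
  fibre_norm b tau q <= E -> E * K ^+ 2 <= 1 -> star (collar b tau q) E.
Proof.
move=> dq bq tau0 qE EK; have r0 := boundary_reg0 bq.
have K20 : 0 <= K ^+ 2 by rewrite sqr_ge0.
split.
- move=> s s0; have [rs ds] := collar_region_act s0 dq r0.
  apply: cvg_PP; [exact: cvg_cst| |exact: coherent_a ds|exact: coherent_g ds].
  by apply: cvg_act; [exact: cvg_cst|apply: cvgN; exact: cvg_id|split; exact: cvg_cst].
- by rewrite /collar oppr0 act00.
- move=> s s' s'0 ss sE; have s0 : 0 <= s by rewrite ltW // (le_lt_trans s'0).
  have [rs ds] := collar_region_act s0 dq r0.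
  have [rs' ds'] := collar_region_act s'0 dq r0.
  apply: (lt_le_trans _ sE).
  have E' : act k 0 (- s') q = act k 0 (s - s') (act k 0 (- s) q).
    by rewrite act_act addr0; congr act; ring.
  rewrite /collar E'; apply: collar_mono => //; rewrite ?subr_gt0 -?E' //.
  apply: (le_trans _ EK); rewrite ler_wpM2r //; apply: (le_trans _ sE); exact: fibre_norm_ie.
- have e0 : 0 < ie q.
    have dq0 := collar_region_d (coherent_a dq) r0.
    rewrite lt0r (coherent_e dq) andbT; apply/eqP => e0; move: dq0.
    by rewrite (coherent_d dq) e0 expr0n (gtn_eqF (ltnW k2)) ltxx.
  have E0 : 0 < E by apply: lt_le_trans qE; apply: lt_le_trans (fibre_norm_ie b dq tau0).
  have s0 : 0 <= E / ie q by rewrite divr_ge0 // ltW.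
  exists (E / ie q) => //; have [_ ds] := collar_region_act s0 dq r0.
  apply: lt_le_trans (fibre_norm_ie b ds tau0); rewrite /= mulr0 sub0r mulrN opprK.
  have := ler_wpM2r (ltW e0) (expR_ge1Dx (2 * (E / ie q))).
  rewrite mulrDl mul1r -mulrA divfK ?gt_eqF //.
  by lra.
Qed.

(* 2 rho is the radius of the tube and 50 ^+ 2 the constant of core_bound. *)
Definition small tau rho : Prop :=
  [/\ 0 < rho, 2 * rho * K <= 1, 0 < tau &
      50 ^+ 2 * tau <= (rho ^+ k) ^+ 4 * rho ^+ 2].

Lemma small_E tau rho : small tau rho -> 4 * rho ^+ 2 * K ^+ 2 <= 1.
Proof.
move=> [r0 rK _ _]; have -> : 4 * rho ^+ 2 * K ^+ 2 = (2 * rho * K) ^+ 2 by ring.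
by rewrite exprn_ile1 // !mulr_ge0 // ltW.
Qed.

Definition orbit_fun b tau q : R -> R := orbit_norm k (if_ b q) (ie q) (tau / (ia q * ig q)).
Definition cen b rho q : R := orbit_center k rho (if_ b q) (id_ q).

Lemma starlike_orbit b tau rho q : coherent k q -> core q -> small tau rho ->
  starlike (orbit_fun b tau q) (cen b rho q) (4 * rho ^+ 2).
Proof.
move=> dq cq [r0 rK t0 ht]; have ag0 : 0 < ia q * ig q by rewrite mulr_gt0 //; case: dq.
have r1 : rho <= 1.
  have : rho * K <= 1 / 2 by lra.
  by have : rho <= rho * K; [rewrite ler_peMr ?(ltW r0) //; have := K2; lra|lra].
apply: starlike_Pl => //; [exact: (coherent_if b dq)|exact: (coherent_e dq)|exact: divr_gt0|].
apply: (orbit_norm_center k2 (C := 50 ^+ 2)) => //; [exact: (coherent_if b dq)|exact: (coherent_e dq)|exact: (coherent_d dq)|].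
exact: (core_bound b dq cq).
Qed.

Lemma orbit_shift b tau l q x : orbit_fun b tau (act k l 0 q) x = orbit_fun b tau q (l + x).
Proof. by rewrite /orbit_fun if_act0 ie_act0 kap_act0 orbit_norm_shift. Qed.

Lemma cen_shift b rho l q : coherent k q -> cen b rho (act k l 0 q) = cen b rho q - l.
Proof.
move=> dq; have h : 0 < if_ b q + id_ q by rewrite ltr_wpDr ?(coherent_d0 dq) ?(coherent_if b dq).
rewrite /cen /orbit_center if_act0 id_act0 -mulrDr lnM ?posrE ?expR_gt0 // expRK -/K.
by field; rewrite gt_eqF.
Qed.

(** Changing the base point of an orbit only translates the stretch: the rescaling is intrinsic to
    the orbit. Invertibility in [core_shiftK] rests on this. *)
Lemma stretch_shift P P' (c c' E E' l y : R) :
  stretch (fun x => P (l + x)) (c - l) E (fun x => P' (l + x)) (c' - l) E' y =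
  stretch P c E P' c' E' (l + y) - l.
Proof.
rewrite /stretch /radr /radl.
have er (Q : R -> R) (d : R) : (fun s => Q (l + (d - l + s))) = (fun s => Q (d + s)).
  by apply/funext => s; congr Q; ring.
have el (Q : R -> R) (d : R) : (fun s => Q (l + (d - l - s))) = (fun s => Q (d - s)).
  by apply/funext => s; congr Q; ring.
rewrite !er !el.
have -> : y - (c - l) = l + y - c by ring.
have -> : c - l - y = c - (l + y) by ring.
by ring.
Qed.

(** The point q has parameter 0 on its own orbit, so the image of 0 is the amount by which q must be
    moved. *)
Definition core_shift b tau rho tau' rho' q : R :=
  stretch (orbit_fun b tau q) (cen b rho q) (4 * rho ^+ 2)
          (orbit_fun b tau' q) (cen b rho' q) (4 * rho' ^+ 2) 0.

Lemma fibre_norm_orbit b tau l q : fibre_norm b tau (act k l 0 q) = orbit_fun b tau q l.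
Proof. by rewrite fibre_norm_act0. Qed.

Lemma fibre_norm_orbit0 b tau q : fibre_norm b tau q = orbit_fun b tau q 0.
Proof. by rewrite -fibre_norm_orbit act00. Qed.

Section LamSpec.
Variables (b : bool) (tau rho tau' rho' : R) (q : invariants R).
Hypotheses (dq : coherent k q) (cq : core q) (gd : small tau rho) (gd' : small tau' rho').
Let l := core_shift b tau rho tau' rho' q.

Lemma core_shift_le : fibre_norm b tau q <= 4 * rho ^+ 2 -> fibre_norm b tau' (act k l 0 q) <= 4 * rho' ^+ 2.
Proof.
rewrite fibre_norm_orbit0 fibre_norm_orbit; apply: stretch_le; exact: starlike_orbit.
Qed.

Lemma core_shift_eq : fibre_norm b tau q = 4 * rho ^+ 2 -> fibre_norm b tau' (act k l 0 q) = 4 * rho' ^+ 2.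
Proof.
rewrite fibre_norm_orbit0 fibre_norm_orbit; apply: stretch_eq; exact: starlike_orbit.
Qed.

Lemma core_shiftK : core_shift b tau' rho' tau rho (act k l 0 q) = - l.
Proof.
rewrite {1}/core_shift !cen_shift //.
have e t : orbit_fun b t (act k l 0 q) = (fun x => orbit_fun b t q (l + x)).
  by apply/funext => x; exact: orbit_shift.
rewrite !e stretch_shift addr0 /l /core_shift stretchK ?sub0r //; exact: starlike_orbit.
Qed.

End LamSpec.

Lemma core_shift_cvg (T : Type) (F : set_system T) (FF : Filter F) b (rho rho' : R)
    (tau tau' : T -> R) (tau0 tau0' : R) (q : T -> invariants R) q0 :
  (\forall t \near F, [/\ coherent k (q t), core (q t), small (tau t) rho & small (tau' t) rho']) ->
  [/\ coherent k q0, core q0, small tau0 rho & small tau0' rho'] ->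
  tau @ F --> tau0 -> tau' @ F --> tau0' -> cvg_inv F q q0 ->
  core_shift b (tau t) rho (tau' t) rho' (q t) @[t --> F] --> core_shift b tau0 rho tau0' rho' q0.
Proof.
move=> near_ [dq0 cq0 g0 g0'] ct ct' cq; have [ca cc cd ce] := cq.
have ccen r : cen b r (q t) @[t --> F] --> cen b r q0.
  rewrite /cen /orbit_center; apply: cvgB; first exact: cvg_cst.
  apply: cvgM; last exact: cvg_cst.
  apply: (cvg_comp _ (@ln R) (G := nbhs (if_ b q0 + id_ q0))).
    by apply: cvgD => //; exact: cvg_if.
  by apply: continuous_ln; rewrite ltr_wpDr ?(coherent_d0 dq0) ?(coherent_if b dq0).
have a0 := coherent_a dq0; have gg0 := coherent_g dq0.
apply: stretch_cvg.
- by apply: filterS near_ => t [? ? ? ?]; exact: starlike_orbit.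
- exact: starlike_orbit.
- by apply: filterS near_ => t [? ? ? ?]; exact: starlike_orbit.
- exact: starlike_orbit.
- move=> s; apply: cvg_Pl => //; [exact: cvg_if|exact: cvg_kap|].
  by apply: cvgD => //; exact: cvg_cst.
- move=> s; apply: cvg_Pl => //; [exact: cvg_if|exact: cvg_kap|].
  by apply: cvgD => //; exact: cvg_cst.
- exact: ccen.
- exact: ccen.
- exact: cvg_cst.
Qed.

End Rescaling.

(** * Rescaling of the collar *)

Section CollarRescaling.
Variables (R : realType) (k : nat).
Hypothesis k2 : (2 <= k)%N.
Let K : R := k%:R.
Implicit Types (p q : invariants R) (b : bool) (tau rho : R).

Let K2 : 2 <= K. Proof. by rewrite /K ler_nat. Qed.
Let K0 : 0 < K. Proof. exact: lt_le_trans K2. Qed.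

(** The time n needed to reach the boundary: [act] with l = 0 multiplies the ratio d / (25 a) by
    e^(- 6 k n), and the boundary is where it equals 1. *)
Definition depth p : R := ln (id_ p / (25 * ia p)) / (6 * k%:R).

Definition to_boundary p := act k 0 (depth p) p.

Lemma to_boundaryP p : 0 < ia p -> 0 < id_ p -> boundary (to_boundary p).
Proof.
move=> a0 d0; rewrite /boundary /to_boundary /=.
have ra : 0 < id_ p / (25 * ia p) by rewrite divr_gt0 // mulr_gt0.
have e6 : expR (6 * K * depth p) = id_ p / (25 * ia p).
  by rewrite /depth -/K mulrC divfK ?lnK ?posrE // gt_eqF // mulr_gt0.
have -> : 2 * k%:R * 0 + 4 * k%:R * depth p = 6 * K * depth p - 2 * K * depth p.
  by rewrite -/K; ring.
rewrite expRD e6 mulr0 sub0r -/K mulrACA.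
by field; rewrite gt_eqF.
Qed.

Lemma depth_boundary n q : 0 < ia q -> boundary q -> depth (act k 0 (- n) q) = n.
Proof.
move=> a0 bq; rewrite /depth /= -bq -/K.
have -> : expR (2 * K * 0 - 2 * K * - n) * (25 * ia q) /
    (25 * (expR (2 * K * 0 + 4 * K * - n) * ia q)) = expR (6 * K * n).
  have -> : 2 * K * 0 - 2 * K * - n = 6 * K * n + (2 * K * 0 + 4 * K * - n) by ring.
  rewrite expRD; field.
  by rewrite !gt_eqF ?expR_gt0.
by rewrite expRK mulrC mulKf // gt_eqF // mulr_gt0.
Qed.

Lemma depth_ge0 p : 0 < ia p -> collar_region p -> 0 <= depth p.
Proof.
move=> a0 r0; rewrite /depth divr_ge0 ?mulr_ge0 ?(ltW K0) // ln_ge0 //.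
by rewrite ler_pdivlMr ?mul1r // mulr_gt0.
Qed.

Lemma from_boundary p : act k 0 (- depth p) (to_boundary p) = p.
Proof. by rewrite /to_boundary act_act addr0 addNr act00. Qed.

Lemma coherent_to_boundary p : coherent k p -> collar_region p -> coherent k (to_boundary p).
Proof.
move=> dp rp; apply: coherent_act => //; rewrite -/(to_boundary p).
have dp0 := collar_region_d (coherent_a dp) rp.
have bq := to_boundaryP (coherent_a dp) dp0.
have aq : 0 < ia (to_boundary p) by rewrite mulr_gt0 ?expR_gt0 // (coherent_a dp).
have rq := boundary_reg0 bq; have dq0 := collar_region_d aq rq.
have cq : ic (to_boundary p) ^+ 2 <= ia (to_boundary p) * id_ (to_boundary p).
  rewrite /= exprMn.
  have -> : expR (2 * k%:R * 0 + k%:R * depth p) ^+ 2 =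
      expR (2 * k%:R * 0 + 4 * k%:R * depth p) * expR (2 * k%:R * 0 - 2 * k%:R * depth p).
    by rewrite -expRD -expRM_natl; congr expR; ring.
  by rewrite [leRHS]mulrACA ler_wpM2l ?mulr_ge0 ?expR_ge0 // (coherent_c dp).
by have := ig_reg0 aq (ltW dq0) cq rq; lra.
Qed.

Lemma fibre_norm_to_boundary b tau p E : coherent k p -> collar_region p -> 0 <= tau ->
  fibre_norm b tau p <= E -> E * K ^+ 2 <= 1 -> fibre_norm b tau (to_boundary p) <= E.
Proof.
move=> dp rp tau0 pE EK.
have [n0|n0] := ltP 0 (depth p); last first.
  by rewrite /to_boundary (_ : depth p = 0) ?act00 //; apply/le_anti; rewrite n0 depth_ge0 // (coherent_a dp).
apply: (le_trans _ pE); apply/ltW/collar_mono => //.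
  apply: boundary_reg0; apply: to_boundaryP; first exact: coherent_a dp.
  exact: collar_region_d (coherent_a dp) rp.
apply: (le_trans _ EK); rewrite ler_wpM2r ?sqr_ge0 //; apply: (le_trans _ pE); exact: fibre_norm_ie dp tau0.
Qed.

Lemma act_factor (l n m : R) p :
  act k l (n - m) p = act k 0 (- m) (act k l 0 (act k 0 n p)).
Proof. by rewrite !act_act add0r !addr0 addrC. Qed.

Definition collar_length b tau rho q := sradius (collar k b tau q) (4 * rho ^+ 2).

(** If the old length is 0 then the depth is 0 too, and the value 0 of the quotient by zero gives
    the right answer 0. *)
Definition new_depth b tau rho tau' rho' p : R :=
  let q := to_boundary p in
  let q' := act k (core_shift k b tau rho tau' rho' q) 0 q in
  depth p * (collar_length b tau' rho' q' / collar_length b tau rho q).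

Section Spec.
Variables (b : bool) (tau rho tau' rho' : R) (p : invariants R).
Hypotheses (dp : coherent k p) (rp : collar_region p) (gd : small k tau rho) (gd' : small k tau' rho').
Hypothesis pE : fibre_norm b tau p <= 4 * rho ^+ 2.

Let q := to_boundary p.
Let l := core_shift k b tau rho tau' rho' q.
Let q' := act k l 0 q.
Let n1 := new_depth b tau rho tau' rho' p.

Lemma spec_q : [/\ coherent k q, boundary q, core q & fibre_norm b tau q <= 4 * rho ^+ 2].
Proof.
have dq := coherent_to_boundary dp rp.
have bq : boundary q := to_boundaryP (coherent_a dp) (collar_region_d (coherent_a dp) rp).
split => //; first exact: boundary_core dq bq.
have [_ _ t0 _] := gd.
exact: fibre_norm_to_boundary dp rp (ltW t0) pE (small_E gd).
Qed.

Lemma spec_q' : [/\ coherent k q', boundary q', core q' & fibre_norm b tau' q' <= 4 * rho' ^+ 2].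
Proof.
have [dq bq cq qE] := spec_q.
split; [exact: coherent_act0|exact: boundary_act0|exact: core_act0|exact: core_shift_le].
Qed.

Lemma spec_star : star (collar k b tau q) (4 * rho ^+ 2).
Proof.
have [dq bq _ qE] := spec_q; have [_ _ t0 _] := gd.
exact: (star_collar k2 dq bq (ltW t0) qE (small_E gd)).
Qed.

Lemma spec_star' : star (collar k b tau' q') (4 * rho' ^+ 2).
Proof.
have [dq bq _ qE] := spec_q'; have [_ _ t0 _] := gd'.
exact: (star_collar k2 dq bq (ltW t0) qE (small_E gd')).
Qed.

Lemma depth_rc : 0 <= depth p <= collar_length b tau rho q.
Proof.
have n0 := depth_ge0 (coherent_a dp) rp; rewrite n0 /= /collar_length -(sradius_leE spec_star n0).
by rewrite /collar from_boundary.
Qed.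

(** A collar has length 0 exactly when its boundary point lies on the sphere bounding the tube, and
    the core rescaling maps sphere to sphere in both directions. *)
Lemma collar_length_eq0 : (collar_length b tau rho q == 0) = (collar_length b tau' rho' q' == 0).
Proof.
rewrite /collar_length (sradius_eq0 spec_star) (sradius_eq0 spec_star') /collar oppr0 !act00.
have [dq bq cq qE] := spec_q; have [dq' bq' cq' qE'] := spec_q'.
apply/eqP/eqP => h; first exact: core_shift_eq.
have -> : q = act k (core_shift k b tau' rho' tau rho q') 0 q'.
  by rewrite /q' /l core_shiftK // act_act addNr addr0 act00.
exact: core_shift_eq.
Qed.

Lemma new_depth_rc : 0 <= n1 <= collar_length b tau' rho' q'.
Proof.
have /andP[n0 nr] := depth_rc.
have r0 : 0 <= collar_length b tau rho q := sradius_ge0 spec_star.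
have r0' : 0 <= collar_length b tau' rho' q' := sradius_ge0 spec_star'.
rewrite /n1 /new_depth -/q -/l -/q'; apply/andP; split.
  exact: mulr_ge0 n0 (divr_ge0 r0' r0).
have [->|rn0] := eqVneq (collar_length b tau rho q) 0; first by rewrite invr0 !mulr0.
have rp0 : 0 < collar_length b tau rho q by rewrite lt0r rn0.
by rewrite mulrA ler_pdivrMr // mulrC ler_wpM2l.
Qed.

Let p' := act k l (depth p - n1) p.

Lemma spec_p'E : p' = act k 0 (- n1) q'.
Proof. exact: act_factor. Qed.

Lemma spec_p' : [/\ coherent k p', collar_region p' & fibre_norm b tau' p' <= 4 * rho' ^+ 2].
Proof.
have [dq' bq' cq' qE'] := spec_q'; have /andP[n1ge n1rc] := new_depth_rc.
have [r1 d1] := collar_region_act n1ge dq' (boundary_reg0 bq').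
rewrite spec_p'E; split => //.
have := sradius_leE spec_star' n1ge; rewrite /collar => ->.
exact: n1rc.
Qed.

Lemma spec_back : core_shift k b tau' rho' tau rho (to_boundary p') = - l /\
  depth p' = n1 /\ new_depth b tau' rho' tau rho p' = depth p.
Proof.
have [dq bq cq qE] := spec_q.
have [dq' bq' cq' qE'] := spec_q'; have /andP[n1ge n1rc] := new_depth_rc.
have np : depth p' = n1 by rewrite spec_p'E depth_boundary // (coherent_a dq').
have tb : to_boundary p' = q'.
  by rewrite /to_boundary np spec_p'E act_act addr0 subrr act00.
have lE : core_shift k b tau' rho' tau rho q' = - l by exact: core_shiftK.
split; first by rewrite tb.
split => //; rewrite /new_depth np tb lE.
have -> : act k (- l) 0 q' = q by rewrite /q' act_act addNr addr0 act00.
rewrite /n1 /new_depth -/q -/l -/q'.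
have [r0|rn0] := eqVneq (collar_length b tau rho q) 0.
  by have := depth_rc; rewrite r0 => /le_anti <-; rewrite !mul0r.
have rn0' : collar_length b tau' rho' q' != 0 by rewrite -collar_length_eq0.
by field; rewrite rn0 rn0'.
Qed.

End Spec.

Lemma cvg_nu0 (T : Type) (F : set_system T) (FF : Filter F) (p : T -> invariants R) p0 :
  0 < ia p0 -> 0 < id_ p0 -> cvg_inv F p p0 -> depth (p t) @[t --> F] --> depth p0.
Proof.
move=> a0 d0 [ca cc cd ce]; rewrite /depth; apply: cvgM; last exact: cvg_cst.
apply: (cvg_comp _ (@ln R) (G := nbhs (id_ p0 / (25 * ia p0)))).
  apply: cvgM => //; apply: cvgV; first by rewrite gt_eqF // mulr_gt0.
  by apply: cvgM => //; exact: cvg_cst.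
by apply: continuous_ln; rewrite divr_gt0 // mulr_gt0.
Qed.

Definition admissible b tau rho tau' rho' p :=
  [/\ coherent k p, collar_region p, small k tau rho, small k tau' rho' & fibre_norm b tau p <= 4 * rho ^+ 2].

Lemma cvg_collar_rescaling (T : Type) (F : set_system T) (FF : Filter F) b (rho rho' : R)
    (tau tau' : T -> R) (tau0 tau0' : R) (p : T -> invariants R) p0 :
  (\forall t \near F, admissible b (tau t) rho (tau' t) rho' (p t)) ->
  admissible b tau0 rho tau0' rho' p0 ->
  tau @ F --> tau0 -> tau' @ F --> tau0' -> cvg_inv F p p0 ->
  core_shift k b (tau t) rho (tau' t) rho' (to_boundary (p t)) @[t --> F]
    --> core_shift k b tau0 rho tau0' rho' (to_boundary p0) /\
  depth (p t) - new_depth b (tau t) rho (tau' t) rho' (p t) @[t --> F]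
    --> depth p0 - new_depth b tau0 rho tau0' rho' p0.
Proof.
move=> nearp [dp0 rp0 g0 g0' pE0] ct ct' cp.
have a0 := coherent_a dp0; have d0 := collar_region_d a0 rp0.
have cn : depth (p t) @[t --> F] --> depth p0 by exact: cvg_nu0.
have cq : cvg_inv F (fun t => to_boundary (p t)) (to_boundary p0).
  by apply: cvg_act => //; exact: cvg_cst.
have [dq0 bq0 cq0 qE0] := spec_q dp0 rp0 g0 pE0.
have cl : core_shift k b (tau t) rho (tau' t) rho' (to_boundary (p t)) @[t --> F]
    --> core_shift k b tau0 rho tau0' rho' (to_boundary p0).
  apply: core_shift_cvg => //.
  by apply: filterS nearp => t [dp rp g g' pE]; have [] := spec_q dp rp g pE.
split => //; apply: cvgB => //.
set q0 := to_boundary p0 in dq0 bq0 cq0 qE0 cq cl *.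
set l0 := core_shift _ _ _ _ _ _ q0 in cl *.
pose q' t := act k (core_shift k b (tau t) rho (tau' t) rho' (to_boundary (p t))) 0
  (to_boundary (p t)).
pose q0' := act k l0 0 q0.
have cq' : cvg_inv F q' q0' by apply: cvg_act => //; exact: cvg_cst.
have [dq0' bq0' cq0' qE0'] := spec_q' dp0 rp0 g0 g0' pE0.
have ccollar (sig : T -> R) sig0 (u : T -> invariants R) u0 s :
    0 <= s -> coherent k u0 -> boundary u0 -> sig @ F --> sig0 -> cvg_inv F u u0 ->
    collar k b (sig t) (u t) s @[t --> F] --> collar k b sig0 u0 s.
  move=> s0 du bu csig cu; have [rs ds] := collar_region_act s0 du (boundary_reg0 bu).
  apply: cvg_PP => //; [|exact: coherent_a ds|exact: coherent_g ds].
  by apply: cvg_act => //; exact: cvg_cst.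
have crc : collar_length b (tau t) rho (to_boundary (p t)) @[t --> F] --> collar_length b tau0 rho q0.
  apply: sradius_cvg; last by move=> s s0; exact: ccollar.
    by apply: filterS nearp => t [dp rp g g' pE]; exact: spec_star.
  exact: spec_star.
have crc' : collar_length b (tau' t) rho' (q' t) @[t --> F] --> collar_length b tau0' rho' q0'.
  apply: sradius_cvg; last by move=> s s0; exact: ccollar.
    by apply: filterS nearp => t [dp rp g g' pE]; exact: (spec_star' dp rp g g' pE).
  exact: (spec_star' dp0 rp0 g0 g0' pE0).
(* Where the old length vanishes the quotient of lengths need not converge; the new length vanishes
   there as well and squeezes the new depth to 0. *)
have [r00|rn0] := eqVneq (collar_length b tau0 rho q0) 0; last first.
  by apply: cvgM => //; apply: cvgM => //; exact: cvgV.
have r00' : collar_length b tau0' rho' q0' = 0.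
  by apply/eqP; rewrite -(collar_length_eq0 dp0 rp0 g0 g0' pE0) r00.
have -> : new_depth b tau0 rho tau0' rho' p0 = 0.
  have := depth_rc dp0 rp0 g0 pE0; rewrite r00 => /le_anti n00.
  by rewrite /new_depth -n00 mul0r.
rewrite r00' in crc'.
apply: (squeeze_cvgr _ (cvg_cst 0) crc').
apply: filterS nearp => t [dp rp g g' pE].
exact: (new_depth_rc dp rp g g' pE).
Qed.

End CollarRescaling.

(** * Action on the points of the tube *)

Section Points.
Variables (R : realType) (k : nat).
Hypothesis k2 : (2 <= k)%N.
Let K : R := k%:R.
Implicit Types (v : 'rV[R]_6).

(* u = x + z^k *)
Definition ure v : R := co 0 v + zre k v.
Definition uim v : R := co 1 v + zim k v.

Definition mkinv (x1 x2 a1 a2 z1 z2 : R) : invariants R :=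
  Invariants (x1 ^+ 2 + x2 ^+ 2) (x1 * a1 + x2 * a2) (a1 ^+ 2 + a2 ^+ 2) (z1 ^+ 2 + z2 ^+ 2).

(* The involution (x, z) |-> (- u, z) exchanges |x| and |u|; inv_ true is the
   tuple of invariants of the image of (x, z). *)
Definition inv_ (b : bool) v : invariants R :=
  if b then mkinv (- ure v) (- uim v) (zre k v) (zim k v) (co 4 v) (co 5 v)
  else mkinv (co 0 v) (co 1 v) (zre k v) (zim k v) (co 4 v) (co 5 v).

Definition x2 v : R := co 0 v ^+ 2 + co 1 v ^+ 2.
Definition u2 v : R := ure v ^+ 2 + uim v ^+ 2.

Lemma ia_inv b v : ia (inv_ b v) = if b then u2 v else x2 v.
Proof. by case: b; rewrite //= !sqrrN. Qed.

Lemma ig_inv b v : ig (inv_ b v) = if b then x2 v else u2 v.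
Proof.
case: b; rewrite /ig /= /x2 /u2 /ure /uim;
by move: (co 0 v) (co 1 v) (zre k v) (zim k v) => *; ring.
Qed.

Lemma if_inv b v : if_ b (inv_ b v) = x2 v.
Proof. by case: b; rewrite /if_ ?ig_inv ?ia_inv. Qed.

Lemma id_inv b v : id_ (inv_ b v) = zre k v ^+ 2 + zim k v ^+ 2.
Proof. by case: b. Qed.

Lemma ie_inv b v : ie (inv_ b v) = co 4 v ^+ 2 + co 5 v ^+ 2.
Proof. by case: b. Qed.

Lemma iag_inv b v : ia (inv_ b v) * ig (inv_ b v) = x2 v * u2 v.
Proof. by rewrite ia_inv ig_inv; case: b; rewrite // mulrC. Qed.

Lemma zreim_norm n v :
  zre n v ^+ 2 + zim n v ^+ 2 = (co 4 v ^+ 2 + co 5 v ^+ 2) ^+ n.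
Proof.
elim: n => [|n IH]; first by rewrite zre0 zim0 expr0n expr1n addr0.
rewrite (exprS _ n) -IH zreS zimS.
by move: (co 4 v) (co 5 v) (zre n v) (zim n v) => *; ring.
Qed.

Lemma coherent_inv b v : 0 < x2 v -> 0 < u2 v -> coherent k (inv_ b v).
Proof.
move=> x0 u0; split.
- by rewrite id_inv ie_inv zreim_norm.
- by rewrite ie_inv addr_ge0 ?sqr_ge0.
- by rewrite ia_inv; case: b.
- by rewrite ig_inv; case: b.
- have cs (a b' c d : R) : (a * c + b' * d) ^+ 2 <= (a ^+ 2 + b' ^+ 2) * (c ^+ 2 + d ^+ 2).
    rewrite -subr_ge0.
    have -> : (a ^+ 2 + b' ^+ 2) * (c ^+ 2 + d ^+ 2) - (a * c + b' * d) ^+ 2 =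
      (a * d - b' * c) ^+ 2 by ring.
    exact: sqr_ge0.
  by case: b; exact: cs.
Qed.

(* v |-> (A x + C z^k, y, B z) *)
Definition mv (c : R * R * R) v (y1 y2 : R) : 'rV[R]_6 :=
  let: (A, C, B) := c in
  mk6 (A * co 0 v + C * zre k v) (A * co 1 v + C * zim k v) y1 y2
      (B * co 4 v) (B * co 5 v).

Lemma zreimZ n (B : R) v w : co 4 w = B * co 4 v -> co 5 w = B * co 5 v ->
  zre n w = B ^+ n * zre n v /\ zim n w = B ^+ n * zim n v.
Proof.
move=> h4 h5; elim: n => [|n [IH1 IH2]].
  by rewrite !zre0 !zim0 expr0 !mul1r.
rewrite !zreS !zimS IH1 IH2 h4 h5 (exprS _ n).
by move: (co 4 v) (co 5 v) (zre n v) (zim n v) (B ^+ n) => *; split; ring.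
Qed.

Lemma zreim_mv (A C B : R) v y1 y2 :
  zre k (mv (A, C, B) v y1 y2) = B ^+ k * zre k v /\
  zim k (mv (A, C, B) v y1 y2) = B ^+ k * zim k v.
Proof. by apply: zreimZ; rewrite co_mk6. Qed.

(** For b = true the scaling is conjugated by the involution: u goes to A u and z to B z, so x goes
    to A u - B^k z^k = A x + (A - B^k) z^k. *)
Definition coef (b : bool) (l n : R) : R * R * R :=
  let A := expR (k%:R * l + 2 * k%:R * n) in
  let B := expR (l - n) in
  (A, if b then A - B ^+ k else 0, B).

Lemma inv_mv b l n v y1 y2 : inv_ b (mv (coef b l n) v y1 y2) = act k l n (inv_ b v).
Proof.
have BE : expR (l - n) ^+ k = expR (K * l - K * n).
  by rewrite -expRM_natl mulrBr.
have eA : expR (2 * K * l + 4 * K * n) = expR (K * l + 2 * K * n) ^+ 2.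
  by rewrite -expRM_natl; congr expR; ring.
have eC : expR (2 * K * l + K * n) = expR (K * l + 2 * K * n) * expR (K * l - K * n).
  by rewrite -expRD; congr expR; ring.
have eD : expR (2 * K * l - 2 * K * n) = expR (K * l - K * n) ^+ 2.
  by rewrite -expRM_natl; congr expR; ring.
have eE : expR (2 * l - 2 * n) = expR (l - n) ^+ 2.
  by rewrite -expRM_natl; congr expR; ring.
rewrite /act -/K eA eC eD eE.
have [zr zi] := zreim_mv (expR (K * l + 2 * K * n))
  (if b then expR (K * l + 2 * K * n) - expR (l - n) ^+ k else 0) (expR (l - n)) v y1 y2.
rewrite /coef -/K /inv_ /ure /uim; case: b zr zi => zr zi.
  rewrite zr zi /mkinv !co_mk6 BE /=.
  move: (co 0 v) (co 1 v) (zre k v) (zim k v) (co 4 v) (co 5 v) => x y a b c d.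
  by congr Invariants; ring.
rewrite zr zi /mkinv !co_mk6 BE /=.
move: (co 0 v) (co 1 v) (zre k v) (zim k v) (co 4 v) (co 5 v) => x y a b c d.
by congr Invariants; ring.
Qed.

Lemma mvK b l n v y1 y2 y1' y2' :
  mv (coef b (- l) (- n)) (mv (coef b l n) v y1 y2) y1' y2' =
  mk6 (co 0 v) (co 1 v) y1' y2' (co 4 v) (co 5 v).
Proof.
have eA : expR (K * - l + 2 * K * - n) * expR (K * l + 2 * K * n) = 1.
  by rewrite -expRD -[RHS]expR0; congr expR; ring.
have eB : expR (- l - - n) * expR (l - n) = 1.
  by rewrite -expRD -[RHS]expR0; congr expR; ring.
have [zr zi] := zreim_mv (expR (K * l + 2 * K * n))
  (if b then expR (K * l + 2 * K * n) - expR (l - n) ^+ k else 0) (expR (l - n)) v y1 y2.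
have eBk : expR (- l - - n) ^+ k * expR (l - n) ^+ k = 1 by rewrite -exprMn eB expr1n.
rewrite {1}/mv /coef -/K zr zi !co_mk6.
move: eA eB eBk; set A := expR (K * l + _); set A' := expR (K * - l + _).
set B := expR (l - n); set B' := expR (- l - _); move=> eA eB eBk.
have key (a0 a1 : R) : A' * (A * a0 + (if b then A - B ^+ k else 0) * a1) +
    (if b then A' - B' ^+ k else 0) * (B ^+ k * a1) = a0.
  case: b {zr zi}; last by rewrite mul0r addr0 mulrA eA mul1r mul0r addr0.
  have -> : A' * (A * a0 + (A - B ^+ k) * a1) + (A' - B' ^+ k) * (B ^+ k * a1) =
    A' * A * a0 + (A' * A - B' ^+ k * B ^+ k) * a1 by ring.
  by rewrite eA eBk subrr mul0r addr0 mul1r.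
by rewrite !key !mulrA eB !mul1r.
Qed.

(** [h1] and [h2] are the real and imaginary parts of h = conj x * u. *)
Definition h1 v : R := co 0 v * ure v + co 1 v * uim v.
Definition h2 v : R := co 0 v * uim v - co 1 v * ure v.

Lemma h_norm v : h1 v ^+ 2 + h2 v ^+ 2 = x2 v * u2 v.
Proof. by rewrite /h1 /h2 /x2 /u2; move: (ure v) (uim v) => *; ring. Qed.

Lemma FreE v : Fre k v = co 2 v * h1 v - co 3 v * h2 v.
Proof. by rewrite /Fre /h1 /h2 -/(ure v) -/(uim v); move: (ure v) (uim v) => *; ring. Qed.
Lemma FimE v : Fim k v = co 2 v * h2 v + co 3 v * h1 v.
Proof. by rewrite /Fim /h1 /h2 -/(ure v) -/(uim v); move: (ure v) (uim v) => *; ring. Qed.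

Definition n2 (w : 'rV[R]_2) : R := w 0 0 ^+ 2 + w 0 1 ^+ 2.

Lemma n2_Fk v : n2 (Fk k v) = (co 2 v ^+ 2 + co 3 v ^+ 2) * (x2 v * u2 v).
Proof.
rewrite /n2 FkE0 FkE1 FreE FimE -h_norm.
by move: (h1 v) (h2 v) => *; ring.
Qed.

Lemma enorm2E (w : 'rV[R]_2) : enorm w ^+ 2 = n2 w.
Proof.
rewrite /enorm sqr_sqrtr; last by apply: sumr_ge0 => i _; rewrite sqr_ge0.
rewrite !big_ord_recl big_ord0 addr0 /n2; congr (_ + w 0 _ ^+ 2).
exact/val_inj.
Qed.

Lemma enorm6E v : enorm v ^+ 2 =
  x2 v + (co 2 v ^+ 2 + co 3 v ^+ 2) + (co 4 v ^+ 2 + co 5 v ^+ 2).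
Proof.
rewrite /enorm sqr_sqrtr; last by apply: sumr_ge0 => i _; rewrite sqr_ge0.
rewrite !big_ord_recl big_ord0 addr0 /x2 co.unlock !addrA.
by do ! [congr (_ + _)]; congr (v 0 _ ^+ 2); apply/val_inj; rewrite /= inordK.
Qed.

Lemma fibre_norm_inv b v : 0 < n2 (Fk k v) ->
  fibre_norm b (n2 (Fk k v)) (inv_ b v) = enorm v ^+ 2.
Proof.
move=> F0; rewrite /fibre_norm if_inv ie_inv iag_inv enorm6E n2_Fk.
have h0 : x2 v * u2 v != 0.
  by apply/eqP => h0; move: F0; rewrite n2_Fk h0 mulr0 ltxx.
by rewrite mulfK // addrAC.
Qed.

Lemma n2_gt0 v : 0 < n2 (Fk k v) -> 0 < x2 v /\ 0 < u2 v.
Proof.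
rewrite n2_Fk => F0.
have x0 : 0 <= x2 v by rewrite addr_ge0 ?sqr_ge0.
have u0 : 0 <= u2 v by rewrite addr_ge0 ?sqr_ge0.
split; rewrite lt0r ?x0 ?u0 andbT; apply/eqP => h; move: F0.
  by rewrite h mul0r mulr0 ltxx.
by rewrite h !mulr0 ltxx.
Qed.

End Points.

(** * Gluing the core and the two collars *)

Section Transport.
Variables (R : realType) (k : nat).
Hypothesis k2 : (2 <= k)%N.
Let K : R := k%:R.
Implicit Types (v : 'rV[R]_6) (tau rho : R) (b : bool).

Definition near_zero b v : bool := 25 * ia (inv_ k b v) <= id_ (inv_ k b v).

Definition coef_collar b tau rho tau' rho' v : R * R * R :=
  let p := inv_ k b v in
  coef k b (core_shift k b tau rho tau' rho' (to_boundary k p))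
           (depth k p - new_depth k b tau rho tau' rho' p).

Definition coef_core b tau rho tau' rho' v : R * R * R :=
  coef k b (core_shift k b tau rho tau' rho' (inv_ k b v)) 0.

Definition coefs tau rho tau' rho' v : R * R * R :=
  if near_zero false v then coef_collar false tau rho tau' rho' v
  else if near_zero true v then coef_collar true tau rho tau' rho' v
  else coef_core false tau rho tau' rho' v.

Lemma coef_core_true (l : R) : coef k true l 0 = coef k false l 0.
Proof.
by rewrite /coef mulr0 addr0 subr0 -expRM_natl subrr.
Qed.

(** The weighted scaling commutes with the involution, and [core_shift] only involves |x|^2, |z|^2,
    |z|^(2k) and |h|^2, the same for both values of b. One core formula thus matches both
    collars. *)
Lemma coef_coreE b tau rho tau' rho' v :
  coef_core b tau rho tau' rho' v = coef_core false tau rho tau' rho' v.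
Proof.
case: b; last by [].
rewrite /coef_core coef_core_true; congr (coef k false _ 0).
by rewrite /core_shift /orbit_fun /cen !if_inv !ie_inv !iag_inv !id_inv.
Qed.

(** In one collar the other of |x|^2, |u|^2 is at least 3/5 of |z|^(2k), far above 1/25. *)
Lemma near_zero_excl b v : 0 < x2 v -> 0 < u2 k v ->
  near_zero b v -> ~~ near_zero (~~ b) v.
Proof.
move=> x0 u0 r0; have dp := coherent_inv b x0 u0.
have := ig_reg0 (coherent_a dp) (coherent_d0 dp) (coherent_c dp) r0.
have := collar_region_d (coherent_a dp) r0.
rewrite /near_zero -ltNge !ia_inv ig_inv !id_inv.
by case: b {r0 dp} => /=; lra.
Qed.

Definition valid tau rho tau' rho' v : Prop :=
  [/\ 0 < x2 v, 0 < u2 k v, small k tau rho, small k tau' rho' &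
      fibre_norm false tau (inv_ k false v) <= 4 * rho ^+ 2].

Lemma fibre_norm_bool b tau v : fibre_norm b tau (inv_ k b v) = fibre_norm false tau (inv_ k false v).
Proof. by rewrite /fibre_norm !if_inv !ie_inv !iag_inv. Qed.

Lemma valid_admissible b tau rho tau' rho' v : valid tau rho tau' rho' v ->
  near_zero b v -> admissible k b tau rho tau' rho' (inv_ k b v).
Proof.
by move=> [x0 u0 g g' pE] r0; split => //; [exact: coherent_inv|rewrite fibre_norm_bool].
Qed.

Lemma core_near v : ~~ near_zero false v -> ~~ near_zero true v -> core (inv_ k false v).
Proof.
rewrite /near_zero -!ltNge /core !ia_inv !id_inv ig_inv => h1 h2.
by split; exact: ltW.
Qed.

Lemma near_zero_mv b b' (l : R) v y1 y2 : near_zero b (mv k (coef k b' l 0) v y1 y2) = near_zero b v.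
Proof.
have -> : coef k b' l 0 = coef k b l 0 by case: b b' => -[] //; rewrite coef_core_true.
by rewrite /near_zero inv_mv ia_act0 id_act0 mulrCA ler_pM2l ?expR_gt0.
Qed.

Lemma coefs_spec tau rho tau' rho' v : valid tau rho tau' rho' v ->
  exists b l n, coefs tau rho tau' rho' v = coef k b l n /\
    forall y1 y2, let v' := mv k (coef k b l n) v y1 y2 in
    valid tau' rho' tau rho v' /\ coefs tau' rho' tau rho v' = coef k b (- l) (- n).
Proof.
move=> vv; have [x0 u0 g g' pE] := vv.
have pos b v' : coherent k (inv_ k b v') -> 0 < x2 v' /\ 0 < u2 k v'.
  by case=> _ _; rewrite ia_inv ig_inv; case: b => h h' _; split.
have collar_case b : near_zero b v -> (b -> ~~ near_zero false v) ->
    exists l n, coefs tau rho tau' rho' v = coef k b l n /\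
    forall y1 y2, let v' := mv k (coef k b l n) v y1 y2 in
    valid tau' rho' tau rho v' /\ coefs tau' rho' tau rho v' = coef k b (- l) (- n).
  move=> r0 nb; have [dp rp _ _ pbE] := valid_admissible vv r0.
  set p := inv_ k b v in dp rp pbE.
  pose l := core_shift k b tau rho tau' rho' (to_boundary k p).
  pose n := depth k p - new_depth k b tau rho tau' rho' p.
  exists l, n; split.
    by rewrite /coefs; case: b r0 nb @p dp rp pbE @l @n => [r0 /(_ isT)/negbTE ->|->] //;
      rewrite r0.
  move=> y1 y2 v'; have pv : inv_ k b v' = act k l n p by rewrite /v' inv_mv.
  have [dp' rp' pE'] := spec_p' k2 dp rp g g' pbE.
  have [lb [nb0 nb1]] := spec_back k2 dp rp g g' pbE.
  rewrite -/n -/l -pv in dp' rp' pE' lb nb0 nb1.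
  have [x0' u0'] := pos _ _ dp'.
  split; first by split => //; rewrite -(fibre_norm_bool b).
  have rv' : near_zero b v' by [].
  (* The image stays in the same collar, so the same branch is selected on the way back. *)
  have -> : coefs tau' rho' tau rho v' = coef_collar b tau' rho' tau rho v'.
    rewrite /coefs; case: b {r0 nb dp rp pbE pv dp' pE' lb nb0 nb1 p l n} v' rp' rv' x0' u0'
      => v' _ rv' x0' u0'; last by rewrite rv'.
    by rewrite (negbTE (near_zero_excl x0' u0' rv')) rv'.
  rewrite /coef_collar lb nb0 nb1; congr (coef k b _ _).
  by rewrite /n opprB.
case r0: (near_zero false v).
  by have [//|//|l [n h]] := collar_case false; exists false, l, n.
case r1: (near_zero true v).
  have [//|_|l [n h]] := collar_case true; first by rewrite r0.
  by exists true, l, n.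
have cp : core (inv_ k false v) by apply: core_near; rewrite ?r0 ?r1.
have dp := coherent_inv false x0 u0.
exists false, (core_shift k false tau rho tau' rho' (inv_ k false v)), 0; split.
  by rewrite /coefs r0 r1.
move=> y1 y2 v'; set l := core_shift _ _ _ _ _ _ _ in v' *.
have pv : inv_ k false v' = act k l 0 (inv_ k false v) by rewrite /v' inv_mv.
have dp' : coherent k (inv_ k false v') by rewrite pv; exact: coherent_act0.
have [x0' u0'] := pos _ _ dp'.
split.
  by split => //; rewrite pv; apply: core_shift_le.
rewrite /coefs /v' !near_zero_mv r0 r1 /coef_core -/v' pv core_shiftK // -/l.
by rewrite oppr0.
Qed.

Lemma cvg_if_within (T : Type) (U : topologicalType) (F : set_system T) (FF : Filter F)
    (c : T -> bool) (g h : T -> U) (l : U) :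
  g @ within [set t | c t] F --> l -> h @ within [set t | ~~ c t] F --> l ->
  (if c t then g t else h t) @[t --> F] --> l.
Proof.
move=> gl hl A Al.
have gA : F [set t | c t -> A (g t)] := gl A Al.
have hA : F [set t | ~~ c t -> A (h t)] := hl A Al.
suff : F [set t | A (if c t then g t else h t)] by [].
apply: filterS (filterI gA hA) => t /= [].
by case: (c t) => gAt hAt; [exact: gAt|exact: hAt].
Qed.

Lemma cvg_within_false (T : Type) (U : topologicalType) (F : set_system T) (FF : Filter F)
    (C : set T) (g : T -> U) (l : U) :
  (\forall t \near F, ~ C t) -> g @ within C F --> l.
Proof.
move=> nC A _; suff : F [set t | C t -> A (g t)] by [].
by apply: filterS nC => t nCt /nCt.
Qed.

Lemma cvg_pair_nbhs (T : Type) (U V : topologicalType) (F : set_system T)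
    (FF : Filter F) (f : T -> U) (g : T -> V) (a : U) (b : V) :
  f @ F --> a -> g @ F --> b -> (f t, g t) @[t --> F] --> (a, b).
Proof. by move=> fa gb; exact: (cvg_pair fa gb). Qed.

Lemma cvg_coef (T : Type) (F : set_system T) (FF : Filter F) b (l n : T -> R) (l0 n0 : R) :
  l @ F --> l0 -> n @ F --> n0 -> coef k b (l t) (n t) @[t --> F] --> coef k b l0 n0.
Proof.
move=> cl cn.
have cA : expR (k%:R * l t + 2 * k%:R * n t) @[t --> F]
    --> expR (k%:R * l0 + 2 * k%:R * n0).
  by apply: cvg_expR_comp; apply: cvgD; apply: cvgM => //; exact: cvg_cst.
have cB : expR (l t - n t) @[t --> F] --> expR (l0 - n0).
  by apply: cvg_expR_comp; exact: cvgB.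
rewrite /coef; apply: cvg_pair_nbhs; [apply: cvg_pair_nbhs => //|exact: cB].
case: b => /=; last exact: cvg_cst.
apply: cvgB => //; apply: (cvg_comp _ (fun x : R => x ^+ k) cB).
exact: exprn_continuous.
Qed.

Lemma cvg_co (T : Type) (F : set_system T) (FF : Filter F) (v : T -> 'rV[R]_6) v0 j :
  v @ F --> v0 -> co j (v t) @[t --> F] --> co j v0.
Proof.
move=> cv; apply: (cvg_comp _ (co j) cv).
exact: differentiable_continuous (differentiable_co j v0).
Qed.

Lemma cvg_zreim (T : Type) (F : set_system T) (FF : Filter F) (v : T -> 'rV[R]_6) v0 n :
  v @ F --> v0 ->
  zre n (v t) @[t --> F] --> zre n v0 /\ zim n (v t) @[t --> F] --> zim n v0.
Proof.
move=> cv; have [dr di] := differentiable_zreim n v0; split.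
  by apply: (cvg_comp _ (zre n) cv); exact: differentiable_continuous dr.
by apply: (cvg_comp _ (zim n) cv); exact: differentiable_continuous di.
Qed.

Lemma cvg_inv_ (T : Type) (F : set_system T) (FF : Filter F) (v : T -> 'rV[R]_6) v0 b :
  v @ F --> v0 -> cvg_inv F (fun t => inv_ k b (v t)) (inv_ k b v0).
Proof.
move=> cv; have [cr ci] := cvg_zreim FF k cv.
have c_ j : co j (v t) @[t --> F] --> co j v0 by exact: cvg_co.
have sq (f : T -> R) (a : R) : f @ F --> a -> f t ^+ 2 @[t --> F] --> a ^+ 2.
  by move=> fa; rewrite expr2; under eq_fun do rewrite expr2; exact: cvgM.
have cur : ure k (v t) @[t --> F] --> ure k v0 by apply: cvgD.
have cui : uim k (v t) @[t --> F] --> uim k v0 by apply: cvgD.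
have mk (f g : T -> R) (f0 g0 : R) : f @ F --> f0 -> g @ F --> g0 ->
  cvg_inv F (fun t => mkinv (f t) (g t) (zre k (v t)) (zim k (v t)) (co 4 (v t)) (co 5 (v t)))
    (mkinv f0 g0 (zre k v0) (zim k v0) (co 4 v0) (co 5 v0)).
  move=> cf cg; split => /=.
  - by apply: cvgD; exact: sq.
  - by apply: cvgD; exact: cvgM.
  - by apply: cvgD; exact: sq.
  - by apply: cvgD; exact: sq.
by case: b; apply: mk => //; exact: cvgN.
Qed.

(** At the boundary the depth is 0 and the collar move reduces to the core move: the compatibility
    needed for gluing. *)
Lemma coef_collar_boundary b tau rho tau' rho' v : 0 < ia (inv_ k b v) ->
  25 * ia (inv_ k b v) = id_ (inv_ k b v) ->
  coef_collar b tau rho tau' rho' v = coef_core b tau rho tau' rho' v.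
Proof.
move=> a0 bd; have n0 : depth k (inv_ k b v) = 0.
  by rewrite /depth -bd divff ?ln1 ?mul0r // gt_eqF // mulr_gt0.
by rewrite /coef_collar /coef_core /to_boundary /new_depth n0 act00 mul0r subr0.
Qed.

(** A piece whose closure misses v0 is eventually avoided by v, so its limit is vacuous; the formula
    of every other piece takes at v0 the value of [coefs]. *)
Lemma coefs_cvg (T : Type) (F : set_system T) (FF : Filter F) (rho rho' : R)
    (tau tau' : T -> R) (tau0 tau0' : R) (v : T -> 'rV[R]_6) v0 :
  (\forall t \near F, valid (tau t) rho (tau' t) rho' (v t)) ->
  valid tau0 rho tau0' rho' v0 ->
  tau @ F --> tau0 -> tau' @ F --> tau0' -> v @ F --> v0 ->
  coefs (tau t) rho (tau' t) rho' (v t) @[t --> F] --> coefs tau0 rho tau0' rho' v0.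
Proof.
move=> nv vv0 ct ct' cv; have [x0 u0 g g' pE] := vv0.
have cI b := cvg_inv_ FF b cv.
have a0 b : 0 < ia (inv_ k b v0) by have := coherent_a (coherent_inv b x0 u0).
have cb b : 25 * ia (inv_ k b (v t)) - id_ (inv_ k b (v t)) @[t --> F]
    --> 25 * ia (inv_ k b v0) - id_ (inv_ k b v0).
  have [ca cc cd ce] := cI b; apply: cvgB => //; apply: cvgM => //; exact: cvg_cst.
have far b : id_ (inv_ k b v0) < 25 * ia (inv_ k b v0) ->
    F [set t | ~~ near_zero b (v t)].
  rewrite -subr_gt0 => h.
  have hh : F [set t | 0 < 25 * ia (inv_ k b (v t)) - id_ (inv_ k b (v t))] .
    exact: (cvgr_gt _ (cb b) _ h).
  by apply: filterS hh => t /=; rewrite subr_gt0 /near_zero -ltNge.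
have close b : 25 * ia (inv_ k b v0) < id_ (inv_ k b v0) ->
    F [set t | near_zero b (v t)].
  rewrite -subr_lt0 => h.
  have hh : F [set t | 25 * ia (inv_ k b (v t)) - id_ (inv_ k b (v t)) < 0] .
    exact: (cvgr_lt _ (cb b) _ h).
  by apply: filterS hh => t /=; rewrite subr_lt0 /near_zero => /ltW.
have ccollar b (G : set_system T) : Filter G -> G `=>` F ->
    (\forall t \near G, near_zero b (v t)) -> near_zero b v0 ->
    coef_collar b (tau t) rho (tau' t) rho' (v t) @[t --> G]
      --> coef_collar b tau0 rho tau0' rho' v0.
  move=> FG GF nG n0.
  have GG (U : topologicalType) (f : T -> U) (l : U) : f @ F --> l -> f @ G --> l.
    by move=> fl A lA; have h : F (f @^-1` A) := fl A lA; exact: GF _ h.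
  have [|||||h1 h2] := @cvg_collar_rescaling R k k2 T G FG b rho rho' tau tau' tau0 tau0'
    (fun t => inv_ k b (v t)) (inv_ k b v0).
  - by apply: filterS2 nG (GF _ nv) => t r0 vt; exact: valid_admissible.
  - exact: valid_admissible.
  - exact: GG.
  - exact: GG.
  - by have [ca cc cd ce] := cI b; split; exact: GG.
  - exact: cvg_coef.
have sub (C : set T) (G : set_system T) : Filter G -> G `=>` F -> within C G `=>` F.
  by move=> FG GF; apply: cvg_trans GF; exact: cvg_within.
have FF_sub : F `=>` F by [].
have nearW_ (G : set_system T) (b : bool) : Filter G ->
    \forall t \near within [set t | near_zero b (v t)] G, near_zero b (v t).
  by move=> FG; exact: withinT.
apply: cvg_if_within.
  have [r0|] := boolP (near_zero false v0); last first.
    rewrite /near_zero -ltNge => /far h.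
    by apply: cvg_within_false; apply: filterS h => t /= /negP.
  rewrite /coefs r0.
  by apply: (ccollar false _ (within_filter _ FF)) => //; [exact: sub|exact: nearW_].
set F1 := within _ F.
have FF1 : Filter F1 := within_filter _ FF.
have F1F : F1 `=>` F by exact: sub.
apply: cvg_if_within.
  have [r1|] := boolP (near_zero true v0); last first.
    rewrite /near_zero -ltNge => /far h.
    by apply: cvg_within_false; apply: F1F; apply: filterS h => t /= /negP.
  rewrite /coefs (negbTE (near_zero_excl x0 u0 r1)) r1.
  by apply: (ccollar true _ (within_filter _ FF1)) => //; [exact: sub|exact: nearW_].
set F2 := within _ F1.
have FF2 : Filter F2 := within_filter _ FF1.
have F2F : F2 `=>` F by exact: sub.
(* Strictly inside a collar, the core branch is eventually never selected. *)
have trivial_near b : 25 * ia (inv_ k b v0) < id_ (inv_ k b v0) ->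
    coef_core false (tau t) rho (tau' t) rho' (v t) @[t --> F2]
      --> coefs tau0 rho tau0' rho' v0.
  move=> /close h; apply: cvg_within_false; rewrite /F1 /within /=.
  by apply: filterS h => t; case: b => -> //= _ /negP.
have [h0|h0] := ltP (25 * ia (inv_ k false v0)) (id_ (inv_ k false v0)).
  exact: (trivial_near false).
have [h1|h1] := ltP (25 * ia (inv_ k true v0)) (id_ (inv_ k true v0)).
  exact: (trivial_near true).
have -> : coefs tau0 rho tau0' rho' v0 = coef_core false tau0 rho tau0' rho' v0.
  rewrite /coefs; case: ifP => r0.
    by apply: coef_collar_boundary => //; apply/le_anti; rewrite h0 andbT.
  case: ifP => r1 //; rewrite -(coef_coreE true).
  by apply: coef_collar_boundary => //; apply/le_anti; rewrite h1 andbT.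
have GG (U : topologicalType) (f : T -> U) (l : U) : f @ F --> l -> f @ F2 --> l.
  by move=> fl A lA; have h : F (f @^-1` A) := fl A lA; exact: F2F _ h.
apply: cvg_coef; last exact: cvg_cst.
apply: core_shift_cvg => //; first last.
- by have [ca cc cd ce] := cI false; split; exact: GG.
- exact: GG.
- exact: GG.
- split => //; first exact: coherent_inv.
  by split => //; move: h1; rewrite ia_inv !id_inv ig_inv.
- rewrite /F2 /F1 /within /=; apply: filterS nv => t [x0' u0' gt gt' _] r0 r1.
  by split => //; [exact: (coherent_inv false x0' u0')|exact: (core_near r0 r1)].
Qed.

End Transport.

(** * Transport from tube to tube over a prescribed value *)

Section TubeTransport.
Variables (R : realType) (k : nat).
Hypothesis k2 : (2 <= k)%N.
Let K : R := k%:R.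
Implicit Types (v : 'rV[R]_6) (w : 'rV[R]_2) (rho : R).

(** After (x, z) is moved, y is set to w conj(h) / |h|^2 = w / h. As h ignores y, it is read at the
    moved point with y = 0. *)
Definition transport rho rho' v w : 'rV[R]_6 :=
  let c := coefs k (n2 (Fk k v)) rho (n2 w) rho' v in
  let v' := mv k c v 0 0 in
  let s := x2 v' * u2 k v' in
  mv k c v ((w 0 0 * h1 k v' + w 0 1 * h2 k v') / s)
           ((w 0 1 * h1 k v' - w 0 0 * h2 k v') / s).

Definition in_tube rho v := enorm v <= 2 * rho /\ small k (n2 (Fk k v)) rho.

Lemma mvE c v (y1 y2 : R) : mv k c v y1 y2 =
  mk6 (c.1.1 * co 0 v + c.1.2 * zre k v) (c.1.1 * co 1 v + c.1.2 * zim k v) y1 y2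
      (c.2 * co 4 v) (c.2 * co 5 v).
Proof. by case: c => [[A C] B]. Qed.

Lemma xz_congr v v' : co 0 v' = co 0 v -> co 1 v' = co 1 v ->
    co 4 v' = co 4 v -> co 5 v' = co 5 v ->
  [/\ x2 v' = x2 v, u2 k v' = u2 k v, h1 k v' = h1 k v & h2 k v' = h2 k v].
Proof.
move=> e0 e1 e4 e5.
have [zr zi] : zre k v' = 1 ^+ k * zre k v /\ zim k v' = 1 ^+ k * zim k v.
  by apply: zreimZ; rewrite mul1r.
by rewrite /h1 /h2 /x2 /u2 /ure /uim zr zi e0 e1 expr1n !mul1r.
Qed.

Lemma Fk_solve v w (s := x2 v * u2 k v) : s != 0 ->
  co 2 v = (w 0 0 * h1 k v + w 0 1 * h2 k v) / s ->
  co 3 v = (w 0 1 * h1 k v - w 0 0 * h2 k v) / s -> Fk k v = w.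
Proof.
move=> s0 e2 e3; have hs : h1 k v ^+ 2 + h2 k v ^+ 2 = s := h_norm k v.
apply/rowP => j.
have [->|j0] := eqVneq j 0.
  rewrite FkE0 FreE e2 e3 -[RHS](mulfK s0) -{3}hs.
  by move: (h1 k v) (h2 k v) s s0 {e2 e3 hs} => a b s s0; field.
have -> : j = 1 by apply/val_inj; case: j j0 => [[|[|]]].
rewrite FkE1 FimE e2 e3 -[RHS](mulfK s0) -{3}hs.
by move: (h1 k v) (h2 k v) s s0 {e2 e3 hs} => a b s s0; field.
Qed.

Lemma in_tube_valid rho rho' v w : in_tube rho v -> small k (n2 w) rho' ->
  valid k (n2 (Fk k v)) rho (n2 w) rho' v.
Proof.
move=> [ve g] g'; have [_ _ F0 _] := g; have [x0 u0] := n2_gt0 F0.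
split => //; rewrite fibre_norm_inv //.
have -> : 4 * rho ^+ 2 = (2 * rho) ^+ 2 by ring.
by rewrite lerXn2r ?nnegrE ?sqrtr_ge0 // (le_trans _ ve) // sqrtr_ge0.
Qed.

Lemma transportP rho rho' v w (p := transport rho rho' v w) :
  in_tube rho v -> small k (n2 w) rho' ->
  [/\ Fk k p = w, in_tube rho' p & transport rho' rho p (Fk k v) = v].
Proof.
move=> tv gw; have vv := in_tube_valid tv gw; have [_ gv] := tv.
have [_ _ Fv0 _] := gv; have [r0' _ _ _] := gw.
have [b [l [n [cE hc]]]] := coefs_spec k2 vv.
pose v' := mv k (coef k b l n) v 0 0.
have pE : p = mv k (coef k b l n) v ((w 0 0 * h1 k v' + w 0 1 * h2 k v') / (x2 v' * u2 k v'))
     ((w 0 1 * h1 k v' - w 0 0 * h2 k v') / (x2 v' * u2 k v')).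
  by rewrite /p /transport cE.
have [vp cp] : valid k (n2 w) rho' (n2 (Fk k v)) rho p /\
    coefs k (n2 w) rho' (n2 (Fk k v)) rho p = coef k b (- l) (- n).
  by rewrite pE; exact: hc.
have [xp up _ _ PPp] := vp.
have sp : x2 p * u2 k p != 0 by rewrite mulf_neq0 ?gt_eqF.
have [ex eu e1 e2] : [/\ x2 v' = x2 p, u2 k v' = u2 k p, h1 k v' = h1 k p & h2 k v' = h2 k p].
  by apply: xz_congr; rewrite pE /v' !mvE !co_mk6.
have Fp : Fk k p = w.
  by apply: Fk_solve sp _ _; rewrite {1}pE mvE !co_mk6 ex eu e1 e2.
split => //.
  split; last by rewrite Fp.
  have [_ _ w0 _] := gw.
  have := PPp; rewrite -Fp fibre_norm_inv ?Fp //.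
  have -> : 4 * rho' ^+ 2 = (2 * rho') ^+ 2 by ring.
  by rewrite ler_pXn2r // nnegrE ?sqrtr_ge0 // mulr_ge0 // ltW.
rewrite /transport Fp cp.
set v'' := mv k (coef k b (- l) (- n)) p 0 0.
have v''E y1 y2 : mv k (coef k b (- l) (- n)) p y1 y2 =
    mk6 (co 0 v) (co 1 v) y1 y2 (co 4 v) (co 5 v) by rewrite pE mvK.
have [-> -> -> ->] : [/\ x2 v'' = x2 v, u2 k v'' = u2 k v, h1 k v'' = h1 k v & h2 k v'' = h2 k v].
  by apply: xz_congr; rewrite /v'' v''E !co_mk6.
have [xv uv] := n2_gt0 Fv0; have sv : x2 v * u2 k v != 0 by rewrite mulf_neq0 ?gt_eqF.
rewrite v''E FkE0 FkE1 FreE FimE -[RHS]mk6_eta -(h_norm k v).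
move: sv; rewrite -(h_norm k v).
move: (h1 k v) (h2 k v) (co 2 v) (co 3 v) => a d y1 y2 s0.
by congr mk6; field.
Qed.

Lemma cvg_mk6 (T : Type) (F : set_system T) (FF : Filter F)
    (f0 f1 f2 f3 f4 f5 : T -> R) (l0 l1 l2 l3 l4 l5 : R) :
  f0 @ F --> l0 -> f1 @ F --> l1 -> f2 @ F --> l2 -> f3 @ F --> l3 ->
  f4 @ F --> l4 -> f5 @ F --> l5 ->
  mk6 (f0 t) (f1 t) (f2 t) (f3 t) (f4 t) (f5 t) @[t --> F] --> mk6 l0 l1 l2 l3 l4 l5.
Proof.
move=> c0 c1 c2 c3 c4 c5; apply: cvg_mx => i j; rewrite mxE.
under eq_fun do rewrite mxE.
by case: j => [[|[|[|[|[|[|//]]]]]] hj].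
Qed.

Lemma cvg_mv (T : Type) (F : set_system T) (FF : Filter F)
    (c : T -> R * R * R) (v : T -> 'rV[R]_6) (y1 y2 : T -> R) c0 v0 (l1 l2 : R) :
  c @ F --> c0 -> v @ F --> v0 -> y1 @ F --> l1 -> y2 @ F --> l2 ->
  mv k (c t) (v t) (y1 t) (y2 t) @[t --> F] --> mv k c0 v0 l1 l2.
Proof.
move=> cc cv c1 c2; have [cr ci] := cvg_zreim FF k cv.
have cco j : co j (v t) @[t --> F] --> co j v0 by exact: cvg_co.
have cB : (c t).2 @[t --> F] --> c0.2 by apply: (cvg_comp _ snd cc); exact: cvg_snd.
have c1_ : (c t).1 @[t --> F] --> c0.1 by apply: (cvg_comp _ fst cc); exact: cvg_fst.
have cA : (c t).1.1 @[t --> F] --> c0.1.1 by apply: (cvg_comp _ fst c1_); exact: cvg_fst.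
have cC : (c t).1.2 @[t --> F] --> c0.1.2 by apply: (cvg_comp _ snd c1_); exact: cvg_snd.
rewrite mvE; under eq_fun do rewrite mvE.
by apply: cvg_mk6 => //; [apply: cvgD; apply: cvgM|apply: cvgD; apply: cvgM|
  apply: cvgM|apply: cvgM] => //; exact: cco.
Qed.

Lemma cvg_sqr (T : Type) (F : set_system T) (FF : Filter F) (f : T -> R) (a : R) :
  f @ F --> a -> f t ^+ 2 @[t --> F] --> a ^+ 2.
Proof. by move=> fa; rewrite expr2; under eq_fun do rewrite expr2; exact: cvgM. Qed.

Lemma cvg_xuh (T : Type) (F : set_system T) (FF : Filter F) (v : T -> 'rV[R]_6) v0 :
  v @ F --> v0 ->
  [/\ x2 (v t) @[t --> F] --> x2 v0, u2 k (v t) @[t --> F] --> u2 k v0,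
      h1 k (v t) @[t --> F] --> h1 k v0 & h2 k (v t) @[t --> F] --> h2 k v0].
Proof.
move=> cv; have [cr ci] := cvg_zreim FF k cv.
have c0 : co 0 (v t) @[t --> F] --> co 0 v0 by exact: cvg_co.
have c1 : co 1 (v t) @[t --> F] --> co 1 v0 by exact: cvg_co.
have cur : ure k (v t) @[t --> F] --> ure k v0 by apply: cvgD.
have cui : uim k (v t) @[t --> F] --> uim k v0 by apply: cvgD.
split.
- by apply: cvgD; exact: cvg_sqr.
- by apply: cvgD; exact: cvg_sqr.
- by apply: cvgD; exact: cvgM.
- by apply: cvgB; exact: cvgM.
Qed.

Lemma cvg_entry (T : Type) (F : set_system T) (FF : Filter F) (w : T -> 'rV[R]_2) w0 j :
  w @ F --> w0 -> w t 0 j @[t --> F] --> w0 0 j.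
Proof.
move=> cw.
exact: (cvg_comp _ (fun M : 'rV[R]_2 => M 0 j) cw (@coord_continuous _ _ _ 0 j w0)).
Qed.

Lemma cvg_n2 (T : Type) (F : set_system T) (FF : Filter F) (w : T -> 'rV[R]_2) w0 :
  w @ F --> w0 -> n2 (w t) @[t --> F] --> n2 w0.
Proof. by move=> cw; apply: cvgD; apply: cvg_sqr; exact: cvg_entry. Qed.

Lemma transport_cvg (T : Type) (F : set_system T) (FF : Filter F) rho rho'
    (v : T -> 'rV[R]_6) (w : T -> 'rV[R]_2) v0 w0 :
  (\forall t \near F, in_tube rho (v t) /\ small k (n2 (w t)) rho') ->
  in_tube rho v0 -> small k (n2 w0) rho' -> v @ F --> v0 -> w @ F --> w0 ->
  transport rho rho' (v t) (w t) @[t --> F] --> transport rho rho' v0 w0.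
Proof.
move=> near_ tv0 gw0 cv cw; have vv0 := in_tube_valid tv0 gw0.
have cF : Fk k (v t) @[t --> F] --> Fk k v0.
  apply: (cvg_comp _ (@Fk R k) cv).
  exact: differentiable_continuous (@differentiable_Fk R k v0).
have cc : coefs k (n2 (Fk k (v t))) rho (n2 (w t)) rho' (v t) @[t --> F]
    --> coefs k (n2 (Fk k v0)) rho (n2 w0) rho' v0.
  apply: coefs_cvg => //; [|exact: cvg_n2|exact: cvg_n2].
  by apply: filterS near_ => t [tv gw]; exact: in_tube_valid.
have [b [l [n [cE hc]]]] := coefs_spec k2 vv0.
have [[x0 u0 _ _ _] _] := hc 0 0; rewrite -cE in x0 u0.
have c00 : (fun=> 0 : R) @ F --> (0 : R) by exact: cvg_cst.
have [cx cu c1 c2] := cvg_xuh FF (cvg_mv FF cc cv c00 c00).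
have cw0 : w t 0 0 @[t --> F] --> w0 0 0 by exact: cvg_entry.
have cw1 : w t 0 1 @[t --> F] --> w0 0 1 by exact: cvg_entry.
have cs := cvgV (lt0r_neq0 (mulr_gt0 x0 u0)) (cvgM cx cu).
apply: cvg_mv => //; apply: cvgM; [|exact: cs| |exact: cs].
  by apply: cvgD; exact: cvgM.
by apply: cvgB; exact: cvgM.
Qed.

(** With rho = eps / 2, this is the largest t such that 50^2 t^2 <= rho^(4k) rho^2, the last
    condition of [small]. *)
Definition eta_bound (eps : R) : R := ((eps / 2) ^+ k) ^+ 2 * (eps / 2) / 50.

Lemma punctured_good (eps eta : R) w : 0 < eps <= K^-1 -> 0 < eta <= eta_bound eps ->
  punctured_ball eta w -> small k (n2 w) (eps / 2).
Proof.
move=> /andP[e0 eK] /andP[t0 tb] [wt w0].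
have K0 : 0 < K by rewrite /K ltr0n (leq_trans _ k2).
split.
- by rewrite divr_gt0.
- have := eK; rewrite -[K^-1]div1r ler_pdivlMr // => eK1.
  by rewrite -/K; lra.
- have n0 : 0 <= n2 w by rewrite addr_ge0 ?sqr_ge0.
  rewrite lt0r n0 andbT; apply: contraNneq w0 => /eqP.
  rewrite paddr_eq0 ?sqr_ge0 // !sqrf_eq0 => /andP[/eqP w00 /eqP w01].
  apply/eqP/rowP => j; rewrite mxE.
  have [->//|j0] := eqVneq j 0.
  by have -> : j = 1 by apply/val_inj; case: j j0 => [[|[|]]].
- have we : enorm w ^+ 2 <= eta_bound eps ^+ 2.
    by rewrite lerXn2r ?nnegrE ?sqrtr_ge0 // ?(le_trans (ltW t0) tb) // (le_trans (ltW wt)).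
  move: we; rewrite enorm2E /eta_bound; set r := (eps / 2) ^+ k.
  have -> : (r ^+ 2 * (eps / 2) / 50) ^+ 2 = r ^+ 4 * (eps / 2) ^+ 2 / 50 ^+ 2 by field.
  by rewrite ler_pdivlMr ?exprn_gt0 // mulrC.
Qed.

Lemma tube_in_tube (eps eta : R) v : 0 < eps <= K^-1 -> 0 < eta <= eta_bound eps ->
  milnor_tube (@Fk R k) eps eta v -> in_tube (eps / 2) v.
Proof.
move=> he ht [ve pv]; split; last exact: punctured_good pv.
by rewrite mulrC divfK.
Qed.

End TubeTransport.

(** * The Milnor tube fibration *)

Section MilnorTube.
Variables (R : realType) (k : nat).
Hypothesis k2 : (2 <= k)%N.
Let K : R := k%:R.

Let adm (eps eta : R) := 0 < eps <= K^-1 /\ 0 < eta <= eta_bound k eps.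

Lemma within_cvg_id (T U : topologicalType) (A : set T) (f : T -> U) (l : U) (x : T) :
  f @ nbhs x --> l -> f @ within A (nbhs x) --> l.
Proof.
move=> fl B lB; have h : nbhs x (f @^-1` B) := fl B lB.
by apply: filterS h => t.
Qed.

Lemma transport_tube (eps eta eps' eta' : R) v w : adm eps eta -> adm eps' eta' ->
  milnor_tube (@Fk R k) eps eta v -> punctured_ball eta' w ->
  let p := transport k (eps / 2) (eps' / 2) v w in
  [/\ Fk k p = w, milnor_tube (@Fk R k) eps' eta' p &
      transport k (eps' / 2) (eps / 2) p (Fk k v) = v].
Proof.
move=> [he ht] [he' ht'] tv pw p.
have iv := tube_in_tube k2 he ht tv.
have gw := punctured_good k2 he' ht' pw.
have [Fp [ep _] back] := transportP k2 iv gw.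
split => //; split; last by rewrite Fp.
by rewrite -[leRHS](divfK (lt0r_neq0 (ltr0n _ 2))) mulrC.
Qed.

Lemma transport_within (T : topologicalType) (A : set T) (eps eta eps' eta' : R)
    (v : T -> 'rV[R]_6) (w : T -> 'rV[R]_2) : adm eps eta -> adm eps' eta' ->
  (forall x, A x -> milnor_tube (@Fk R k) eps eta (v x) /\ punctured_ball eta' (w x)) ->
  (forall x, A x -> v @ within A (nbhs x) --> v x) ->
  (forall x, A x -> w @ within A (nbhs x) --> w x) ->
  {within A, continuous (fun x => transport k (eps / 2) (eps' / 2) (v x) (w x))}.
Proof.
move=> [he ht] [he' ht'] hA cv cw; apply/subspace_continuousP => x Ax.
have iv y : A y -> in_tube k (eps / 2) (v y).
  by move=> /hA[tv _]; exact: tube_in_tube tv.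
have gw y : A y -> small k (n2 (w y)) (eps' / 2).
  by move=> /hA[_ pw]; exact: punctured_good pw.
apply: transport_cvg => //; [|exact: iv|exact: gw|exact: cv|exact: cw].
by apply: filterS (withinT A _) => y Ay; split; [exact: iv|exact: gw].
Qed.

Lemma Fk_continuous : continuous (@Fk R k).
Proof. by move=> v; exact: differentiable_continuous (@differentiable_Fk R k v). Qed.

Lemma enormZ (a : R) (w : 'rV[R]_2) : 0 <= a -> enorm (a *: w) = a * enorm w.
Proof.
move=> a0; rewrite /enorm -[X in X * _](ger0_norm a0) -sqrtr_sqr -sqrtrM ?sqr_ge0 //.
by congr Num.sqrt; rewrite mulr_sumr; apply: eq_bigr => i _; rewrite mxE exprMn.
Qed.

Lemma punctured_ballZ (eta eta' : R) w : 0 < eta -> 0 < eta' ->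
  punctured_ball eta w -> punctured_ball eta' ((eta' / eta) *: w : 'rV[R]_2).
Proof.
move=> t0 t0' [wt w0]; have q0 : 0 < eta' / eta by rewrite divr_gt0.
split; last by rewrite scaler_eq0 negb_or w0 gt_eqF.
rewrite enormZ; last exact: ltW.
by rewrite mulrAC ltr_pdivrMr // ltr_pM2l.
Qed.

Lemma milnor_tube_locally_trivial (eps eta : R) : adm eps eta ->
  locally_trivial (milnor_tube (@Fk R k) eps eta) (punctured_ball eta) (@Fk R k).
Proof.
move=> ad; split; first by move=> v [].
(* [transport] reaches every value of the punctured ball, so a single trivialization serves the
   whole base. *)
move=> w0 pw0; exists setT; split => //; first exact: openT.
exists (fun v => transport k (eps / 2) (eps / 2) v w0),
       (fun wv => transport k (eps / 2) (eps / 2) wv.2 wv.1).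
split.
- have ct : {within milnor_tube (@Fk R k) eps eta `&` (@Fk R k) @^-1` (setT `&` punctured_ball eta),
      continuous (fun v => transport k (eps / 2) (eps / 2) v w0)}.
    apply: (transport_within ad ad) => [v [tv _]|v _|v _] //.
      by apply: within_cvg_id; exact: cvg_id.
    by apply: within_cvg_id; exact: cvg_cst.
  apply/subspace_continuousP => v tv; apply: cvg_pair_nbhs.
    by apply: within_cvg_id; exact: Fk_continuous.
  by move/subspace_continuousP : ct; apply.
- apply: (transport_within ad ad) => [[w v] /= [[_ pw] [tv _]]|x _|x _] //.
    by apply: within_cvg_id; exact: cvg_snd.
  by apply: within_cvg_id; exact: cvg_fst.
- move=> v [tv _].
  have [Fp tp back] := transport_tube ad ad tv pw0.
  by split => //=; split; [split => //; case: tv|split].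
- move=> [w v] /= [[_ pw] [tv Fv]].
  have [Fp tp back] := transport_tube ad ad tv pw.
  split; first by split => //=; rewrite Fp; split.
  by rewrite Fv in back; rewrite Fp back.
Qed.

(** The homothety of ratio eta' / eta on the base is covered by [transport] to the scaled value of
    F. *)
Lemma milnor_tube_top_equivalent (eps eta eps' eta' : R) : adm eps eta -> adm eps' eta' ->
  top_equivalent (milnor_tube (@Fk R k) eps eta) (punctured_ball eta) (@Fk R k)
                 (milnor_tube (@Fk R k) eps' eta') (punctured_ball eta') (@Fk R k).
Proof.
move=> ad ad'; have [_ /andP[t0 _]] := ad; have [_ /andP[t0' _]] := ad'.
pose s (a b : R) (w : 'rV[R]_2) := (b / a) *: w.
have sK (a b : R) w : 0 < a -> 0 < b -> s b a (s a b w) = w.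
  by move=> a0 b0; rewrite /s scalerA mulrA divfK ?divff ?scale1r ?gt_eqF.
have cs a b : continuous (s a b) by move=> w; exact: scaler_continuous.
exists (fun v => transport k (eps / 2) (eps' / 2) v (s eta eta' (Fk k v))),
       (fun v => transport k (eps' / 2) (eps / 2) v (s eta' eta (Fk k v))),
       (s eta eta'), (s eta' eta).
have half (e1 t1 e2 t2 : R) : adm e1 t1 -> adm e2 t2 -> 0 < t1 -> 0 < t2 ->
   {within milnor_tube (@Fk R k) e1 t1, continuous
      (fun v => transport k (e1 / 2) (e2 / 2) v (s t1 t2 (Fk k v)))} /\
   (forall v, milnor_tube (@Fk R k) e1 t1 v ->
      let p := transport k (e1 / 2) (e2 / 2) v (s t1 t2 (Fk k v)) in
      milnor_tube (@Fk R k) e2 t2 p /\ Fk k p = s t1 t2 (Fk k v) /\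
      transport k (e2 / 2) (e1 / 2) p (s t2 t1 (Fk k p)) = v).
  move=> a1 a2 p1 p2; split.
    apply: (transport_within a1 a2) => [v tv|v _|v _].
    - by split => //; apply: punctured_ballZ => //; case: tv.
    - by apply: within_cvg_id; exact: cvg_id.
    - apply: within_cvg_id.
      by apply: (@continuous_comp _ _ _ (@Fk R k) (s t1 t2)); [exact: Fk_continuous|exact: cs].
  move=> v tv p; have pw : punctured_ball t2 (s t1 t2 (Fk k v)).
    by apply: punctured_ballZ => //; case: tv.
  have [Fp tp back] := transport_tube a1 a2 tv pw.
  by rewrite -/p in Fp tp back; split; [exact: tp|rewrite Fp sK].
have [c1 h1] := half _ _ _ _ ad ad' t0 t0'.
have [c2 h2] := half _ _ _ _ ad' ad t0' t0.
split.
- split; [exact: c1|exact: c2| |] => v tv.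
    by have [tp [_ back]] := h1 v tv; split; [exact: tp|exact: back].
  by have [tp [_ back]] := h2 v tv; split; [exact: tp|exact: back].
- split.
  + by apply: continuous_subspaceT => w; exact: cs.
  + by apply: continuous_subspaceT => w; exact: cs.
  + by move=> w pw; split; [exact: punctured_ballZ|exact: sK].
  + by move=> w pw; split; [exact: punctured_ballZ|exact: sK].
- by move=> v tv; have [_ []] := h1 v tv.
Qed.

Lemma Fk_milnor_tube_fibration : milnor_tube_fibration (@Fk R k).
Proof.
have K0 : 0 < K by rewrite /K ltr0n (leq_trans _ k2).
split; [exact/Fk_nonconstant/ltnW|exact: isolated_critical_value_Fk|].
exists K^-1, (eta_bound k); split.
- by rewrite invr_gt0.
- move=> eps /andP[e0 eK]; rewrite /eta_bound.
  have h0 : 0 < eps / 2 by rewrite divr_gt0.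
  have h1 : eps / 2 <= 1.
    have : K^-1 <= 1 by rewrite invf_le1 // /K ler1n ltnW.
    by lra.
  rewrite divr_gt0 ?mulr_gt0 ?exprn_gt0 //=.
  have : ((eps / 2) ^+ k) ^+ 2 * (eps / 2) <= eps / 2.
    by rewrite ler_piMl ?(ltW h0) // !exprn_ile1 ?exprn_ge0 // ltW.
  by rewrite ltr_pdivrMr //; lra.
- by move=> eps eta /andP[h h']; exact: (milnor_tube_locally_trivial (conj h h')).
- move=> eps eta eps' eta' /andP[h1 h2] /andP[h3 h4].
  exact: (milnor_tube_top_equivalent (conj h1 h2) (conj h3 h4)).
Qed.

End MilnorTube.

Theorem mainTheorem6 (R : realType) (k : nat) (hk : (2 <= k)%N) :
  [/\ isolated_critical_value (@Fk R k),
      nonisolated_singularities (@Fk R k),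
      milnor_tube_fibration (@Fk R k) &
      ~ thom_regular (@Fk R k)].
Proof.
split.
- exact: isolated_critical_value_Fk.
- exact: nonisolated_singularities_Fk.
- exact: Fk_milnor_tube_fibration.
- exact: Fk_not_thom_regular.
Qed.
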